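(* Let $d\ge 2$ and let $\Omega\subset\mathbb{R}^d$ be a bounded, connected, open set with boundary $\Gamma$, let $\sigma$ be the $(d-1)$-dimensional Hausdorff measure on $\Gamma$, and assume $\sigma(\Gamma)<\infty$. Then the following are equivalent. (i) The Dirichlet-to-Neumann operator $D_0$ on $L_2(\Gamma)$ has a compact resolvent. (ii) The map $j\colon D(\ell)\to L_2(\Gamma)$ defined by $j(u)=u|_\Gamma$ is compact, where $D(\ell)=H^1(\Omega)\cap C(\overline\Omega)$ is equipped with the norm $u\mapsto\Big(\int_\Omega|\nabla u|^2+\int_\Gamma|u|^2\,d\sigma\Big)^{1/2}$. (iii) The trace on $\Omega$ is unique and the map $\mathrm{Tr}$ is compact from $H^1_\sigma(\Omega)$ into $L_2(\Gamma)$. (iv) Every element in $\widetilde H^1(\Omega)$ has a unique trace and the map $\mathrm{Tr}\colon\widetilde H^1(\Omega)\to L_2(\Gamma)$ is compact.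
   Context: All spaces are real. $L_2(\Gamma)=L_2(\Gamma,\sigma)$, $H^1(\Omega)$ is the Sobolev space with norm $\|u\|_{H^1(\Omega)}^2=\int_\Omega|u|^2+\int_\Omega|\nabla u|^2$, $H^1(\Omega)\cap C(\overline\Omega)$ is the set of $u\in C(\overline\Omega)$ whose restriction to $\Omega$ lies in $H^1(\Omega)$, and $\widetilde H^1(\Omega)$ is the closure of $H^1(\Omega)\cap C(\overline\Omega)$ in $H^1(\Omega)$, with the norm of $H^1(\Omega)$. The operator $\Delta$ is the distributional Laplacian on $\Omega$. A linear map between normed spaces is compact if it maps bounded sets to relatively compact sets. Trace: for $u\in H^1(\Omega)$, a function $\varphi\in L_2(\Gamma)$ is called a trace of $u$ if there is a sequence $(u_n)$ in $H^1(\Omega)\cap C(\overline\Omega)$ with $\lim u_n=u$ in $H^1(\Omega)$ and $\lim u_n|_\Gamma=\varphi$ in $L_2(\Gamma)$. The trace on $\Omega$ is unique if $\varphi=0$ is the only trace of $u=0$. For Borel $B\subset\Gamma$ write $L_2(B)=\{\varphi\in L_2(\Gamma):\varphi=0\text{ a.e. on }\Gamma\setminus B\}$. It is known that there is a Borel set $\Gamma_\sigma\subset\Gamma$, unique up to $\sigma$-null sets, such that $\{\varphi\in L_2(\Gamma):\varphi\text{ is a trace of }0\}=L_2(\Gamma\setminus\Gamma_\sigma)$. $H^1_\sigma(\Omega)$ is the set of all $u\in H^1(\Omega)$ which have a trace, and $\mathrm{Tr}\colon H^1_\sigma(\Omega)\to L_2(\Gamma_\sigma)\subset L_2(\Gamma)$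 is the unique map such that $\mathrm{Tr}\,u\in L_2(\Gamma_\sigma)$ is a trace of $u$. The norm on $H^1_\sigma(\Omega)$ is $\|u\|_{H^1_\sigma(\Omega)}^2=\int_\Omega|\nabla u|^2+\int_{\Gamma_\sigma}|\mathrm{Tr}\,u|^2\,d\sigma$. Normal derivative: let $u\in H^1(\Omega)$ with $\Delta u\in L_2(\Omega)$. Then $u$ has a normal derivative in $L_2(\Gamma)$ if there is a (necessarily unique) $\psi\in L_2(\Gamma)$ such that $\int_\Omega(\Delta u)\,v+\int_\Omega\nabla u\cdot\nabla v=\int_\Gamma\psi\,v\,d\sigma$ for all $v\in H^1(\Omega)\cap C(\overline\Omega)$; then $\frac{\partial u}{\partial\nu}:=\psi$. Dirichlet-to-Neumann operator: for $\varphi,\psi\in L_2(\Gamma)$ one has $\varphi\in D(D_0)$ and $D_0\varphi=\psi$ if and only if there is a $u\in H^1(\Omega)$ such that $\Delta u=0$, $\varphi$ is a trace of $u$, and $u$ has a normal derivative in $L_2(\Gamma)$ with $\frac{\partial u}{\partial\nu}=\psi$. This defines a single-valued, positive, self-adjoint operator on $L_2(\Gamma)$. *)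

(* Defs.v *)
From HB Require Import structures.
From mathcomp Require Import all_boot all_order all_algebra.
From mathcomp Require Import all_classical all_reals all_analysis measurable_realfun ess_sup_inf.
Set Implicit Arguments. Unset Strict Implicit. Unset Printing Implicit Defensive.
Import Order.TTheory GRing.Theory Num.Theory numFieldNormedType.Exports.
Local Open Scope classical_set_scope.
Local Open Scope ring_scope.

Definition borel_rV_display : measure_display. Proof. exact: default_measure_display. Qed.

Section borel_rV.
Context {R : realType} {n : nat}.

Let borel0 : <<s [set U : set 'rV[R]_n | open U] >> set0.
Proof. exact: sigma_algebra0. Qed.

Let borelC A : <<s [set U : set 'rV[R]_n | open U] >> A ->
  <<s [set U : set 'rV[R]_n | open U] >> (~` A).
Proof. exact: sigma_algebraC. Qed.

Let borel_bigcup (F : (set 'rV[R]_n)^nat) :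
  (forall i, <<s [set U : set 'rV[R]_n | open U] >> (F i)) ->
  <<s [set U : set 'rV[R]_n | open U] >> (\bigcup_i (F i)).
Proof. exact: sigma_algebra_bigcup. Qed.

HB.instance Definition _ := @isMeasurable.Build borel_rV_display 'rV[R]_n
  <<s [set U : set 'rV[R]_n | open U] >> borel0 borelC borel_bigcup.

Lemma open_measurable_rV (U : set 'rV[R]_n) : open U -> measurable U.
Proof. by move=> oU; apply: sub_sigma_algebra. Qed.

Lemma closed_measurable_rV (C : set 'rV[R]_n) : closed C -> measurable C.
Proof.
by rewrite -openC => /open_measurable_rV/measurableC; rewrite setCK.
Qed.

Let box (p : 'rV[rat]_n * nat) : set 'rV[R]_n :=
  [set y | forall i, `|y ord0 i - ratr (p.1 ord0 i)| < p.2.+1%:R^-1].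

Let open_bigcup_box (U : set 'rV[R]_n) : open U ->
  U = \bigcup_p (if `[< box p `<=` U >] then box p else set0).
Proof.
move=> oU; apply/seteqP; split => [x Ux|x [p _]]; last first.
  by case: asboolP => // boxU /boxU.
have /nbhs_ballP[e e0 xeU] : nbhs x U by exact: open_nbhs_nbhs.
have e20 : 0 < e / 2 by rewrite divr_gt0.
have [k _ /(_ k (leqnn k)) /= ke] := near_infty_natSinv_lt (PosNum e20).
have k0 : 0 < k.+1%:R^-1 :> R by rewrite invr_gt0.
have [q xq] : exists q : 'rV[rat]_n,
    forall i, `|x ord0 i - ratr (q ord0 i)| < k.+1%:R^-1.
  have /choice[q qP] : forall i : 'I_n,
      exists q : rat, `|x ord0 i - ratr q| < k.+1%:R^-1.
    move=> i; have /rat_in_itvoo[q] :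
        x ord0 i - k.+1%:R^-1 < x ord0 i + k.+1%:R^-1.
      by rewrite ltrBlDr -addrA ltrDl addr_gt0.
    by rewrite in_itv/= => /andP[q1 q2]; exists q; rewrite ltr_distlC q1 q2.
  by exists (\row_i q i) => i; rewrite mxE.
exists (q, k) => //; rewrite asboolT// => y /= yq.
apply: xeU; split=> // i j; rewrite ord1 /ball/=.
have -> : x ord0 j - y ord0 j = (x ord0 j - ratr (q ord0 j)) -
    (y ord0 j - ratr (q ord0 j)) by rewrite opprB addrA subrK.
by rewrite (le_lt_trans (ler_normB _ _))// [ltRHS]splitr ltrD// (lt_trans _ ke).
Qed.

Lemma measurable_preimage_open_rV d (T : measurableType d) (f : T -> 'rV[R]_n)
    (U : set 'rV[R]_n) :
  (forall i, measurable_fun [set: T] (fun t => f t ord0 i)) ->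
  open U -> measurable (f @^-1` U).
Proof.
move=> mf /open_bigcup_box ->; rewrite preimage_bigcup.
apply: countable_bigcupT_measurable => [|p]; first exact: countableP.
case: asboolP => _; last by rewrite preimage_set0.
have -> : f @^-1` box p = \bigcap_(i in [set: 'I_n])
    ((fun t => f t ord0 i) @^-1` `]ratr (p.1 ord0 i) - p.2.+1%:R^-1,
       ratr (p.1 ord0 i) + p.2.+1%:R^-1[%classic).
  apply/seteqP; split=> t /= => [H i _|H i].
    by rewrite /= in_itv/=; have := H i; rewrite ltr_distl.
  by have := H i I; rewrite /= in_itv/= ltr_distl.
apply: fin_bigcap_measurable => // i _.
by rewrite -[X in measurable X]setTI; apply: mf => //; exact: measurable_itv.
Qed.

Lemma measurable_fun_rV d (T : measurableType d) (f : T -> 'rV[R]_n) :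
  (forall i, measurable_fun [set: T] (fun t => f t ord0 i)) ->
  measurable_fun [set: T] f.
Proof.
move=> mf; apply: (@measurability _ _ _ _ setT f [set U : set 'rV[R]_n | open U]) => //.
by move=> _ [U oU <-]; rewrite setTI; exact: measurable_preimage_open_rV.
Qed.

Lemma measurable_coord_rV (i : 'I_n) :
  measurable_fun [set: 'rV[R]_n] (fun x => x ord0 i).
Proof.
apply: (measurability _ (RGenOpens.measurableE R)).
move=> _ [_ [a [b ->]] <-]; rewrite setTI; apply: open_measurable_rV.
apply: open_comp => [x _|]; first exact: coord_continuous.
exact: interval_open.
Qed.

End borel_rV.

Section lebesgue_rV.
Context {R : realType}.

Section succ.
Context {n : nat}.
Variable mu : {sigma_finite_measure set 'rV[R]_n -> \bar R}.

Let cons_rV (p : measurableTypeR R * 'rV[R]_n) : 'rV[R]_n.+1 :=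
  row_mx (\row_(i < 1) p.1) p.2.

Let measurable_cons_rV : measurable_fun [set: _] cons_rV.
Proof.
apply: measurable_fun_rV => i; rewrite /cons_rV.
case: (split_ordP (i : 'I_(1 + n))) => j ->.
- under eq_fun do rewrite (row_mxEl _ _ ord0 j) mxE.
  exact: measurable_fst.
- apply: (eq_measurable_fun
      (fun p : measurableTypeR R * 'rV[R]_n => p.2 ord0 j)).
    by move=> p _; rewrite (row_mxEr (\row_(i < 1) p.1) p.2 ord0 j).
  by apply: (measurableT_comp (measurable_coord_rV j)); exact: measurable_snd.
Qed.

Let uncons_rV (x : 'rV[R]_n.+1) : measurableTypeR R * 'rV[R]_n :=
  (x ord0 ord0, rsubmx (x : 'rV_(1 + n))).

Let cons_rVK : cancel cons_rV uncons_rV.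
Proof.
move=> [x v]; rewrite /uncons_rV /cons_rV row_mxKr/=; congr pair.
have -> : ord0 = lshift n ord0 :> 'I_(1 + n) by apply: val_inj.
by apply: (etrans (row_mxEl (\row_(i < 1) x) v ord0 ord0)); rewrite mxE.
Qed.

Let measurable_uncons_rV : measurable_fun [set: _] uncons_rV.
Proof.
apply: measurable_fun_pair; first exact: measurable_coord_rV.
apply: measurable_fun_rV => i; under eq_fun do rewrite mxE.
exact: measurable_coord_rV.
Qed.

Definition lebesgue_rV_succ : set 'rV[R]_n.+1 -> \bar R :=
  pushforward (@lebesgue_measure R \x mu)%E cons_rV.

Let lebesgue_rV_succ0 : lebesgue_rV_succ set0 = 0%E.
Proof. by rewrite /lebesgue_rV_succ /pushforward preimage_set0 measure0. Qed.

Let lebesgue_rV_succ_ge0 A : (0 <= lebesgue_rV_succ A)%E.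
Proof. exact: measure_ge0. Qed.

Let lebesgue_rV_succ_sigma_additive : semi_sigma_additive lebesgue_rV_succ.
Proof.
move=> F mF tF mUF; rewrite /lebesgue_rV_succ /pushforward preimage_bigcup.
have mcons A : measurable A -> measurable (cons_rV @^-1` A).
  by move=> mA; rewrite -[X in measurable X]setTI; exact: measurable_cons_rV.
apply: measure_semi_sigma_additive; first by move=> i; exact: mcons.
- apply/trivIsetP => /= i j _ _ ij; rewrite -preimage_setI.
  by move/trivIsetP : tF => /(_ _ _ _ _ ij) ->//; rewrite preimage_set0.
- by rewrite -preimage_bigcup; exact: mcons.
Qed.

HB.instance Definition _ := isMeasure.Build _ _ _ lebesgue_rV_succ
  lebesgue_rV_succ0 lebesgue_rV_succ_ge0 lebesgue_rV_succ_sigma_additive.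

Let lebesgue_rV_succ_sigma_finite : sigma_finite setT lebesgue_rV_succ.
Proof.
have /sigma_finiteP[F [TF ndF Foo]] := sigma_finiteT (@lebesgue_measure R).
have /sigma_finiteP[G [TG ndG Goo]] := sigma_finiteT mu.
exists (fun k => uncons_rV @^-1` (F k `*` G k)).
  apply/seteqP; split=> // x _.
  have : setT (uncons_rV x).1 by [].
  have : setT (uncons_rV x).2 by [].
  rewrite {1}TF {1}TG => -[k _ Gk] [l _ Fl]; exists (maxn k l) => //; split.
  - exact: (subsetPset _ _ (ndF _ _ (leq_maxr k l))).
  - exact: (subsetPset _ _ (ndG _ _ (leq_maxl k l))).
move=> k; have [mFk Fkoo] := Foo k; have [mGk Gkoo] := Goo k.
split.
  rewrite -[X in measurable X]setTI; apply: measurable_uncons_rV => //.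
  exact: measurableX.
rewrite /lebesgue_rV_succ /pushforward.
rewrite (_ : cons_rV @^-1` _ = F k `*` G k).
  by rewrite product_measure1E// lte_mul_pinfty// ge0_fin_numE.
by rewrite -comp_preimage (_ : _ \o _ = id) ?preimage_id//; exact/funext.
Qed.

HB.instance Definition _ := @Measure_isSigmaFinite.Build _ _ _ lebesgue_rV_succ
  lebesgue_rV_succ_sigma_finite.

End succ.

Fixpoint lebesgue_rV n : {sigma_finite_measure set 'rV[R]_n -> \bar R} :=
  match n with
  | 0 => \d_(0 : 'rV[R]_0)
  | n'.+1 => lebesgue_rV_succ (lebesgue_rV n')
  end.

End lebesgue_rV.

Section caratheodory_metric.
Context {R : realType} {T : pointedType}.
Variables (mu : {outer_measure set T -> \bar R}) (dist : T -> T -> R).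
Hypothesis mu_separated : forall (A B : set T) (e : R), 0 < e ->
  (forall x y, A x -> B y -> e <= dist x y) ->
  (mu A + mu B <= mu (A `|` B))%E.
Local Open Scope ereal_scope.

Let separated_sum (E : (set T)^nat) (e : nat -> R) n :
  (forall i, 0 < e i)%R ->
  (forall i j x y, (i < j)%N -> E i x -> E j y -> (e j <= dist x y)%R) ->
  \sum_(i < n) mu (E i) <= mu (\big[setU/set0]_(i < n) E i).
Proof.
move=> e0 Ed; elim: n => [|n ih]; first by rewrite !big_ord0 outer_measure_ge0.
rewrite !big_ord_recr/=.
apply: le_trans (mu_separated (e0 n) _); first by rewrite leeD.
by move=> x y; rewrite -bigcup_mkord => -[i /= ni Eix]; exact: Ed Eix.
Qed.

Lemma caratheodory_measurable_lip (f : T -> R) :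
  (forall x y, `|f x - f y| <= dist x y)%R ->
  mu.-caratheodory [set x | (0 < f x)%R].
Proof.
move=> lipf; apply: le_caratheodory_measurable => X.
have [->|] := eqVneq (mu X) +oo; first by rewrite leey.
rewrite -ltey => muXoo.
pose r (k : nat) : R := (k.+1%:R^-1)%R.
have r0 k : (0 < r k)%R by rewrite invr_gt0.
have rle j k : (j <= k)%N -> (r k <= r j)%R.
  by move=> jk; rewrite lef_pV2 ?posrE// ler_nat.
pose D k := X `&` [set x | (r k.+1 <= f x < r k)%R].
pose A k := X `&` [set x | (r k <= f x)%R].
have g0 k : (0 < r k - r k.+1)%R.
  by rewrite subr_gt0 ltf_pV2 ?posrE// ltr_nat.
have lef x y a : (a <= f x - f y -> a <= dist x y)%R.
  by move=> /le_trans; apply; exact: le_trans (ler_norm _) (lipf _ _).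
have half (c : bool) n : \sum_(i < n) mu (D (i.*2 + c)%N) <= mu X.
  apply: (@le_trans _ _ (mu (\big[setU/set0]_(i < n) D (i.*2 + c)%N))).
    apply: (separated_sum (E := fun i => D (i.*2 + c)%N)
      (e := fun j => r (j.*2 + c).-1 - r (j.*2 + c).-1.+1)%R) => [j|].
      exact: g0.
    move=> i j x y ij [_ /= /andP[fx _]] [_ /= /andP[_ fy]]; apply: lef.
    have jc : (0 < j.*2 + c)%N by rewrite ltn_addr// double_gt0 (leq_trans _ ij).
    rewrite prednK// lerB//; last exact: ltW.
    rewrite (le_trans _ fx)// rle// -ltnS prednK//.
    by rewrite -addSn ltn_add2r ltn_Sdouble.
  apply: le_outer_measure; apply: (big_ind (fun B => B `<=` X)) => // [B C BX CX|i _].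
    by rewrite subUset.
  exact: subIsetl.
have sum2 n : \sum_(i < n.*2) mu (D i) =
    \sum_(i < n) mu (D (i.*2 + false)%N) + \sum_(i < n) mu (D (i.*2 + true)%N).
  elim: n => [|n ih]; first by rewrite !big_ord0 adde0.
  rewrite doubleS !big_ord_recr/= ih addn0 addn1 -!addeA; congr +%E.
  by rewrite addeCA.
have sumD : \sum_(0 <= k <oo) mu (D k) < +oo.
  apply: (@le_lt_trans _ _ (mu X + mu X)); last by rewrite lte_add_pinfty.
  apply: lime_le; first by apply: is_cvg_nneseries => *; exact: outer_measure_ge0.
  apply: nearW => n; apply: (@le_trans _ _ (\sum_(i < n.*2) mu (D i))).
    rewrite -(big_mkord xpredT (mu \o D)); apply: lee_sum_nneg_natr.
      by move=> k _ _; exact: outer_measure_ge0.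
    by rewrite -addnn leq_addr.
  by rewrite sum2 leeD.
have tail k : mu (X `&` [set x | (0 < f x)%R]) <=
    mu (A k) + \sum_(k <= i <oo) mu (D i).
  apply: (@le_trans _ _ (mu (A k `|` \bigcup_(n in ~` `I_k) D n))).
    apply: le_outer_measure => x [Xx /= fx].
    have [rf|fr] := leP (r k) (f x); first by left.
    right.
    have [m _ /(_ m (leqnn m)) /= mf] := near_infty_natSinv_lt (PosNum fx).
    have exm : exists m, (r m <= f x)%R by exists m; exact: ltW.
    case: (ex_minnP exm) => -[|p] rp minp.
      by move: fr; rewrite ltNge (le_trans _ rp)// rle.
    exists p; last first.
      by split=> //=; rewrite rp ltNge; apply/negP => /minp; rewrite ltnn.
    move=> /= pk; move: fr; rewrite ltNge => /negP; apply.
    exact: le_trans (rle _ _ pk) rp.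
  apply: (le_trans (outer_measureU2 _ _ _)); rewrite leeD2l//.
  exact: outer_measure_sigma_subadditive_tail.
have AB k : mu (A k) + mu (X `&` ~` [set x | (0 < f x)%R]) <= mu X.
  apply: (le_trans (mu_separated (r0 k) _)).
    move=> x y [_ /= fx] [_ /= /negP]; rewrite -leNgt => fy; apply: lef.
    by rewrite (le_trans fx)// lerBrDr gerDl.
  by apply: le_outer_measure => x [[]|[]].
have := nneseries_tail_cvg sumD (fun k _ => outer_measure_ge0 mu (D k)).
move=> tail0.
apply/lee_addgt0Pr => e e0.
have : \forall k \near \oo, \sum_(k <= i <oo) mu (D i) < e%:E.
  by apply: (tail0 [set y | y < e%:E]); apply: open_nbhs_nbhs; split; [exact: open_ereal_lt_ereal|rewrite /= lte_fin].
move=> [k _ /(_ k (leqnn k)) /= ke].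
apply: (@le_trans _ _ (mu (A k) + e%:E + mu (X `&` ~` [set x | (0 < f x)%R]))).
  by rewrite leeD2r// (le_trans (tail k))// leeD2l// ltW.
by rewrite addeAC leeD2r.
Qed.

End caratheodory_metric.


Section hausdorff.
Context {R : realType} {d : nat}.
Implicit Types (A B : set 'rV[R]_d) (delta : R) (n : nat).

Definition enorm (x : 'rV[R]_d) : R := Num.sqrt (\sum_i x ord0 i ^+ 2).

Definition ediam A : \bar R :=
  ereal_sup [set (enorm (x.1 - x.2))%:E | x in A `*` A].

(* volume of the Euclidean unit ball of R^n *)
Fixpoint unit_ball_volume n : R :=
  match n with
  | 0 => 1
  | 1 => 2
  | (n'.+1 as m).+1 => 2 * pi / m.+1%:R * unit_ball_volume n'
  end.

(* the volume of a ball of diameter [ediam A]; the empty set has gauge 0 also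
   when n = 0 *)
Definition hausdorff_gauge n A : \bar R :=
  if A == set0 then 0%E
  else ((unit_ball_volume n / 2 ^+ n)%:E * ediam A ^+ n)%E.

Definition hausdorff_cover delta A : set (set 'rV[R]_d)^nat :=
  [set F | A `<=` \bigcup_k F k /\ forall k, (ediam (F k) <= delta%:E)%E].

Definition hausdorff_size n delta A : \bar R :=
  ereal_inf [set (\sum_(k <oo) hausdorff_gauge n (F k))%E
            | F in hausdorff_cover delta A].

(* normalized so that it agrees with the surface measure on n-dimensional
   submanifolds *)
Definition hausdorff_outer n A : \bar R :=
  ereal_sup [set hausdorff_size n delta A | delta in [set delta | 0 < delta]].

Let unit_ball_volume_ge0 n : 0 <= unit_ball_volume n.
Proof.
suff: 0 <= unit_ball_volume n /\ 0 <= unit_ball_volume n.+1 by case.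
elim: n => [|n [ih1 ih2]]; first by split; rewrite /= ?ler01 ?ler0n.
split=> //; rewrite [unit_ball_volume n.+2]/=.
by rewrite mulr_ge0// divr_ge0// mulr_ge0// pi_ge0.
Qed.

Let enorm_ge0 x : 0 <= enorm x. Proof. exact: sqrtr_ge0. Qed.

Let enorm0 : enorm 0 = 0.
Proof.
by rewrite /enorm big1 ?sqrtr0// => i _; rewrite mxE expr0n.
Qed.

Let coord_enorm i (x : 'rV[R]_d) : `|x ord0 i| <= enorm x.
Proof.
rewrite -sqrtr_sqr ler_wsqrtr// (bigD1 i)//= lerDl sumr_ge0// => j _.
exact: sqr_ge0.
Qed.

Let ediam_ge0 A : A != set0 -> (0 <= ediam A)%E.
Proof.
move=> /set0P[x Ax]; apply: ereal_sup_ubound; exists (x, x) => //=.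
by rewrite subrr enorm0.
Qed.

Let ediam0 : ediam set0 = -oo%E.
Proof. by rewrite /ediam set0X image_set0 ereal_sup0. Qed.

Let gauge0 n : hausdorff_gauge n set0 = 0%E.
Proof. by rewrite /hausdorff_gauge eqxx. Qed.

Let gauge_ge0 n A : (0 <= hausdorff_gauge n A)%E.
Proof.
rewrite /hausdorff_gauge; case: eqVneq => // A0.
rewrite mule_ge0 ?expe_ge0 ?ediam_ge0// lee_fin.
by apply: divr_ge0; [exact: unit_ball_volume_ge0|exact: exprn_ge0].
Qed.

Let size_ge0 n delta A : (0 <= hausdorff_size n delta A)%E.
Proof.
by apply: le_ereal_inf_tmp => _ [F _ <-]; apply: nneseries_ge0 => k _ _.
Qed.

Let le_size n delta A B : A `<=` B ->
  (hausdorff_size n delta A <= hausdorff_size n delta B)%E.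
Proof.
move=> AB; apply: ereal_inf_le_tmp => _ [F [BF dF] <-]; exists F => //.
by split=> //; exact: subset_trans BF.
Qed.

Let le_size_delta n delta delta' A : delta <= delta' ->
  (hausdorff_size n delta' A <= hausdorff_size n delta A)%E.
Proof.
move=> dd'; apply: ereal_inf_le_tmp => _ [F [BF dF] <-]; exists F => //.
by split=> // k; rewrite (le_trans (dF k))// lee_fin.
Qed.

Let size0 n delta : hausdorff_size n delta set0 = 0%E.
Proof.
apply/eqP; rewrite eq_le size_ge0 andbT; apply: ereal_inf_lbound.
exists (fun=> set0); last by rewrite eseries0.
by split=> // k; rewrite ediam0 leNye.
Qed.

Let size_sigma_subadditive n delta : sigma_subadditive (hausdorff_size n delta).
Proof.
move=> A; set size := hausdorff_size n delta.
have [[i ioo]|] := pselect (exists i, size (A i) = +oo%E).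
  by rewrite (eseries_pinfty _ _ ioo) ?leey// => k _; rewrite -ltNye (lt_le_trans _ (size_ge0 _ _ _)).
rewrite -forallNE => Aoo.
suff add2e (e : {posnum R}) :
    (size (\bigcup_n A n) <= \sum_(i <oo) size (A i) + e%:num%:E)%E.
  by apply/lee_addgt0Pr => _/posnumP[].
rewrite (le_trans _ (epsilon_trick _ _ _))//; last by move=> k; exact: size_ge0.
pose P k (B : (set 'rV[R]_d)^nat) := hausdorff_cover delta (A k) B /\
  (\sum_(i <oo) hausdorff_gauge n (B i) <=
    size (A k) + (e%:num / (2 ^ k.+1)%:R)%:E)%E.
have [G PG] : {G : ((set 'rV[R]_d)^nat)^nat & forall k, P k (G k)}.
  apply: (@choice _ _ P) => k; rewrite /P.
  have Akfin : size (A k) \is a fin_num.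
    by rewrite ge0_fin_numE ?size_ge0// ltey; apply/eqP; exact: Aoo.
  have en1 : 0 < e%:num / (2 ^ k.+1)%:R by [].
  have [x [B AkB Bx] xS] := lb_ereal_inf_adherent en1 Akfin.
  by exists B; split => //; rewrite Bx; exact/ltW.
pose gG := hausdorff_gauge n \o uncurry G.
apply: (@le_trans _ _ (\esum_(i in setT) gG i)).
  apply: ereal_inf_lbound => /=.
  have /card_esym/ppcard_eqP[f] := card_nat2.
  exists (uncurry G \o f).
    split => [t [i _ Ait]|i]; last first.
      by rewrite /=; case: (f i) => a b /=; exact: (PG a).1.2.
    have [j _ Gijt] := (PG i).1.1 t Ait.
    by exists (f^-1%FUN (i, j)) => //=; rewrite invK ?inE.
  rewrite -(esum_pred_image gG _ xpredT) ?[fun=> _]set_true//.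
    by rewrite image_eq.
  by move=> *; exact: gauge_ge0.
rewrite (_ : esum _ _ =
    (\sum_(i <oo) \sum_(j <oo ) hausdorff_gauge n (G i j))%E); last first.
  pose J : nat -> set (nat * nat) := fun i => [set (i, j) | j in setT].
  rewrite (_ : setT = \bigcup_k J k); last first.
    by rewrite predeqE => -[a b]; split => // _; exists a => //; exists b.
  rewrite esum_bigcupT /=; last 2 first.
    - apply/trivIsetP => i j _ _ ij.
      rewrite predeqE => -[k m] /=; split => //= -[] [_] _ [<-{k} _].
      by move=> [m' _] [] /esym/eqP; rewrite (negbTE ij).
    - by move=> *; exact: gauge_ge0.
  rewrite -(image_id [set: nat]) -fun_true esum_pred_image//; last first.
    by move=> k _; apply: esum_ge0 => *; exact: gauge_ge0.
  apply: eq_eseriesr => /= j _.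
  rewrite -(esum_pred_image gG (pair j) predT)//=; last first.
  - by move=> ? ? _ _; exact: (@can_inj _ _ _ snd).
  - by move=> *; exact: gauge_ge0.
  by congr esum; rewrite predeqE => -[a b]; split; move=> [i _ <-]; exists i.
apply: lee_nneseries => k _; last exact: (PG k).2.
by move=> _; apply: nneseries_ge0 => *; exact: gauge_ge0.
Qed.

Let hausdorff0 n : hausdorff_outer n set0 = 0%E.
Proof.
apply/eqP; rewrite eq_le; apply/andP; split.
  by apply: ge_ereal_sup => _ [delta _ <-]; rewrite size0.
by apply: ereal_sup_ubound; exists 1; rewrite /= ?size0.
Qed.

Let size_le_hausdorff n delta A : 0 < delta ->
  (hausdorff_size n delta A <= hausdorff_outer n A)%E.
Proof. by move=> d0; apply: ereal_sup_ubound; exists delta. Qed.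

Let hausdorff_ge0 n A : (0 <= hausdorff_outer n A)%E.
Proof. exact: le_trans (size_le_hausdorff n A ltr01). Qed.

Let le_hausdorff n : {homo hausdorff_outer n : A B / A `<=` B >-> (A <= B)%E}.
Proof.
move=> A B AB; apply: ge_ereal_sup => _ [delta d0 <-].
exact: le_trans (le_size n delta AB) (size_le_hausdorff _ _ d0).
Qed.

Let hausdorff_sigma_subadditive n : sigma_subadditive (hausdorff_outer n).
Proof.
move=> F; apply: ge_ereal_sup => _ [delta d0 <-].
apply: (le_trans (size_sigma_subadditive n delta F)).
by apply: lee_nneseries => // k _; exact: size_le_hausdorff.
Qed.

HB.instance Definition _ n := isOuterMeasure.Build R 'rV[R]_d (hausdorff_outer n)
  (hausdorff0 n) (hausdorff_ge0 n) (@le_hausdorff n)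
  (@hausdorff_sigma_subadditive n).

Let size_separated n A B delta e : delta < e ->
  (forall x y, A x -> B y -> e <= enorm (x - y)) ->
  (hausdorff_size n delta A + hausdorff_size n delta B <=
   hausdorff_size n delta (A `|` B))%E.
Proof.
move=> de ABe; apply: le_ereal_inf_tmp => _ [F [ABF dF] <-].
pose FC C k := if `[< F k `&` C !=set0 >] then F k else set0.
have FCcover C : C `<=` A `|` B -> hausdorff_cover delta C (FC C).
  move=> CAB; split=> [x Cx|k]; last first.
    by rewrite /FC; case: ifP => // _; rewrite ediam0 leNye.
  have [k _ Fkx] := ABF x (CAB x Cx); exists k => //.
  by rewrite /FC asboolT//; exists x.
have sizeFC C : C `<=` A `|` B ->
    (hausdorff_size n delta C <= \sum_(k <oo) hausdorff_gauge n (FC C k))%E.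
  by move=> /FCcover cC; apply: ereal_inf_lbound; exists (FC C).
apply: (le_trans (leeD (sizeFC A _) (sizeFC B _))); [by left|by right|].
rewrite -nneseriesD//; apply: lee_nneseries => [k _ _|k _].
  by rewrite adde_ge0.
rewrite /FC; case: asboolP => [[x [Fx Ax]]|_]; last first.
  by case: ifP => _; rewrite gauge0 add0e// gauge_ge0.
case: asboolP => [[y [Fy By]]|_]; last by rewrite gauge0 adde0.
exfalso; have := dF k; apply/negP; rewrite -ltNge.
apply: (@lt_le_trans _ _ (enorm (x - y))%:E); last first.
  by apply: ereal_sup_ubound; exists (x, y).
by rewrite lte_fin (lt_le_trans de)// ABe.
Qed.

Let hausdorff_separated n A B e : 0 < e ->
  (forall x y, A x -> B y -> e <= enorm (x - y)) ->
  (hausdorff_outer n A + hausdorff_outer n B <= hausdorff_outer n (A `|` B))%E.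
Proof.
move=> e0 ABe.
have sizeAB d1 d2 : 0 < d1 -> 0 < d2 ->
   (hausdorff_size n d1 A + hausdorff_size n d2 B <= hausdorff_outer n (A `|` B))%E.
  move=> d10 d20; pose d3 := Num.min (Num.min d1 d2) (e / 2).
  have d30 : 0 < d3 by rewrite !lt_min d10 d20 divr_gt0.
  apply: (@le_trans _ _ (hausdorff_size n d3 A + hausdorff_size n d3 B)%E).
    by rewrite leeD// le_size_delta// !ge_min lexx ?orbT.
  apply: le_trans (size_le_hausdorff _ _ d30).
  apply: size_separated ABe; rewrite gt_min; apply/orP; right.
  by rewrite ltr_pdivrMr// ltr_pMr// ltr1n.
have [->|] := eqVneq (hausdorff_outer n (A `|` B)) +oo%E; first by rewrite leey.
rewrite -ltey => ABoo.
have fin C : C `<=` A `|` B -> hausdorff_outer n C \is a fin_num.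
  move=> CAB; rewrite ge0_fin_numE ?hausdorff_ge0//.
  exact: le_lt_trans (le_hausdorff n CAB) ABoo.
have finA : hausdorff_outer n A \is a fin_num by apply: fin; left.
rewrite addeC -leeBrDr//.
apply: ge_ereal_sup => _ [d2 /= d20 <-].
rewrite leeBrDr// addeC.
have finB : hausdorff_size n d2 B \is a fin_num.
  rewrite ge0_fin_numE//; apply: le_lt_trans ABoo.
  by apply: le_trans (size_le_hausdorff n B d20) _; apply: le_hausdorff; right.
rewrite -leeBrDr//.
apply: ge_ereal_sup => _ [d1 /= d10 <-].
by rewrite leeBrDr// sizeAB.
Qed.

Lemma hausdorff_caratheodory n (U : set 'rV[R]_d) : measurable U ->
  (hausdorff_outer n).-caratheodory U.
Proof.
have lip := caratheodory_measurable_lip (dist := fun x y => enorm (x - y))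
  (@hausdorff_separated n).
pose mu : {outer_measure set 'rV[R]_d -> \bar R} := hausdorff_outer n.
pose T : measurableType _ := caratheodory_type mu.
apply: smallest_sub => [|{}U oU].
  exact: (@sigma_algebra_measurable _ T).
apply: (@measurable_preimage_open_rV R d _ T id U _ oU) => i.
apply: (measurability _ (measurable_realfun.RGenOpens.measurableE R)).
move=> _ [_ [a [b ->]] <-]; rewrite setTI.
have abE : [set x : 'rV[R]_d | `]a, b[%classic (x ord0 i)] =
    [set x | 0 < x ord0 i - a] `&` [set x | 0 < b - x ord0 i].
  by apply/seteqP; split=> x /=; rewrite in_itv/= !subr_gt0 => /andP.
apply: (eq_ind_r (@measurable _ T) _ abE).
apply: (@measurableI _ T); apply: lip => x y.
  rewrite opprB addrA subrK.
  by have := coord_enorm i (x - y); rewrite !mxE.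
rewrite opprB addrC addrA subrK distrC.
by have := coord_enorm i (x - y); rewrite !mxE.
Qed.

Definition hausdorff n : set 'rV[R]_d -> \bar R := hausdorff_outer n.

Let hausdorff_sigma_additive n : semi_sigma_additive (hausdorff n).
Proof.
move=> F mF tF mUF.
have := @caratheodory_measure_sigma_additive R _ (hausdorff_outer n) F.
by apply=> // [i|]; exact: hausdorff_caratheodory.
Qed.

HB.instance Definition _ n := isMeasure.Build _ _ _ (hausdorff n)
  (hausdorff0 n) (hausdorff_ge0 n) (@hausdorff_sigma_additive n).

End hausdorff.

Section Lspace_normed.
Context d (T : measurableType d) (R : realType).
Variables (mu : {measure set T -> \bar R}) (p : \bar R) (p1 : (1 <= p)%E).
Local Notation L := (LspaceType mu p1).
Local Notation Lf := (LfunType mu p1).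
Let nm (f : T -> R) : R := fine ('N[mu]_p[EFin \o f])%E.

Let finite_norm_ae (f g : T -> R) : measurable_fun [set: T] f ->
  measurable_fun [set: T] g -> f = g %[ae mu] ->
  ('N[mu]_p[EFin \o f] = 'N[mu]_p[EFin \o g])%E.
Proof.
move=> mf mg fg; rewrite unlock; case: p => [r| |].
- have mpow (h : T -> R) : measurable_fun [set: T] h ->
      measurable_fun [set: T] (fun x => `|(EFin \o h) x| `^ r)%E.
    move=> mh; apply/(measurableT_comp (measurable_poweR r)).
    by apply: measurableT_comp => //; exact/measurable_EFinP.
  congr poweR; apply: ge0_ae_eq_integral => //.
  + exact: mpow.
  + exact: mpow.
  + by move=> x _; exact: poweR_ge0.
  + by move=> x _; exact: poweR_ge0.
  + by apply: filterS fg => x + _ /= => ->.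
- case: ifPn => // _; apply: eq_ess_sup; apply: filterS fg => x /=.
  by move=> /(_ I) ->.
- case: ifPn => // _; apply: eq_ess_inf; apply: filterS fg => x /=.
  by move=> /(_ I) ->.
Qed.

Let mfun_of (f : T -> R) (mf : measurable_fun [set: T] f) :
    {mfun T >-> measurableTypeR R} :=
  HB.pack_for {mfun T >-> measurableTypeR R} f
    (isMeasurableFun.Build _ _ T (measurableTypeR R) f mf).

Let class_of (f : Lf) : {mfun_ mu, T >-> measurableTypeR R} :=
  \pi_({mfun_ mu, T >-> measurableTypeR R})%qT
    (mfun_of (measurable_funPT f)).

Let class_ofE (f : Lf) : class_of f = f %[ae mu].
Proof.
have : (repr (class_of f) == mfun_of (measurable_funPT f)
  %[mod {mfun_ mu, T >-> measurableTypeR R}])%qT by rewrite reprK.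
by rewrite eqmodE => /asboolP.
Qed.

Let measurable_repr (u : {mfun_ mu, T >-> measurableTypeR R}) :
  measurable_fun [set: T] (u : T -> R).
Proof. exact: (@measurable_funPT _ _ _ _ (repr u)). Qed.

Let class_of_finite (f : Lf) : finite_norm mu p (class_of f).
Proof.
rewrite /finite_norm (finite_norm_ae _ _ (class_ofE f)).
- exact: Lfunction_finite.
- exact: measurable_repr.
- exact: measurable_funPT.
Qed.

Definition Lspace_class (f : Lf) : L :=
  HB.pack_for L (class_of f)
    (isFinLebesgue.Build _ _ _ _ _ p1 (class_of f) (class_of_finite f)).

Let Lspace_Lfun (u : L) : (u : T -> R) \in Lfun mu p.
Proof.
apply/andP; split; apply/mem_set; first exact: measurable_repr.
exact: (@Lebesgue_finite _ _ _ _ _ _ u).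
Qed.

Definition Lspace_repr (u : L) : Lf := Lfun_Sub p1 (Lspace_Lfun u).

Lemma Lspace_reprE (u : L) : (Lspace_repr u : T -> R) = u.
Proof. exact: Lfun_valP. Qed.

Lemma Lspace_classE (f : Lf) : Lspace_class f = f %[ae mu].
Proof. exact: class_ofE. Qed.

Lemma Lspace_eqP (u v : L) : u = v <-> u = v %[ae mu].
Proof.
split=> [->|uv]; first exact/nearW.
have : LebesgueSpace.sort u = LebesgueSpace.sort v.
  rewrite -[LHS]reprK -[RHS]reprK; apply/eqmodP; exact/asboolP.
case: u v {uv} => u [[hu]] [v [[hv]]] /= uv; move: hu hv; rewrite uv => hu hv.
by rewrite (Prop_irrelevance hu hv).
Qed.

Lemma Lspace_reprK (u : L) : Lspace_class (Lspace_repr u) = u.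
Proof.
apply/Lspace_eqP; have := Lspace_classE (Lspace_repr u).
by rewrite Lspace_reprE.
Qed.

Lemma Lspace_class_eqP (f g : Lf) :
  Lspace_class f = Lspace_class g <-> f = g %[ae mu].
Proof.
rewrite Lspace_eqP; have Ef := Lspace_classE f; have Eg := Lspace_classE g.
split=> fg; move: Ef Eg fg; apply: filterS3 => x.
- by move=> /(_ I) <- /(_ I) <-.
- by move=> /(_ I) -> /(_ I) ->.
Qed.

HB.instance Definition _ := gen_eqMixin L.
HB.instance Definition _ := gen_choiceMixin L.

Let Ladd (u v : L) := Lspace_class (Lspace_repr u + Lspace_repr v).
Let Lopp (u : L) := Lspace_class (- Lspace_repr u).
Let Lzero : L := Lspace_class 0.
Let Lscale (a : R) (u : L) := Lspace_class (a *: Lspace_repr u).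

Let repr_class (f : Lf) : Lspace_repr (Lspace_class f) = f %[ae mu].
Proof. by apply/Lspace_class_eqP; rewrite Lspace_reprK. Qed.

Let LaddE f g : Ladd (Lspace_class f) (Lspace_class g) = Lspace_class (f + g).
Proof.
apply/Lspace_class_eqP; move: (repr_class f) (repr_class g).
by apply: filterS2 => x /(_ I) /= fx /(_ I) /= gx _; congr (_ + _).
Qed.

Let LoppE f : Lopp (Lspace_class f) = Lspace_class (- f).
Proof.
apply/Lspace_class_eqP; move: (repr_class f).
by apply: filterS => x /(_ I) /= fx _; congr (- _).
Qed.

Let LscaleE a f : Lscale a (Lspace_class f) = Lspace_class (a *: f).
Proof.
apply/Lspace_class_eqP; move: (repr_class f).
by apply: filterS => x /(_ I) /= fx _; congr (_ *: _).
Qed.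

Let LaddA : associative Ladd.
Proof.
move=> u v w; rewrite -[u]Lspace_reprK -[v]Lspace_reprK -[w]Lspace_reprK.
by rewrite !LaddE addrA.
Qed.

Let LaddC : commutative Ladd.
Proof.
move=> u v; rewrite -[u]Lspace_reprK -[v]Lspace_reprK.
by rewrite !LaddE addrC.
Qed.

Let Ladd0 : left_id Lzero Ladd.
Proof. by move=> u; rewrite -[u]Lspace_reprK LaddE add0r. Qed.

Let LaddN : left_inverse Lzero Lopp Ladd.
Proof. by move=> u; rewrite -[u]Lspace_reprK LoppE LaddE addNr. Qed.

HB.instance Definition _ := GRing.isZmodule.Build L LaddA LaddC Ladd0 LaddN.

Let LscaleA a b (u : L) : Lscale a (Lscale b u) = Lscale (a * b) u.
Proof. by rewrite -[u]Lspace_reprK !LscaleE scalerA. Qed.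

Let Lscale1 : left_id 1 Lscale.
Proof. by move=> u; rewrite -[u]Lspace_reprK LscaleE scale1r. Qed.

Let LscaleDr : right_distributive Lscale +%R.
Proof.
move=> a u v; rewrite -[u]Lspace_reprK -[v]Lspace_reprK.
rewrite [X in Lscale a X]LaddE !LscaleE scalerDr; exact/esym/LaddE.
Qed.

Let LscaleDl (u : L) : {morph Lscale^~ u : a b / a + b >-> a + b}.
Proof.
move=> a b /=; rewrite -[u]Lspace_reprK !LscaleE scalerDl; exact/esym/LaddE.
Qed.

HB.instance Definition _ := GRing.Zmodule_isLmodule.Build R L
  LscaleA Lscale1 LscaleDr LscaleDl.

Let Lnorm_class f : nm (Lspace_class f) = nm f.
Proof.
congr fine; apply: finite_norm_ae (Lspace_classE f).
- exact: measurable_repr.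
- exact: measurable_funPT.
Qed.

Let LnormD (u v : L) : nm (u + v)%R <= nm u + nm v.
Proof.
rewrite -[u]Lspace_reprK -[v]Lspace_reprK [_ + _]LaddE !Lnorm_class.
exact: ler_LnormD.
Qed.

Let LnormrZ (a : R) (u : L) : nm (a *: u)%R = `|a| * nm u.
Proof.
rewrite -[u]Lspace_reprK [_ *: _]LscaleE !Lnorm_class.
apply/EFin_inj; rewrite EFinM !finite_norm_fine; exact: LnormZ.
Qed.

Let Lnormr0 (u : L) : nm u = 0 -> u = 0.
Proof.
rewrite -[u]Lspace_reprK Lnorm_class => /fine_Lnormr_eq0 u0.
exact/Lspace_class_eqP.
Qed.

HB.instance Definition _ := @Lmodule_isNormed.Build R L
  (fun u => nm u) LnormD LnormrZ Lnormr0.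

Lemma Lspace_normE (u : L) : `|u| = fine ('N[mu]_p[EFin \o u])%E.
Proof. by []. Qed.

Lemma Lspace_addE (u v : L) : (u + v : L) = (u \+ v) %[ae mu].
Proof.
have := Lspace_classE (Lspace_repr u + Lspace_repr v).
apply: filterS => x /(_ I) -> _.
by rewrite -[in RHS](Lspace_reprE u) -[in RHS](Lspace_reprE v).
Qed.

Lemma Lspace_scaleE (a : R) (u : L) :
  (a *: u : L) = (a \*: (u : T -> R)) %[ae mu].
Proof.
have := Lspace_classE (a *: Lspace_repr u).
by apply: filterS => x /(_ I) -> _; rewrite -[in RHS](Lspace_reprE u).
Qed.

End Lspace_normed.

Section L2.
Context {dT} {T : measurableType dT} {R : realType}.
Variable mu : {measure set T -> \bar R}.

(* the element of L_2 represented by f; junk value 0 when there is none *)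
Definition L2class (f : T -> R) : LspaceType2 mu :=
  xget 0 [set u : LspaceType2 mu | u = f %[ae mu]].

Lemma L2classE (f : T -> R) (u : LspaceType2 mu) :
  u = f %[ae mu] -> L2class f = u.
Proof.
move=> uf; apply/Lspace_eqP; have := @xgetI _ 0 [set u : LspaceType2 mu | u = f %[ae mu]] u uf.
by move: uf; apply: filterS2 => x /(_ I) /= fx /(_ I) /= gx _; rewrite fx -gx.
Qed.

Definition L2dot (u v : LspaceType2 mu) : R := \int[mu]_x (u x * v x).

End L2.

Section operators.
Context {R : realType}.

Definition compact_map {U : Type} {W : normedModType R}
    (D : set U) (N : U -> R) (T : U -> W) :=
  forall B : set U, B `<=` D -> (exists M, forall u, B u -> N u <= M) ->
  precompact (T @` B).

(* [A phi psi] reads: phi is in D(A) and A phi = psi. [T] is the inverse of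
   lambda - A : D(A) -> W, so lambda is in the resolvent set of A. *)
Definition is_resolvent {W : normedModType R} (A : W -> W -> Prop) (lambda : R)
    (T : {linear W -> W}) :=
  continuous T /\
  forall f phi, T f = phi <-> exists2 psi, A phi psi & lambda *: phi - psi = f.

Definition compact_resolvent {W : normedModType R} (A : W -> W -> Prop) :=
  exists (lambda : R) (T : {linear W -> W}),
    is_resolvent A lambda T /\ compact_map [set: W] (fun f => `|f|) T.

End operators.

Section domain.
Context {R : realType} {d : nat}.

Definition boundary (A : set 'rV[R]_d) : set 'rV[R]_d :=
  closure A `\` interior A.

Lemma measurable_boundary (A : set 'rV[R]_d) : measurable (boundary A).
Proof.
apply: closed_measurable_rV; rewrite /boundary setDE.
by apply: closedI; [exact: closed_closure|rewrite closedC; exact: open_interior].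
Qed.

Definition pderiv (i : 'I_d) (f : 'rV[R]_d -> R^o) : 'rV[R]_d -> R^o :=
  'D_(delta_mx ord0 i) f.

Definition smooth (f : 'rV[R]_d -> R^o) :=
  forall (s : seq 'I_d) x, differentiable (foldr pderiv f s) x.

Variable Omega : set 'rV[R]_d.

Definition test_function (f : 'rV[R]_d -> R^o) :=
  [/\ smooth f, compact (closure [set x | f x != 0]) &
      closure [set x | f x != 0] `<=` Omega].

(* (d-1)-dimensional Hausdorff measure on the boundary, as a measure on R^d *)
Definition surface : {measure set 'rV[R]_d -> \bar R} :=
  mrestr (@hausdorff R d d.-1) (measurable_boundary Omega).

Hypothesis oOmega : open Omega.

Definition volume : {measure set 'rV[R]_d -> \bar R} :=
  mrestr (@lebesgue_rV R d) (open_measurable_rV oOmega).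

Local Notation L2Omega := (LspaceType2 volume).
Local Notation L2Gamma := (LspaceType2 surface).

Definition is_weak_deriv (i : 'I_d) (u g : L2Omega) :=
  forall f, test_function f ->
    \int[volume]_x (u x * pderiv i f x) = - \int[volume]_x (g x * f x).

Definition H1 : set L2Omega :=
  [set u | forall i, exists g, is_weak_deriv i u g].

Definition weak_deriv (i : 'I_d) (u : L2Omega) : L2Omega :=
  xget 0 [set g | is_weak_deriv i u g].

Definition dirichlet (u v : L2Omega) : R :=
  \int[volume]_x (\sum_i weak_deriv i u x * weak_deriv i v x).

Definition H1norm (u : L2Omega) : R := Num.sqrt (L2dot u u + dirichlet u u).

(* the distributional Laplacian of u is the element f of L_2(Omega) *)
Definition is_laplacian (u f : L2Omega) :=
  forall h, test_function h ->
    \int[volume]_x (u x * \sum_i pderiv i (pderiv i h) x) =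
    \int[volume]_x (f x * h x).

Definition on_domain (v : 'rV[R]_d -> R) : L2Omega := L2class volume v.
Definition on_boundary (v : 'rV[R]_d -> R) : L2Gamma := L2class surface v.

(* elements of C(closure Omega) are represented by functions on the whole space,
   whose values outside closure Omega are irrelevant *)
Definition H1C : set ('rV[R]_d -> R) :=
  [set v | {within closure Omega, continuous v} /\
           exists2 u, H1 u & u = v %[ae volume]].

Definition H1tilde : set L2Omega :=
  [set u | H1 u /\ forall e, 0 < e ->
           exists2 v, H1C v & H1norm (on_domain v - u) < e].

Definition is_trace (u : L2Omega) (phi : L2Gamma) :=
  H1 u /\ exists v : ('rV[R]_d -> R)^nat,
    [/\ forall n, H1C (v n),
        H1norm (on_domain (v n) - u) @[n --> \oo] --> (0 : R) &
        on_boundary (v n) @[n --> \oo] --> phi].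

Definition trace_unique := forall phi, is_trace 0 phi -> phi = 0.

Definition L2Gamma_on (B : set 'rV[R]_d) : set L2Gamma :=
  [set phi | phi = cst 0 %[ae surface in boundary Omega `\` B]].

Definition Gamma_sigma : set 'rV[R]_d :=
  get [set B | [/\ measurable B, B `<=` boundary Omega &
    [set phi | is_trace 0 phi] = L2Gamma_on (boundary Omega `\` B)]].

Definition Tr (u : L2Omega) : L2Gamma :=
  xget 0 [set phi | is_trace u phi /\ L2Gamma_on Gamma_sigma phi].

Definition H1sigma : set L2Omega :=
  [set u | exists phi, is_trace u phi].

Definition H1sigma_norm (u : L2Omega) : R :=
  Num.sqrt (dirichlet u u + \int[surface]_(x in Gamma_sigma) (Tr u x ^+ 2)).

Definition form_norm (v : 'rV[R]_d -> R) : R :=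
  Num.sqrt (dirichlet (on_domain v) (on_domain v) +
            L2dot (on_boundary v) (on_boundary v)).

Definition is_normal_deriv (u : L2Omega) (psi : L2Gamma) :=
  H1 u /\ exists2 f, is_laplacian u f &
    forall v, H1C v ->
      L2dot f (on_domain v) + dirichlet u (on_domain v) =
      L2dot psi (on_boundary v).

Definition DtN (phi psi : L2Gamma) :=
  exists u, [/\ H1 u, is_laplacian u 0, is_trace u phi & is_normal_deriv u psi].

End domain.

Arguments H1 {R d Omega} oOmega.
Arguments H1norm {R d Omega} oOmega u.
Arguments H1C {R d Omega} oOmega.
Arguments H1tilde {R d Omega} oOmega.
Arguments is_trace {R d Omega} oOmega u phi.
Arguments Tr {R d Omega} oOmega u.
Arguments H1sigma {R d Omega} oOmega.
Arguments H1sigma_norm {R d Omega} oOmega u.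
Arguments form_norm {R d Omega} oOmega v.
Arguments DtN {R d Omega} oOmega phi psi.

(* Main.v *)
From HB Require Import structures.
Require Import Defs.
From mathcomp Require Import all_boot all_order all_algebra.
From mathcomp Require Import all_classical all_reals all_analysis measurable_realfun ess_sup_inf.
From mathcomp Require Import ring lra.
Set Implicit Arguments. Unset Strict Implicit. Unset Printing Implicit Defensive.
Import Order.TTheory GRing.Theory Num.Theory numFieldNormedType.Exports.
Local Open Scope classical_set_scope.
Local Open Scope ring_scope.

(** The heart of the matter is Maz'ya's inequality
    int_Omega v^2 <= C (int_Omega |grad v|^2 + int_Gamma v^2), valid for v in
    H^1(Omega) and continuous on the closure.  Covering the level sets of v^2
    on Gamma separately, one finds finitely many small balls B(x_k, r_k) that
    cover Gamma, with sum_k r_k^(d-1) v(x_k)^2 controlled by int_Gamma v^2.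
    Multiply v by a product of Lipschitz cutoffs that vanish on these balls and
    call the result u.  For a small step h, translation invariance gives
    h int u^2 = int x_1 (u(x)^2 - u(x + h e_1)^2), where the difference of u
    splits into a difference quotient of v, bounded by its weak derivative, and
    a difference of cutoffs, bounded by the sums over the balls.

    Hence the form norm dominates the H^1 norm, and the Riesz argument solves
    the Robin problem (u harmonic, du/dnu + Tr u = x) weakly.  Let K x be the
    trace of its solution.
    (i) => (ii): a compact resolvent makes K compact, and
    |v|_Gamma|^3 <= N(v)^2 |K (v|_Gamma)| transfers this to the restriction map,
    where N is the form norm.
    (ii) => (iii): the traces of 0 form a space stable under multiplication by
    smooth bumps, with totally bounded unit ball.  If it contained phi <> 0, then
    cutting phi off near a point around which it never vanishes, and normalizing,
    would give unit vectors concentrating at a point; since points are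
    sigma-null these become orthogonal, contradicting total boundedness.
    (iii) => (iv): by compactness and uniqueness, |v|_Gamma| <= C |v|_(H^1).
    (iv) => (i): -1 is in the resolvent set, and the resolvent there is -K, which
    is bounded into H^1 followed by the compact trace. *)

(** * The Hilbert space L_2 *)

(** The boundary carries no regularity: there is no extension operator, no trace theorem, no
    approximation by functions smooth up to the boundary. Everything therefore passes through the
    cut-off function u, which lives on a compact subset of Omega, so that its extension by zero can
    be translated in the whole space. Counting powers explains the dimension of the measure: a
    cutoff at a ball of radius r has slope 1/r and varies on a volume of order r^d, and the product
    r^(d-1) is the gauge of the (d-1)-dimensional Hausdorff measure. A single cover of Gamma would
    control only the sum of r_k^(d-1); the weights v(x_k)^2 are the reason for covering level sets
    one by one. Weak derivatives are known only against test functions, so difference quotients are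
    bounded by duality, without mollification. Before uniqueness is established an element of H^1
    may have many traces; the variational problem is therefore posed for pairs (u, phi) in which phi
    is a trace of u. *)

Section L2_basics.
Context {dT} {T : measurableType dT} {R : realType}.
Variable mu : {measure set T -> \bar R}.
Local Notation L2 := (LspaceType2 mu).
Implicit Types (u v w : L2) (f g : T -> R).

Lemma Lfun2P f : reflect (measurable_fun [set: T] f /\
    mu.-integrable [set: T] (EFin \o (fun x => f x ^+ 2)))
  (f \in Lfun mu 2%:E).
Proof.
apply: (iffP idP) => [fL|[mf /integrableP[_ foo]]].
  split; last exact: Lfun2_integrable_sqr.
  by case/andP : fL; rewrite inE.
apply/andP; split; rewrite inE//= /finite_norm unlock poweR_lty//.
rewrite (le_lt_trans _ foo)//; apply: ge0_le_integral => //.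
- by move=> x _; exact: poweR_ge0.
- apply: (measurableT_comp (measurable_poweR 2)) => //.
  by apply/measurable_EFinP; exact: measurableT_comp.
- by apply/measurable_EFinP; apply: measurableT_comp => //; exact: measurable_funX.
- by move=> x _ /=; rewrite lee_fin normrX powR_mulrn.
Qed.

Lemma Lspace2_Lfun u : (u : T -> R) \in Lfun mu 2%:E.
Proof. by rewrite -Lspace_reprE; exact: LfunP. Qed.

Lemma Lspace2_measurable u : measurable_fun [set: T] u.
Proof. by have /Lfun2P[] := Lspace2_Lfun u. Qed.

Lemma Lfun2_mul_integrable f g : f \in Lfun mu 2%:E -> g \in Lfun mu 2%:E ->
  mu.-integrable [set: T] (EFin \o (fun x => f x * g x)).
Proof. by move=> fL gL; apply/Lfun1_integrable; exact: Lfun2_mul_Lfun1. Qed.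

Lemma L2class_ae f : f \in Lfun mu 2%:E -> L2class mu f = f %[ae mu].
Proof.
move=> fL; have := Lspace_classE (Lfun_Sub (lee1n 2) fL).
by move=> h; rewrite (L2classE (u := Lspace_class (Lfun_Sub (lee1n 2) fL)) h).
Qed.

Lemma eq_Rintegral_ae f g : measurable_fun [set: T] f -> measurable_fun [set: T] g ->
  f = g %[ae mu] -> \int[mu]_x f x = \int[mu]_x g x.
Proof.
move=> mf mg fg; congr fine; apply: ae_eq_integral => //.
- exact/measurable_EFinP.
- exact/measurable_EFinP.
- by move: fg; apply: filterS => x /= h xT; rewrite h.
Qed.

Lemma L2dot_integrable u v : mu.-integrable [set: T] (EFin \o (fun x => u x * v x)).
Proof. by apply: Lfun2_mul_integrable; exact: Lspace2_Lfun. Qed.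

Lemma L2dot_ae u v f g : u = f %[ae mu] -> v = g %[ae mu] ->
  measurable_fun [set: T] f -> measurable_fun [set: T] g ->
  L2dot u v = \int[mu]_x (f x * g x).
Proof.
move=> uf vg mf mg; apply: eq_Rintegral_ae.
- by apply: measurable_funM; exact: Lspace2_measurable.
- exact: measurable_funM.
- by move: uf vg; apply: filterS2 => x h1 h2 xT; rewrite h1// h2.
Qed.

Lemma L2dotC u v : L2dot u v = L2dot v u.
Proof. by rewrite /L2dot; under eq_Rintegral do rewrite mulrC. Qed.

Lemma L2dotDl u v w : L2dot (u + v) w = L2dot u w + L2dot v w.
Proof.
rewrite (L2dot_ae (f := fun x => u x + v x) (g := w))//.
- under eq_Rintegral do rewrite mulrDl.
  by rewrite RintegralD//; exact: L2dot_integrable.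
- exact: Lspace_addE.
- exact: nearW.
- by apply: measurable_funD; exact: Lspace2_measurable.
- exact: Lspace2_measurable.
Qed.

Lemma L2dotZl (a : R) u v : L2dot (a *: u) v = a * L2dot u v.
Proof.
rewrite (L2dot_ae (f := fun x => a * u x) (g := v))//.
- under eq_Rintegral do rewrite -mulrA.
  by rewrite RintegralZl//; exact: L2dot_integrable.
- exact: Lspace_scaleE.
- exact: nearW.
- by apply: measurable_funM => //; exact: Lspace2_measurable.
- exact: Lspace2_measurable.
Qed.

Lemma L2dotDr u v w : L2dot w (u + v) = L2dot w u + L2dot w v.
Proof. by rewrite !(L2dotC w) L2dotDl. Qed.

Lemma L2dotZr (a : R) u v : L2dot v (a *: u) = a * L2dot v u.
Proof. by rewrite !(L2dotC v) L2dotZl. Qed.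

Lemma L2dotNl u v : L2dot (- u) v = - L2dot u v.
Proof. by rewrite -scaleN1r L2dotZl mulN1r. Qed.

Lemma L2dotBl u v w : L2dot (u - v) w = L2dot u w - L2dot v w.
Proof. by rewrite L2dotDl L2dotNl. Qed.

Lemma L2dotBr u v w : L2dot w (u - v) = L2dot w u - L2dot w v.
Proof. by rewrite !(L2dotC w) L2dotBl. Qed.

Lemma L2dot0l u : L2dot 0 u = 0.
Proof. by rewrite -(scale0r (0 : L2)) L2dotZl mul0r. Qed.

Lemma L2dot0r u : L2dot u 0 = 0.
Proof. by rewrite L2dotC L2dot0l. Qed.

Lemma L2dot_norm u : L2dot u u = `|u| ^+ 2.
Proof.
have h : (`|u|%:E = 'N[mu]_2%:E[EFin \o u])%E.
  rewrite Lspace_normE -{1 2}Lspace_reprE.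
  exact: (finite_norm_fine (Lspace_repr u)).
have : ((`|u| `^ 2)%:E = 'N[mu]_2%:E[EFin \o u] `^ 2)%E by rewrite -h.
rewrite poweR_Lnorm//; under eq_integral do rewrite /= powR_mulrn//.
rewrite powR_mulrn// => /(congr1 fine) /= ->.
by congr fine; apply: eq_integral => x _ /=; rewrite real_normK ?num_real.
Qed.

Lemma L2dot_ge0 u : 0 <= L2dot u u.
Proof. by rewrite L2dot_norm sqr_ge0. Qed.

Lemma L2dot_CauchySchwarz u v : `|L2dot u v| <= `|u| * `|v|.
Proof.
have [->|v0] := eqVneq v 0; first by rewrite L2dot0r normr0 mulr_ge0.
have vv : 0 < `|v| ^+ 2 by rewrite exprn_gt0// normr_gt0.
(* The component of [u] orthogonal to [v] has nonnegative square norm. *)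
have := L2dot_ge0 (u - (L2dot u v / `|v| ^+ 2) *: v).
rewrite !(L2dotBl, L2dotBr, L2dotZl, L2dotZr) !L2dot_norm (L2dotC v u).
set a := L2dot u v => h.
have {h} : a ^+ 2 / `|v| ^+ 2 <= `|u| ^+ 2.
  move: h; set b := `|v| ^+ 2 in vv *.
  rewrite -[a / b * b]mulrA mulVf ?gt_eqF// mulr1 subrr subr0.
  by rewrite subr_ge0 expr2 mulrAC.
rewrite ler_pdivrMr// -exprMn => h.
by rewrite -ler_sqr ?nnegrE ?mulr_ge0// real_normK ?num_real.
Qed.

Lemma L2norm_class f : f \in Lfun mu 2%:E ->
  `|L2class mu f| ^+ 2 = \int[mu]_x (f x ^+ 2).
Proof.
move=> fL; have /Lfun2P[mf _] := fL.
by rewrite -L2dot_norm (L2dot_ae (L2class_ae fL) (L2class_ae fL)).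
Qed.

Lemma Lfun2D f g : f \in Lfun mu 2%:E -> g \in Lfun mu 2%:E ->
  (fun x => f x + g x) \in Lfun mu 2%:E.
Proof.
move=> fL gL.
exact: (LfunP (Lfun_Sub (lee1n 2) fL + Lfun_Sub (lee1n 2) gL)).
Qed.

Lemma Lfun2Z (a : R) f : f \in Lfun mu 2%:E -> (fun x => a * f x) \in Lfun mu 2%:E.
Proof. by move=> fL; exact: (LfunP (a *: Lfun_Sub (lee1n 2) fL)). Qed.

Lemma Lfun2_bdM f g (M : R) : measurable_fun [set: T] f ->
  (forall x, `|f x| <= M) -> g \in Lfun mu 2%:E ->
  (fun x => f x * g x) \in Lfun mu 2%:E.
Proof.
move=> mf fM /Lfun2P[mg gi]; apply/Lfun2P; split; first exact: measurable_funM.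
have Mi := @integrableZl _ _ _ mu [set: T] measurableT (M ^+ 2) _ gi.
apply: le_integrable Mi => //.
  by apply/measurable_EFinP; apply: measurable_funX; exact: measurable_funM.
move=> x _ /=; rewrite lee_fin exprMn !normrM ler_wpM2r//.
by apply: ler_pM => //; rewrite (le_trans (fM x))// ler_norm.
Qed.

Lemma L2class_eq f g : f = g %[ae mu] -> L2class mu f = L2class mu g.
Proof.
move=> fg; congr xget; apply/seteqP; split => w /=; move: fg; apply: filterS2 => x.
  by move=> h1 h2 xT; rewrite h2// h1.
by move=> h1 h2 xT; rewrite h2// h1.
Qed.

Lemma L2classK u : L2class mu u = u.
Proof. by apply: L2classE; apply: nearW. Qed.

Lemma L2classD f g : f \in Lfun mu 2%:E -> g \in Lfun mu 2%:E ->
  L2class mu (fun x => f x + g x) = L2class mu f + L2class mu g.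
Proof.
move=> /L2class_ae fL /L2class_ae gL; apply: L2classE.
have := Lspace_addE (L2class mu f) (L2class mu g).
move: fL gL; apply: filterS3 => x h1 h2 h3 xT.
by rewrite h3//= h1// h2.
Qed.

Lemma L2classZ (a : R) f : f \in Lfun mu 2%:E ->
  L2class mu (fun x => a * f x) = a *: L2class mu f.
Proof.
move=> /L2class_ae fL; apply: L2classE.
have := Lspace_scaleE a (L2class mu f).
move: fL; apply: filterS2 => x h1 h3 xT.
by rewrite h3//= h1.
Qed.

Lemma L2_le_norm u v (f g : T -> R) : u = f %[ae mu] -> v = g %[ae mu] ->
  (forall x, `|f x| <= `|g x|) -> `|u| <= `|v|.
Proof.
move=> uf vg fg; rewrite -ler_sqr ?nnegrE// -!L2dot_norm.
apply: fine_le; [exact: integrable_fin_num (L2dot_integrable _ _)..|].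
apply: ae_ge0_le_integral => //.
- by move=> x _; rewrite lee_fin -expr2 sqr_ge0.
- by apply/measurable_EFinP; apply: measurable_funM; exact: Lspace2_measurable.
- by move=> x _; rewrite lee_fin -expr2 sqr_ge0.
- by apply/measurable_EFinP; apply: measurable_funM; exact: Lspace2_measurable.
move: uf vg; apply: filterS2 => x h1 h2 xT.
rewrite lee_fin h1// h2// -!expr2 -(real_normK (num_real (f x))) -(real_normK (num_real (g x))).
by rewrite lerXn2r// ?nnegrE// fg.
Qed.

End L2_basics.

(** * Bounded functions on a finite measure space *)

Section finite_measure.
Context {dT} {T : measurableType dT} {R : realType}.
Variable mu : {measure set T -> \bar R}.
Hypothesis muoo : (mu setT < +oo)%E.

Lemma finite_bounded_integrable (F : T -> R) (M : R) :
  measurable_fun [set: T] F -> (forall x, `|F x| <= M) ->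
  mu.-integrable [set: T] (EFin \o F).
Proof.
move=> mF FM; apply: (@le_integrable _ _ _ mu _ _ _ (EFin \o cst M)) => //.
- exact/measurable_EFinP.
- by move=> x _ /=; rewrite lee_fin (le_trans (FM x))// ler_norm.
- apply/integrableP; split; first by apply/measurable_EFinP; exact: measurable_cst.
  by rewrite /= integral_cst// lte_mul_pinfty.
Qed.

Lemma finite_bounded_Lfun2 (F : T -> R) (M : R) :
  measurable_fun [set: T] F -> (forall x, `|F x| <= M) -> F \in Lfun mu 2%:E.
Proof.
move=> mF FM; apply/Lfun2P; split=> //.
apply: (finite_bounded_integrable (M := M ^+ 2)); first exact: measurable_funX.
by move=> x; rewrite normrX lerXn2r// nnegrE// (le_trans _ (FM x)).
Qed.

End finite_measure.

(** * Completeness and compactness *)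

Section complete_sequences.
Context {R : realType}.

Definition cauchyn (V : normedModType R) (u : V^nat) :=
  forall e : R, 0 < e -> exists N, forall m n, (N <= m)%N -> (N <= n)%N ->
    `|u m - u n| < e.

(** Completeness is a property of sequences here, because the spaces [LspaceType2] enter only as
    normed modules. *)
Definition cauchyn_complete (V : normedModType R) :=
  forall u : V^nat, cauchyn u -> exists l : V, u @ \oo --> l.

Lemma normed_ballE (V : normedModType R) (x y : V) (e : R) :
  ball x e y = (`|x - y| < e) :> Prop.
Proof. by rewrite -ball_normE. Qed.

Lemma geometric_cauchyn (V : normedModType R) (u : V^nat) (C : R) :
  (forall n, `|u n.+1 - u n| <= C * 2^-1 ^+ n) -> cauchyn u.
Proof.
move=> uC; have C0 : 0 <= C.
  by have := uC 0%N; rewrite expr0 mulr1; exact: le_trans.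
(* The factor [1 - 2^-1 ^+ k] is the exact partial geometric sum; with it the induction on [k]
   closes as an equality. *)
have bound m k : `|u (m + k)%N - u m| <= C * 2 * 2^-1 ^+ m * (1 - 2^-1 ^+ k).
  elim: k => [|k ih]; first by rewrite addn0 subrr normr0 expr0 subrr mulr0.
  rewrite -[u (m + k.+1)%N](subrK (u (m + k)%N)) -addrA.
  rewrite (le_trans (ler_normD _ _))//.
  rewrite addnS (le_trans (lerD (uC (m + k)%N) ih))//.
  by rewrite exprD exprS le_eqVlt; apply/orP; left; apply/eqP; field.
move=> e e0.
have C1 : 0 < C * 4 + 1 by rewrite ltr_pwDr// mulr_ge0.
have : 2^-1 ^+ n @[n --> \oo] --> (0 : R).
  by apply: cvg_expr; rewrite ger0_norm ?invr_ge0// invf_lt1// ltr1n.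
move=> /cvgr0_norm_lt => /(_ (e / (C * 4 + 1))).
rewrite divr_gt0// => /(_ isT)[N _ NP].
have near_N m : (N <= m)%N -> `|u m - u N| < e / 2.
  move=> Nm; have := bound N (m - N)%N; rewrite subnKC// => /le_lt_trans; apply.
  have := NP N (leqnn N); rewrite /= ger0_norm ?exprn_ge0 ?invr_ge0// ltr_pdivlMr//.
  have : 0 < 2^-1 ^+ N :> R by rewrite exprn_gt0// invr_gt0.
  have : 0 <= 2^-1 ^+ (m - N) :> R by rewrite exprn_ge0// invr_ge0.
  set p := 2^-1 ^+ N; set q := 2^-1 ^+ (m - N) => q0 p0 h.
  rewrite (@le_lt_trans _ _ (C * 2 * p))//; last by lra.
  by rewrite ler_piMr// ?mulr_ge0 ?(ltW p0)// gerBl.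
exists N => m n /near_N um /near_N un.
rewrite -[u m](subrK (u N)) -addrA (le_lt_trans (ler_normD _ _))//.
by rewrite [e]splitr ltrD// distrC.
Qed.

Lemma cauchyn_R (u : R^nat) : cauchyn u -> cvgn u.
Proof.
move=> cu; apply/cauchy_cvgP/cauchy_ballP => e e0.
have e20 : 0 < e / 2 by rewrite divr_gt0.
have [N Nu] := cu _ e20.
exists (u @` [set n | (N <= n)%N], u @` [set n | (N <= n)%N]).
  by split; exists N => // n /= Nn; exists n.
move=> [x y] /= [[m Nm <-] [n Nn <-]]; rewrite normed_ballE.
by rewrite (lt_le_trans (Nu _ _ Nm Nn))// ler_pdivrMr// ler_pMr// ler1n.
Qed.

Lemma cauchyn_subseq_cvg (V : normedModType R) (u : V^nat) (k : nat -> nat) (l : V) :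
  cauchyn u -> (forall n, (n <= k n)%N) -> u (k n) @[n --> \oo] --> l ->
  u @ \oo --> l.
Proof.
move=> cu nk ul; apply/cvgrPdist_lt => e e0.
have e20 : 0 < e / 2 by rewrite divr_gt0.
have [N Nu] := cu _ e20.
have [M _ Mu] := cvgr_dist_lt _ _ ul _ e20.
exists N => // n /= Nn.
rewrite -(subrK (u (k (maxn N M))) l) -addrA.
rewrite (le_lt_trans (ler_normD _ _))// [e]splitr ltrD//.
  by apply: Mu => /=; exact: leq_maxr.
by apply: Nu => //; exact: leq_trans (leq_maxl _ _) (nk _).
Qed.

(** An ultrafilter containing [closure A] contains, for each n, a ball of radius 2^-n around one of
    finitely many centres. Two members of the ultrafilter meet, so the chosen centres form a Cauchy
    sequence, and the ultrafilter converges to their limit. *)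
Lemma totally_bounded_precompact (V : normedModType R) (A : set V) :
  cauchyn_complete V ->
  (forall e : R, 0 < e -> exists s : seq V,
     forall a, A a -> exists2 x, x \in s & `|a - x| < e) ->
  precompact A.
Proof.
move=> cV tA; rewrite precompactE compact_ultra => F UF FA.
have [x xP] : {x : nat -> V & forall n, F (ball (x n) (2^-1 ^+ n))}.
  apply: (@choice _ _ (fun n x => F (ball x (2^-1 ^+ n)))) => n.
  set e : R := 2^-1 ^+ n; have e0 : 0 < e by rewrite exprn_gt0// invr_gt0.
  have e20 : 0 < e / 2 by rewrite divr_gt0.
  have [s sA] := tA _ e20.
  have Fs : F [set y | exists2 x, x \in s & ball x e y].
    apply: filterS FA => y /(_ _ (nbhsx_ballx y (e / 2) e20))[z [/sA[x xs zx] yz]].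
    exists x => //; rewrite normed_ballE in yz; rewrite normed_ballE -(subrK z x) -addrA.
    by rewrite (le_lt_trans (ler_normD _ _))// [e]splitr ltrD// distrC.
  (* An ultrafilter that contains a finite union of balls contains one of them. *)
  elim: s Fs {sA} => [|a s ih] Fs.
    have : F set0 by apply: filterS Fs => y [].
    by have [+ _] := @ultra_proper _ _ UF => /[apply].
  have [Fa|Fa] := in_ultra_setVsetC (ball a e) UF; first by exists a.
  apply: ih; apply: filterS (filterI Fs Fa) => y [[z + zy] nay].
  by rewrite inE => /predU1P[za|zs]; [exfalso; apply: nay; rewrite -za|exists z].
have cx : cauchyn x.
  apply: (@geometric_cauchyn _ _ 2) => n.
  have [y [/= y1 y2]] := filter_ex (filterI (xP n) (xP n.+1)).
  rewrite -(subrK y (x n.+1)) -addrA (le_trans (ler_normD _ _))//.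
  rewrite !normed_ballE in y1 y2.
  rewrite [X in _ + X]distrC (le_trans (lerD (ltW y2) (ltW y1)))//.
  rewrite exprS; have : 0 < 2^-1 ^+ n :> R by rewrite exprn_gt0// invr_gt0.
  by set p := _ ^+ n => p0; lra.
have [l xl] := cV _ cx; exists l.
have Fl : F --> l.
  move=> B /nbhs_ballP[e e0 lB]; have e20 : 0 < e / 2 by rewrite divr_gt0.
  have [N _ Nx] := cvgr_dist_lt _ _ xl _ e20.
  have : 2^-1 ^+ n @[n --> \oo] --> (0 : R).
    by apply: cvg_expr; rewrite ger0_norm ?invr_ge0// invf_lt1// ltr1n.
  move=> /cvgr0_norm_lt => /(_ _ e20)[M _ MP].
  apply: filterS (xP (maxn N M)) => y yx; apply: lB; rewrite normed_ballE in yx; rewrite normed_ballE.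
  rewrite -(subrK (x (maxn N M)) l) -addrA (le_lt_trans (ler_normD _ _))//.
  rewrite [e]splitr ltrD//; first by apply: Nx => /=; exact: leq_maxl.
  rewrite (lt_trans yx)//; have := MP _ (leq_maxr N M).
  by rewrite /= ger0_norm// exprn_ge0// invr_ge0.
have /closure_id -> : closed (closure A) by exact: closed_closure.
split=> //.
by move=> B /Fl FB; exact: (filter_ex (filterI FA FB)).
Qed.

Lemma precompact_totally_bounded (V : normedModType R) (A : set V) :
  precompact A -> forall e : R, 0 < e -> exists s : seq V,
     forall a, A a -> exists2 x, x \in s & `|a - x| < e.
Proof.
rewrite precompactE compact_cover => cA e e0.
have [|x clx|s sA As] := cA _ (closure A) (fun x => ball x e).
- by move=> x _; exact: ball_open.
- by exists x => //; exact: ballxx.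
exists (finmap.enum_fset s) => a /subset_closure/As[x /= xs xa].
by exists x => //; rewrite distrC -normed_ballE.
Qed.

(** The Riesz argument without completeness: minimize J(u) = a(u, u) - 2 l(u) on [D]. The
    parallelogram law makes a minimizing sequence Cauchy for [a], and varying J in the direction w
    gives a(v, w) = l(w) in the limit. The result is a sequence and not a minimizer, so that each
    use can take the limit in the space where it exists: L_2 for the density of test functions, H^1
    times L_2(Gamma) for the Robin problem. *)
Lemma quadratic_minimizing_sequence (E : lmodType R) (D : set E)
    (a : E -> E -> R) (l : E -> R) (C : R) :
  D 0 -> (forall u v, D u -> D v -> D (u + v)) ->
  (forall k u, D u -> D (k *: u)) ->
  (forall u v, D u -> D v -> a u v = a v u) ->
  (forall u v w, D u -> D v -> D w -> a (u + v) w = a u w + a v w) ->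
  (forall k u w, D u -> D w -> a (k *: u) w = k * a u w) ->
  (forall u, D u -> 0 <= a u u) ->
  (forall u v, D u -> D v -> l (u + v) = l u + l v) ->
  (forall k u, D u -> l (k *: u) = k * l u) ->
  (forall u, D u -> l u ^+ 2 <= C * a u u) ->
  exists v : E^nat, [/\ forall n, D (v n),
    forall e : R, 0 < e -> exists N, forall m n, (N <= m)%N -> (N <= n)%N ->
      a (v m - v n) (v m - v n) < e &
    forall w, D w -> a (v n) w @[n --> \oo] --> l w].
Proof.
move=> D0 DD DZ aC aDl aZl a0 lD lZ lC.
have aDr u v w : D u -> D v -> D w -> a w (u + v) = a w u + a w v.
  by move=> Du Dv Dw; rewrite aC ?aDl ?(aC _ w)//; exact: DD.
have aZr k u w : D u -> D w -> a w (k *: u) = k * a w u.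
  by move=> Du Dw; rewrite aC ?aZl ?(aC _ w)//; exact: DZ.
pose J u := a u u - 2 * l u.
(* From l^2 <= c a and 4 c a <= (a + c)^2 follows 2 l <= a + c. *)
have C0' u : D u -> - `|C| <= J u.
  move=> Du; have h : l u ^+ 2 <= `|C| * a u u.
    by rewrite (le_trans (lC u Du))// ler_wpM2r ?a0// ler_norm.
  rewrite /J; have := a0 u Du; have := normr_ge0 C; move: h.
  set x := a u u; set c := `|C|; set y := l u => h c0 x0.
  have [y0|y0] := leP y 0; first by nra.
  have : 0 <= x + c - 2 * y; last by lra.
  rewrite subr_ge0 -ler_sqr ?nnegrE ?addr_ge0 ?mulr_ge0 ?(ltW y0)//.
  by have := sqr_ge0 (x - c); nra.
pose m := inf [set J u | u in D].
have hasinf : has_inf [set J u | u in D].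
  split; first by exists (J 0), 0.
  by exists (- `|C|) => _ [u Du <-]; exact: C0'.
have mJ u : D u -> m <= J u.
  by move=> Du; apply: ge_inf; [by case: hasinf|exists u].
have [v vP] : {v : nat -> E & forall n, D (v n) /\ J (v n) < m + n.+1%:R^-1}.
  apply: (@choice _ _ (fun n v => D v /\ J v < m + n.+1%:R^-1)) => n.
  have n0 : 0 < n.+1%:R^-1 :> R by rewrite invr_gt0.
  by have [_ [u Du <-] Ju] := inf_adherent n0 hasinf; exists u.
have parallelogram u w : D u -> D w ->
    a (u - w) (u - w) = 2 * J u + 2 * J w - 4 * J (2^-1 *: (u + w)).
  move=> Du Dw; have Dw' : D (- w) by rewrite -scaleN1r; exact: DZ.
  have Duw := DD _ _ Du Dw; have DZuw := DZ 2^-1 _ Duw.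
  have Duw' := DD _ _ Du Dw'.
  rewrite /J lZ// lD// aZl// aZr// !aDl// !aDr//.
  rewrite -(scaleN1r w) !aZl// ?scaleN1r// -(scaleN1r w) !aZr// ?scaleN1r//.
  by rewrite (aC w u)//; field.
exists v; split=> [n|e e0|w Dw]; first by have [] := vP n.
  have e40 : 0 < e / 4 by rewrite divr_gt0.
  have [N _ NP] := near_infty_natSinv_lt (PosNum e40).
  exists N => i j /NP/= Ni /NP/= Nj.
  have [Di Ji] := vP i; have [Dj Jj] := vP j.
  rewrite parallelogram//; have := mJ _ (DZ 2^-1 _ (DD _ _ Di Dj)).
  move: (J (2^-1 *: _)) (J (v i)) (J (v j)) (i.+1%:R^-1) (j.+1%:R^-1) Ji Jj Ni Nj.
  by move: m {hasinf mJ vP} => M p q r s t; lra.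
(* J(v_n) exceeds the infimum by less than 1/(n+1), so J cannot drop by more along v_n + t w. The
   [+ 1] in the denominator of [t] keeps it positive when a(w, w) = 0. *)
have key n : (a (v n) w - l w) ^+ 2 <= (a w w + 1) * n.+1%:R^-1.
  have [Dn Jn] := vP n; have q0 := a0 w Dw.
  set t := - (a (v n) w - l w) / (a w w + 1).
  have := mJ _ (DD _ _ Dn (DZ t _ Dw)).
  have DZw := DZ t _ Dw.
  have -> : J (v n + t *: w) = J (v n) + 2 * t * (a (v n) w - l w) + t ^+ 2 * a w w.
    rewrite /J lD// lZ// aDl// ?aDr ?aZl ?aZr//; last exact: DD.
    by rewrite (aC w)//; ring.
  move: Jn; rewrite /t; set q := a w w in q0 *; set b := a _ w - _.
  have q1 : q + 1 != 0 by rewrite gt_eqF// ltr_pwDr.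
  move=> Jn h.
  have : 2 * (- b / (q + 1)) * b + (- b / (q + 1)) ^+ 2 * q >= - n.+1%:R^-1.
    move: h; rewrite -addrA -lerBlDl; apply: le_trans.
    by rewrite lerBrDl -lerBrDr opprK ltW.
  have -> : 2 * (- b / (q + 1)) * b + (- b / (q + 1)) ^+ 2 * q =
     - (b ^+ 2 / (q + 1)) - (b / (q + 1)) ^+ 2 by field.
  move=> {}h.
  have : b ^+ 2 / (q + 1) <= n.+1%:R^-1 by rewrite -lerN2 (le_trans h)// gerDl oppr_le0 sqr_ge0.
  by rewrite ler_pdivrMr 1?mulrC// ltr_pwDr.
apply/cvgrPdist_lt => e e0.
have q0 : 0 < a w w + 1 by rewrite ltr_pwDr// a0.
have ee0 : 0 < e ^+ 2 / (a w w + 1) by rewrite divr_gt0// exprn_gt0.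
have [N _ NP] := near_infty_natSinv_lt (PosNum ee0).
exists N => // n /NP/= Nn; rewrite distrC.
rewrite -ltr_sqr ?nnegrE//; last exact: ltW.
rewrite real_normK ?num_real// (le_lt_trans (key n))//.
by rewrite mulrC -ltr_pdivlMr.
Qed.

End complete_sequences.

(** * Completeness of L_2 (Riesz-Fischer) *)

Section L2_complete.
Context {dT} {T : measurableType dT} {R : realType}.
Variable mu : {measure set T -> \bar R}.
Local Notation L2 := (LspaceType2 mu).

(** Stated in the extended reals, where the integral on the right can be fed to Fatou's lemma. *)
Lemma L2dist_sqr (u v : L2) :
  (`|u - v| ^+ 2)%:E = (\int[mu]_x ((u x - v x) ^+ 2)%:E)%E.
Proof.
have uL := Lspace2_Lfun u; have vL := Lspace2_Lfun v.
have uvL : (fun x => u x + (-1) * v x) \in Lfun mu 2%:E.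
  by apply: Lfun2D => //; exact: Lfun2Z.
have -> : u - v = L2class mu (fun x => u x + (-1) * v x).
  by rewrite L2classD ?L2classZ ?L2classK ?scaleN1r//; exact: Lfun2Z.
rewrite L2norm_class// fineK; first by under eq_integral do rewrite mulN1r.
by have /Lfun2P[_ /(integrable_fin_num measurableT)] := uvL.
Qed.

Lemma einfs_le (u : (\bar R)^nat) n : (einfs u n <= u n)%E.
Proof. by apply: ereal_inf_lbound; exists n => /=. Qed.

Lemma limn_einf_le (u : (\bar R)^nat) (c : \bar R) N :
  (forall n, (N <= n)%N -> u n <= c)%E -> (limn_einf u <= c)%E.
Proof.
move=> uc; rewrite limn_einf_lim; apply: lime_le; first exact: is_cvg_einfs.
by exists N => // n /= Nn; exact: le_trans (einfs_le _ _) (uc _ Nn).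
Qed.

(* Summing 4^k |u_{k+1} - u_k|^2 makes the sequence geometrically Cauchy at
   almost every point. *)
Lemma L2_fast_cauchy_ae (u : L2^nat) :
  (forall k, `|u k.+1 - u k| <= 4^-1 ^+ k) ->
  \forall x \ae mu, cvgn (fun k => u k x).
Proof.
move=> uk; pose D k x := (4 ^+ k * (u k.+1 x - u k x) ^+ 2)%:E.
have mD k : measurable_fun [set: T] (D k).
  apply/measurable_EFinP; apply: measurable_funM => //.
  by apply: measurable_funX; apply: measurable_funB; exact: Lspace2_measurable.
have D0 k x : (0 <= D k x)%E.
  by rewrite lee_fin mulr_ge0 ?sqr_ge0 ?exprn_ge0.
(* The weight 4^k costs only half of the decay: 4^k (4^-k)^2 = 4^-k. *)
have intD k : (\int[mu]_x D k x <= (4^-1 ^+ k)%:E)%E.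
  rewrite /D; under eq_integral do rewrite EFinM.
  rewrite ge0_integralZl_EFin//; last 2 first.
  - by move=> x _; rewrite lee_fin sqr_ge0.
  - apply/measurable_EFinP; apply: measurable_funX.
    by apply: measurable_funB; exact: Lspace2_measurable.
  rewrite -L2dist_sqr -EFinM lee_fin.
  have h : `|u k.+1 - u k| ^+ 2 <= (4^-1 ^+ k) ^+ 2.
    by rewrite lerXn2r// ?nnegrE// exprn_ge0// invr_ge0.
  rewrite (le_trans (ler_wpM2l _ h)) ?exprn_ge0//.
  by rewrite [in leLHS]expr2 mulrA -exprMn divff// expr1n mul1r.
pose F x := (\sum_(0 <= k <oo) D k x)%E.
have intF : mu.-integrable [set: T] F.
  apply/integrableP; split.
    by apply: ge0_emeasurable_sum => // k x _ _; exact: D0.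
  under eq_integral.
    by move=> x _; rewrite gee0_abs; [over|exact: nneseries_ge0].
  rewrite integral_nneseries//.
  apply: (@le_lt_trans _ _ (\sum_(0 <= k <oo) (2^-1 ^+ k)%:E)%E).
    apply: lee_nneseries => [k *|k _]; first by apply: integral_ge0.
    rewrite (le_trans (intD k))// lee_fin lerXn2r ?nnegrE ?invr_ge0//.
    by rewrite lef_pV2 ?posrE// ler_nat.
  apply: (@le_lt_trans _ _ 2%:E); last exact: ltry.
  apply: lime_le.
    by apply: is_cvg_nneseries => k _ _; rewrite lee_fin exprn_ge0// invr_ge0.
  apply: nearW => n; rewrite sumEFin lee_fin.
  have -> : \sum_(0 <= k < n) 2^-1 ^+ k = 2 * (1 - 2^-1 ^+ n) :> R.
    elim: n => [|n ih]; first by rewrite big_geq// expr0 subrr mulr0.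
    by rewrite big_nat_recr//= ih exprS; field.
  by rewrite mulrBr mulr1 gerBl mulr_ge0// exprn_ge0// invr_ge0.
move: (integrable_ae measurableT intF); apply: filterS => x /(_ I) Fx.
have [c Fxc] : exists c, F x = c%:E by exists (fine (F x)); rewrite fineK.
have Dc k : 4 ^+ k * (u k.+1 x - u k x) ^+ 2 <= c.
  rewrite -lee_fin -Fxc; apply: (le_trans _ (nneseries_lim_ge k.+1 _)) => //.
  rewrite (@big_nat_recr _ _ _ k)//= leeDr// sume_ge0//.
have c0 : 0 <= c by apply: le_trans (Dc 0%N); rewrite expr0 mul1r sqr_ge0.
apply/cauchyn_R/(@geometric_cauchyn _ R^o _ (Num.sqrt c)) => k.
rewrite -ler_sqr ?nnegrE ?mulr_ge0 ?exprn_ge0 ?sqrtr_ge0 ?invr_ge0//.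
rewrite real_normK ?num_real// exprMn sqr_sqrtr//.
by rewrite -exprM mulnC exprM exprVn -natrX exprVn ler_pdivlMr ?exprn_gt0// mulrC Dc.
Qed.

(** A subsequence with steps at most 4^-n converges almost everywhere. Fatou's lemma turns the
    Cauchy condition into norm convergence to the pointwise limit, and a Cauchy sequence follows its
    subsequence. *)
Lemma L2_complete : cauchyn_complete L2.
Proof.
move=> u cu.
have [N NP] : {N : nat -> nat & forall k m n, (N k <= m)%N -> (N k <= n)%N ->
    `|u m - u n| < 4^-1 ^+ k}.
  apply: (@choice _ _ (fun k N => forall m n, (N <= m)%N -> (N <= n)%N ->
    `|u m - u n| < 4^-1 ^+ k)) => k.
  by apply: cu; rewrite exprn_gt0// invr_gt0.
(* Adding all earlier thresholds makes the indices increase, dominate n, and be at least [N n]. *)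
pose k n := (n + \sum_(i < n.+1) N i)%N.
have Nk n : (N n <= k n)%N by rewrite /k big_ord_recr/= addnA leq_addl.
have kS n : (k n <= k n.+1)%N.
  by rewrite /k (big_ord_recr n.+1)/= leq_add ?leqnSn// leq_addr.
pose v n := u (k n).
have vs n : `|v n.+1 - v n| <= 4^-1 ^+ n.
  by apply/ltW/NP => //; exact: leq_trans (kS n).
have vcvg := L2_fast_cauchy_ae vs.
have cv : cauchyn v.
  apply: (@geometric_cauchyn _ _ _ 1) => n.
  rewrite mul1r (le_trans (vs n))// lerXn2r ?nnegrE ?invr_ge0//.
  by rewrite lef_pV2 ?posrE// ler_nat.
(* An upper limit is measurable without any choice of null set; where the sequence converges it is
   the limit. *)
pose f x := fine (limn_esup (fun n => (v n x)%:E)).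
have mf : measurable_fun [set: T] f.
  apply: measurableT_comp => //; apply: measurable_fun_limn_esup => n.
  by apply/measurable_EFinP; exact: Lspace2_measurable.
have vf : \forall x \ae mu, v n x @[n --> \oo] --> f x.
  move: vcvg; apply: filterS => x /cvg_ex[/= l vl].
  rewrite /f (_ : limn_esup _ = l%:E)//.
  by apply: (cvg_limn_einf_sup _).2; apply: cvg_EFin => //; exact: nearW.
have intf (e : R) : 0 < e -> exists M, forall n, (M <= n)%N ->
    (\int[mu]_x ((f x - v n x) ^+ 2)%:E <= (e ^+ 2)%:E)%E.
  move=> e0; have [M MP] := cv _ e0; exists M => n Mn.
  have mfv : measurable_fun [set: T] (fun x => ((f x - v n x) ^+ 2)%:E).
    apply/measurable_EFinP/measurable_funX/measurable_funB => //.
    exact: Lspace2_measurable.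
  have mvv m : measurable_fun [set: T] (fun x => ((v m x - v n x) ^+ 2)%:E).
    by apply/measurable_EFinP/measurable_funX/measurable_funB; exact: Lspace2_measurable.
  have -> : (\int[mu]_x ((f x - v n x) ^+ 2)%:E =
      \int[mu]_x limn_einf (fun m => ((v m x - v n x) ^+ 2)%:E))%E.
    apply: ae_eq_integral => //.
      rewrite (_ : (fun x => _) = (fun x => - limn_esup (fun m =>
          - ((v m x - v n x) ^+ 2)%:E))%E).
        apply: measurableT_comp => //.
        by apply: measurable_fun_limn_esup => m; exact: measurableT_comp.
      apply/funext => x; rewrite -limn_einfN; congr limn_einf.
      by apply/funext => m; rewrite /comp oppeK.
    move: vf; apply: filterS => x vfx _; symmetry.
    apply: (cvg_limn_einf_sup _).1; apply: cvg_EFin; first exact: nearW.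
    rewrite expr2; under eq_fun do rewrite expr2.
    by apply: cvgM; (apply: cvgB; [exact: vfx|exact: cvg_cst]).
  apply: (le_trans (fatou mu measurableT mvv _)).
    by move=> m x _; rewrite lee_fin sqr_ge0.
  apply: (@limn_einf_le _ _ M) => m Mm; rewrite -L2dist_sqr lee_fin.
  by rewrite lerXn2r// ?nnegrE ?(ltW e0)// ltW// MP.
have fL : f \in Lfun mu 2%:E.
  have [M /(_ M (leqnn M)) fM] := intf _ ltr01.
  have fvL : (fun x => f x - v M x) \in Lfun mu 2%:E.
    apply/Lfun2P; split.
      by apply: measurable_funB => //; exact: Lspace2_measurable.
    apply/integrableP; split.
      apply/measurable_EFinP/measurable_funX/measurable_funB => //.
      exact: Lspace2_measurable.
    rewrite (le_lt_trans _ (ltry 1))//.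
    under eq_integral do rewrite gee0_abs ?lee_fin ?sqr_ge0//.
    by rewrite expr1n in fM.
  have := Lfun2D fvL (Lspace2_Lfun (v M)).
  by under eq_fun do rewrite subrK.
exists (L2class mu f); apply: (cauchyn_subseq_cvg cu (k := k)).
  by move=> n; rewrite /k leq_addr.
apply/cvgrPdist_lt => e e0; have e20 : 0 < e / 2 by rewrite divr_gt0.
have [M MP] := intf _ e20; exists M => // n /= Mn.
have : ((`|L2class mu f - v n| ^+ 2)%:E <= ((e / 2) ^+ 2)%:E)%E.
  rewrite L2dist_sqr (le_trans _ (MP n Mn))// le_eqVlt; apply/orP; left; apply/eqP.
  apply: ae_eq_integral => //.
  - by apply/measurable_EFinP/measurable_funX/measurable_funB; exact: Lspace2_measurable.
  - apply/measurable_EFinP/measurable_funX/measurable_funB => //.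
    exact: Lspace2_measurable.
  by move: (L2class_ae fL); apply: filterS => x h _; rewrite h.
rewrite lee_fin ler_sqr ?nnegrE ?(ltW e20)// => /le_lt_trans; apply.
by rewrite ltr_pdivrMr// ltr_pMr// ltr1n.
Qed.

End L2_complete.

(** * Smooth functions and bumps *)

Section flat.
Context {R : realType}.
Implicit Types (p : {poly R}) (t : R).

(** The family p(1/t) e^(-1/t), extended by 0, is stable under differentiation when p runs over all
    polynomials; the bumps use only p = 1. *)
Definition flat p t : R := if 0 < t then p.[t^-1] * expR (- t^-1) else 0.

Lemma flat_pos p t : 0 < t -> flat p t = p.[t^-1] * expR (- t^-1).
Proof. by rewrite /flat => ->. Qed.

Lemma flat_npos p t : t <= 0 -> flat p t = 0.
Proof. by rewrite /flat leNgt => /negbTE ->. Qed.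

(** The exponential e^(1/t) outgrows t^-(n+2), with n the size of [p]. The order t^2 is what gives
    the derivative 0 at the origin. *)
Lemma flat_le_sqr p : exists2 C : R, 0 <= C &
  forall t, t <= 1 -> `|flat p t| <= C * t ^+ 2.
Proof.
pose n := size p; pose S := \sum_(i < n) `|p`_i|.
have S0 : 0 <= S by apply: sumr_ge0.
exists (S * (n.+3)`!%:R) => [|t t1]; first exact: mulr_ge0.
have [t0|t0] := leP t 0.
  by rewrite flat_npos// normr0 mulr_ge0 ?sqr_ge0// mulr_ge0.
rewrite flat_pos//; set s := t^-1; have s0 : 0 < s by rewrite invr_gt0.
have s1 : 1 <= s by rewrite invf_ge1.
have hp : `|p.[s]| <= S * s ^+ n.
  rewrite horner_coef (le_trans (ler_norm_sum _ _ _))// mulr_suml.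
  apply: ler_sum => i _; rewrite normrM ler_wpM2l//.
  by rewrite normrX ger0_norm ?(ltW s0)// ler_weXn2l// ltnW.
have he : s ^+ n.+2 / (n.+2)`!%:R <= expR s.
  by rewrite (le_trans _ (expR_ge1Dxn n.+1 (ltW s0)))// lerDr.
have -> : t ^+ 2 = (s ^+ 2)^-1 by rewrite -exprVn invrK.
rewrite normrM (ger0_norm (expR_ge0 _)) expRN ler_pdivrMr ?expR_gt0//.
rewrite (le_trans hp)// -!mulrA ler_wpM2l// mulrCA.
have sn : s ^+ n.+2 = s ^+ 2 * s ^+ n by rewrite -exprD.
rewrite ler_pdivlMl ?exprn_gt0// -sn mulrC.
move: he; rewrite ler_pdivrMr ?ltr0n ?fact_gt0// => /le_trans; apply.
by rewrite ler_wpM2l ?expR_ge0// ler_nat [(n.+3)`!]factS leq_pmull.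
Qed.

(** The derivative of p(1/t) e^(-1/t) is t^-2 (p - p')(1/t) e^(-1/t). *)
Let flat' p : {poly R} := 'X^2 * (p - p^`()).

Lemma is_derive_flat p t : is_derive t 1 (flat p) (flat (flat' p) t).
Proof.
have [t0|t0|->] := ltgtP t 0.
- rewrite (flat_npos _ (ltW t0)).
  have := @is_derive_cst _ _ R^o (0 : R) t 1; apply: near_eq_is_derive.
  near=> z; rewrite flat_npos//; apply: ltW.
  near: z; exact: lt_nbhsl.
- rewrite (flat_pos _ t0).
  suff h : is_derive t (1 : R) (fun z : R => p.[z^-1] * expR (- z^-1))
      ((flat' p).[t^-1] * expR (- t^-1)).
    move: h; apply: near_eq_is_derive.
    near=> z; rewrite flat_pos//; near: z; exact: lt_nbhsr.
  have tn0 : t != 0 by rewrite gt_eqF.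
  have dV : is_derive t 1 (fun z : R => z^-1) (- (t ^- 2)).
    have := @is_deriveV R id t 1 1 tn0 (is_derive_id _ _).
    by rewrite /GRing.scale/= mulr1.
  have dp : is_derive t 1 (fun z => p.[z^-1]) (- (t ^- 2) * p^`().[t^-1]).
    rewrite mulrC; apply: is_derive1_comp; exact: is_derive_poly.
  have dN : is_derive t 1 (fun z : R => - z^-1) (t ^- 2).
    by have := is_deriveN dV; rewrite opprK.
  have de : is_derive t 1 (fun z => expR (- z^-1)) (t ^- 2 * expR (- t^-1)).
    rewrite mulrC; apply: is_derive1_comp.
  apply: (is_derive_eq (is_deriveM dp de)).
  rewrite /flat' !hornerE /GRing.scale/= exprVn; ring.
- have [C C0 fC] := flat_le_sqr p.
  rewrite flat_npos//.
  have L : (fun h : R => h^-1 *: ((flat p \o shift 0) (h *: 1) - flat p 0)) @ 0^' --> (0 : R).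
    apply/cvgrPdist_le => e e0; have eC0 : 0 < e / (C + 1) by rewrite divr_gt0// ltr_pwDr.
    near=> h.
    rewrite sub0r normrN /= addr0 (flat_npos p (lexx 0)) subr0 /GRing.scale/= mulr1.
    have h0 : h != 0 by near: h; exact: nbhs_dnbhs_neq.
    have h1 : h <= 1.
      near: h; apply: cvg_within; near=> h; apply: ltW; near: h; exact: lt_nbhsl.
    have hC : `|h| <= e / (C + 1).
      near: h; exact: (@dnbhs0_le _ R^o).
    rewrite normrM normfV ler_pdivrMl ?normr_gt0// (le_trans (fC _ h1))//.
    rewrite -[h ^+ 2]real_normK ?num_real// expr2 mulrCA ler_wpM2l//.
    rewrite (le_trans (ler_wpM2l C0 hC))// mulrCA ler_piMr ?(ltW e0)//.
    by rewrite ler_pdivrMr ?mul1r ?lerDl// ltr_pwDr.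
  apply: DeriveDef; last exact: cvg_lim L.
  by apply/cvg_ex; exists 0.
Unshelve. all: by end_near.
Qed.

End flat.

(** * Stability properties of smooth functions *)

Section smooth_algebra.
Context {R : realType} {d : nat}.
Implicit Types (f g : 'rV[R]_d -> R^o) (i : 'I_d).

Lemma smooth_differentiable f x : smooth f -> differentiable f x.
Proof. by move=> /(_ [::] x). Qed.

Lemma smooth_pderiv f i : smooth f -> smooth (pderiv i f).
Proof. by move=> sf s x; have := sf (rcons s i) x; rewrite foldr_rcons. Qed.

(** Induction from the last entry of the sequence, because [foldr] applies that derivative first. *)
Lemma smooth_coind (P : set ('rV[R]_d -> R^o)) :
  (forall f, P f -> (forall x, differentiable f x) /\ forall i, P (pderiv i f)) ->
  forall f, P f -> smooth f.
Proof.
move=> Pd f Pf s; elim/last_ind: s f Pf => [|s i ih] f Pf; first by have [] := Pd f Pf.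
by rewrite foldr_rcons; apply: ih; have [] := Pd f Pf.
Qed.

(** A class stable under partial derivatives by the sum and product rules, to be fed to
    [smooth_coind]. The polynomial in the flat case is arbitrary because each derivative changes
    it. *)
Inductive smooth_expr : ('rV[R]_d -> R^o) -> Prop :=
  | smooth_expr_base f : smooth f -> smooth_expr f
  | smooth_expr_cst (c : R) : smooth_expr (cst c)
  | smooth_expr_flat (p : {poly R}) i (c a : R) :
      smooth_expr (fun x => flat p (c * x ord0 i + a))
  | smooth_expr_add f g : smooth_expr f -> smooth_expr g -> smooth_expr (f + g)
  | smooth_expr_mul f g : smooth_expr f -> smooth_expr g -> smooth_expr (f * g).

Lemma is_diff_affine_coord i (c a : R) (x : 'rV[R]_d) :
  is_diff x (fun y : 'rV[R]_d => c * y ord0 i + a : R^o)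
    (fun y : 'rV[R]_d => c * y ord0 i : R^o).
Proof.
pose L : 'rV[R]_d -> R^o := fun y => c * y ord0 i.
have L_lin : linear L.
  by move=> k u v; rewrite /L !mxE /GRing.scale/=; ring.
have cL : continuous L.
  move=> y; apply: (@continuousM _ _ (cst c) (fun z : 'rV[R]_d => z ord0 i)).
    exact: cst_continuous.
  exact: coord_continuous.
have diffL : is_diff x L L.
  pose L' := GRing.isLinear.Build _ _ _ _ L L_lin.
  pose LL : {linear 'rV[R]_d -> R^o} := HB.pack L L'.
  by apply: DiffDef; [exact: (@linear_differentiable _ _ _ LL)|exact: (@diff_lin _ _ _ LL)].
have := is_diffD diffL (is_diff_cst (a : R^o) x).
by rewrite addr0.
Qed.

Lemma pderiv_flat_affine (p : {poly R}) i j (c a : R) (x : 'rV[R]_d) :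
  differentiable (fun y : 'rV[R]_d => flat p (c * y ord0 i + a) : R^o) x /\
  pderiv j (fun y : 'rV[R]_d => flat p (c * y ord0 i + a)) x =
    (c * (i == j)%:R) * flat ('X^2 * (p - p^`())) (c * x ord0 i + a).
Proof.
have [dA eA] := is_diff_affine_coord i c a x.
have dF := is_derive_flat p (c * x ord0 i + a).
have dflat : differentiable (flat p : R^o -> R^o) (c * x ord0 i + a).
  exact/derivable1_diffP.
have dcomp := differentiable_comp dA dflat.
split; first exact: dcomp.
rewrite /pderiv (deriveE _ dcomp) diff_comp//= eA diff1E// derive1E derive_val.
by rewrite mxE eqxx.
Qed.

Lemma smooth_exprP f : smooth_expr f -> smooth f.
Proof.
apply: smooth_coind => {}f.
elim=> {f} [f sf|c|p i c a|f g _ [df pf] _ [dg pg]|f g sf [df pf] sg [dg pg]].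
- split=> [x|i]; first exact: smooth_differentiable.
  exact/smooth_expr_base/smooth_pderiv.
- split=> [x|i]; first exact: differentiable_cst.
  rewrite (_ : pderiv i _ = cst 0); first exact: smooth_expr_cst.
  by apply/funext => x; rewrite /pderiv derive_cst.
- split=> [x|j]; first by have [] := pderiv_flat_affine p i i c a x.
  rewrite (_ : pderiv j _ = cst (c * (i == j)%:R) *
      (fun y => flat ('X^2 * (p - p^`())) (c * y ord0 i + a))).
    by apply: smooth_expr_mul; [exact: smooth_expr_cst|exact: smooth_expr_flat].
  by apply/funext => x; have [_ ->] := pderiv_flat_affine p i j c a x.
- split=> [x|i]; first exact: differentiableD.
  rewrite (_ : pderiv i _ = pderiv i f + pderiv i g).
    exact: smooth_expr_add.
  by apply/funext => x; rewrite /pderiv deriveD//; exact: diff_derivable.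
- split=> [x|i]; first exact: differentiableM.
  rewrite (_ : pderiv i _ = f * pderiv i g + g * pderiv i f).
    by apply: smooth_expr_add; apply: smooth_expr_mul.
  by apply/funext => x; rewrite /pderiv deriveM//; exact: diff_derivable.
Qed.

Lemma pderivD i f g : smooth f -> smooth g ->
  pderiv i (f + g) = pderiv i f + pderiv i g.
Proof.
move=> sf sg; apply/funext => x; rewrite /pderiv deriveD//;
  exact/diff_derivable/smooth_differentiable.
Qed.

Lemma pderivM i f g : smooth f -> smooth g ->
  pderiv i (f * g) = f * pderiv i g + g * pderiv i f.
Proof.
move=> sf sg; apply/funext => x; rewrite /pderiv deriveM//;
  exact/diff_derivable/smooth_differentiable.
Qed.

Lemma pderiv_cst i (c : R) : pderiv i (cst c : 'rV[R]_d -> R^o) = cst 0.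
Proof. by apply/funext => x; rewrite /pderiv derive_cst. Qed.

Lemma smooth_cst (c : R) : smooth (cst c : 'rV[R]_d -> R^o).
Proof. exact/smooth_exprP/smooth_expr_cst. Qed.

Lemma smoothD f g : smooth f -> smooth g -> smooth (f + g).
Proof.
by move=> sf sg; apply/smooth_exprP/smooth_expr_add; exact: smooth_expr_base.
Qed.

Lemma smoothM f g : smooth f -> smooth g -> smooth (f * g).
Proof.
by move=> sf sg; apply/smooth_exprP/smooth_expr_mul; exact: smooth_expr_base.
Qed.

Lemma smooth_flat_affine (p : {poly R}) i (c a : R) :
  smooth (fun x : 'rV[R]_d => flat p (c * x ord0 i + a)).
Proof. exact/smooth_exprP/smooth_expr_flat. Qed.

Lemma smooth_prod (I : Type) (s : seq I) (F : I -> 'rV[R]_d -> R^o) :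
  (forall k, smooth (F k)) -> smooth (\prod_(k <- s) F k).
Proof.
move=> sF; elim/big_ind : _ => // [|f g]; last exact: smoothM.
exact: smooth_cst.
Qed.

Lemma smooth_continuous f : smooth f -> continuous f.
Proof. by move=> sf x; exact/differentiable_continuous/smooth_differentiable. Qed.

End smooth_algebra.

(** * Bump functions and approximation of indicators of open sets *)

Section test_functions.
Context {R : realType} {d : nat}.
Implicit Types (f g : 'rV[R]_d -> R^o) (U K : set 'rV[R]_d).

Lemma test_function_supp U f : test_function U f ->
  exists K, [/\ compact K, K `<=` U & forall x, ~ K x -> f x = 0].
Proof.
move=> [_ cf fU]; exists (closure [set x | f x != 0]); split=> // x nx.
by apply/eqP; apply: contra_notT nx => fx; exact: subset_closure.
Qed.

Lemma supp_test_function U K f : smooth f -> compact K -> K `<=` U ->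
  (forall x, ~ K x -> f x = 0) -> test_function U f.
Proof.
move=> sf cK KU f0; have clK : closed K.
  by apply: compact_closed => //; exact: norm_hausdorff.
have fK : closure [set x | f x != 0] `<=` K.
  rewrite [X in _ `<=` X](closure_id K).1//; apply: closureS => x /= fx.
  by apply: contrapT => /f0 /eqP; exact/negP.
split=> //; last exact: subset_trans KU.
exact: subclosed_compact (@closed_closure _ _) cK fK.
Qed.

Lemma test_function_subset U V f : U `<=` V -> test_function U f -> test_function V f.
Proof. by move=> UV [? ? fU]; split=> //; exact: subset_trans UV. Qed.

Lemma test_function_smooth U f : test_function U f -> smooth f.
Proof. by case. Qed.

Lemma test_function0 U : test_function U (cst 0).
Proof.
apply: (@supp_test_function U set0) => //; [exact: smooth_cst|exact: compact0].
Qed.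

Lemma test_functionD U f g : test_function U f -> test_function U g ->
  test_function U (f + g).
Proof.
move=> /[dup] /test_function_smooth sf /test_function_supp[K [cK KU f0]].
move=> /[dup] /test_function_smooth sg /test_function_supp[L [cL LU g0]].
apply: (@supp_test_function U (K `|` L)).
- exact: smoothD.
- exact: compactU.
- by move=> x [/KU|/LU].
- by move=> x /not_orP[/f0 fx /g0 gx]; rewrite fctE fx gx addr0.
Qed.

Lemma test_functionMl U f g : smooth g -> test_function U f ->
  test_function U (g * f).
Proof.
move=> sg /[dup] /test_function_smooth sf /test_function_supp[K [cK KU f0]].
apply: (@supp_test_function U K) => //; first exact: smoothM.
by move=> x /f0 fx; rewrite fctE fx mulr0.
Qed.

Lemma test_functionZ U (c : R) f : test_function U f -> test_function U (cst c * f).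
Proof. by apply: test_functionMl; exact: smooth_cst. Qed.

Lemma test_function_pderiv U i f : test_function U f -> test_function U (pderiv i f).
Proof.
move=> /[dup] /test_function_smooth sf /test_function_supp[K [cK KU f0]].
apply: (@supp_test_function U K) => //; first exact: smooth_pderiv.
move=> x nKx; have clK : closed K.
  by apply: compact_closed => //; exact: norm_hausdorff.
have : \near x, f x = cst 0 x.
  have : open_nbhs x (~` K) by split=> //; rewrite openC.
  by move=> /open_nbhs_nbhs; apply: filterS => y /f0.
by rewrite /pderiv => /near_eq_derive ->; rewrite derive_cst.
Qed.

Lemma fct_prodE (I : Type) (s : seq I) (F : I -> 'rV[R]_d -> R^o) x :
  (\prod_(k <- s) F k) x = \prod_(k <- s) F k x.
Proof. exact: (big_morph (fun f : 'rV[R]_d -> R^o => f x)). Qed.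

(** For k > 0, positive exactly on the slab |x_i - c_i| < r. As k grows, e^(-1/(k t)) tends to 1 for
    each t > 0, so the product over i tends to the indicator of the ball, which is a cube for this
    norm. *)
Definition bump1 (c : 'rV[R]_d) (r k : R) (i : 'I_d) : 'rV[R]_d -> R^o :=
  ((fun x => flat 1 (k * x ord0 i + k * (r - c ord0 i))) : 'rV[R]_d -> R^o) *
  (fun x => flat 1 (- k * x ord0 i + k * (c ord0 i + r))).

Definition bump (c : 'rV[R]_d) (r k : R) : 'rV[R]_d -> R^o :=
  \prod_(i <- enum 'I_d) bump1 c r k i.

Lemma bumpE c r k x : bump c r k x = \prod_(i <- enum 'I_d)
  (flat 1 (k * (x ord0 i - c ord0 i + r)) * flat 1 (k * (c ord0 i - x ord0 i + r))).
Proof.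
rewrite /bump fct_prodE; apply: eq_bigr => i _.
by rewrite /bump1 fctE; congr (flat 1 _ * flat 1 _); ring.
Qed.

Lemma flat1_ge0 (t : R) : 0 <= flat 1 t.
Proof. by rewrite /flat; case: ifPn => // _; rewrite hornerE mul1r expR_ge0. Qed.

Lemma flat1_le1 (t : R) : flat 1 t <= 1.
Proof.
rewrite /flat; case: ifPn => // t0; rewrite hornerE mul1r.
by rewrite -[leRHS]expR0 ler_expR oppr_le0 invr_ge0 ltW.
Qed.

Lemma flat1_gt0 (t : R) : 0 < t -> 0 < flat 1 t.
Proof. by move=> t0; rewrite flat_pos// hornerE mul1r expR_gt0. Qed.

Lemma smooth_bump c r k : smooth (bump c r k).
Proof. by apply: smooth_prod => i; apply: smoothM; exact: smooth_flat_affine. Qed.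

Lemma bump_ge0 c r k x : 0 <= bump c r k x.
Proof. by rewrite bumpE prodr_ge0// => i _; rewrite mulr_ge0// flat1_ge0. Qed.

Lemma bump_le1 c r k x : bump c r k x <= 1.
Proof.
rewrite bumpE; apply: prodr_ile1 => i _.
by rewrite mulr_ge0 ?flat1_ge0//= mulr_ile1 ?flat1_ge0 ?flat1_le1.
Qed.

Lemma ball_rVP (c x : 'rV[R]_d) (r : R) : 0 < r ->
  ball c r x <-> forall i, `|c ord0 i - x ord0 i| < r.
Proof.
move=> r0; split=> [cx i|cx]; first by have [_ /(_ ord0 i)] := cx.
by split=> // i j; rewrite ord1; exact: cx.
Qed.

Lemma bump_gt0 c r k x : 0 < k -> ball c r x -> 0 < bump c r k x.
Proof.
move=> k0 cx; have r0 : 0 < r by case: cx.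
rewrite bumpE prodr_gt0// => i _.
have := (ball_rVP _ _ r0).1 cx i; rewrite ltr_norml => /andP[h1 h2].
by rewrite mulr_gt0// flat1_gt0// mulr_gt0//; lra.
Qed.

Lemma bump_eq0 c r k x : 0 < r -> 0 < k -> ~ ball c r x -> bump c r k x = 0.
Proof.
move=> r0 k0 ncx; rewrite bumpE.
have /existsNP[i] : ~ forall i, `|c ord0 i - x ord0 i| < r by move=> /(ball_rVP _ _ r0).
move=> /negP; rewrite -leNgt => ri; apply/eqP; rewrite prodf_seq_eq0.
apply/hasP; exists i; first exact: mem_enum.
rewrite /= mulf_eq0; move: ri; rewrite ler_normr => /orP[ri|ri].
  by rewrite [flat 1 _]flat_npos ?eqxx// pmulr_rle0//; lra.
by rewrite [X in _ || (X == 0)]flat_npos ?eqxx ?orbT// pmulr_rle0//; lra.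
Qed.

Lemma flat1_cvg (t : R) : 0 < t -> flat 1 (k.+1%:R * t) @[k --> \oo] --> (1 : R).
Proof.
move=> t0.
have -> : (fun k => flat 1 (k.+1%:R * t)) = (fun k => expR (- (t^-1 * k.+1%:R^-1))).
  by apply/funext => k; rewrite flat_pos ?mulr_gt0// hornerE mul1r invfM mulrC.
rewrite -[X in _ --> X]expR0; apply: continuous_cvg; first exact: continuous_expR.
rewrite -[X in _ --> X]oppr0; apply: cvgN; rewrite -[X in _ --> X](mulr0 t^-1).
by apply: cvgM; [exact: cvg_cst|exact: cvg_harmonic].
Qed.

Lemma bump_cvg c r x : ball c r x -> bump c r k.+1%:R x @[k --> \oo] --> (1 : R).
Proof.
move=> cx; have r0 : 0 < r by case: cx.
pose a (i : 'I_d) (k : nat) : R := flat 1 (k.+1%:R * (x ord0 i - c ord0 i + r)) *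
  flat 1 (k.+1%:R * (c ord0 i - x ord0 i + r)).
suff key s : (fun k => \prod_(i <- s) a i k) @ \oo --> (1 : R).
  by under eq_fun do rewrite bumpE; exact: key.
elim: s => [|i s ih].
  rewrite (_ : (fun k => _) = cst 1); first exact: cvg_cst.
  by apply/funext => k; rewrite big_nil.
rewrite (_ : (fun k => _) = a i \* (fun k => \prod_(i <- s) a i k)); last first.
  by apply/funext => k; rewrite big_cons.
rewrite -[X in _ --> X]mul1r; apply: cvgM => //.
have := (ball_rVP _ _ r0).1 cx i; rewrite ltr_norml => /andP[h1 h2].
by rewrite -[X in _ --> X]mul1r; apply: cvgM; apply: flat1_cvg; lra.
Qed.

Lemma closed_ball_compact (c : 'rV[R]_d) (r : R) : compact (closed_ball c r).
Proof.
apply: bounded_closed_compact; last exact: closed_ball_closed.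
exists (`|c| + r); split; first exact: num_real.
move=> M cM x; have [r0|r0] := leP r 0; first by rewrite closed_ball0.
rewrite closed_ballE// /closed_ball_/= => cx; rewrite (le_trans _ (ltW cM))//.
by rewrite -[x](subrK c) addrC (le_trans (ler_normD _ _))// lerD2l distrC.
Qed.

Lemma test_function_bump U c r k : 0 < r -> 0 < k -> closed_ball c r `<=` U ->
  test_function U (bump c r k).
Proof.
move=> r0 k0 crU; apply: (@supp_test_function U (closed_ball c r)) => //.
- exact: smooth_bump.
- exact: closed_ball_compact.
- by move=> x nx; apply: bump_eq0 => // /subset_closed_ball.
Qed.

(** f + (1 - f) b = 1 - (1 - f)(1 - b): a smooth union, which stays in [0, 1] and increases with
    m. *)
Fixpoint bump_union (q : nat -> option ('rV[R]_d * R)) (k : R) m : 'rV[R]_d -> R^o :=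
  if m is m'.+1 then
    let f := bump_union q k m' in
    if q m' is Some (c, r) then f + (1 - f) * bump c r k else f
  else cst 0.

(** The balls with rational centres and radii 1/(k+1) whose closure lies in [U]; [None] fills the
    codes that give no such ball. Closed balls are asked for so that the bumps have compact support
    in [U]. *)
Lemma open_ball_enum U : open U -> exists q : nat -> option ('rV[R]_d * R),
  (forall n c r, q n = Some (c, r) -> 0 < r /\ closed_ball c r `<=` U) /\
  (forall x, U x -> exists n c r, q n = Some (c, r) /\ ball c r x).
Proof.
move=> oU.
pose ctr (p : 'rV[rat]_d * nat) : 'rV[R]_d := \row_i ratr (p.1 ord0 i).
pose rad (p : 'rV[rat]_d * nat) : R := p.2.+1%:R^-1.
pose q n := if unpickle n is Some p then
    if `[< closed_ball (ctr p) (rad p) `<=` U >]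
    then Some (ctr p, rad p) else None
  else None.
exists q; split=> [n c r|x Ux].
  rewrite /q; case: unpickle => // p; case: asboolP => // pU [<- <-].
  by rewrite /rad invr_gt0.
have /nbhs_ballP[e e0 xeU] : nbhs x U by exact: open_nbhs_nbhs.
(* One third of e for the distance from x to the rational centre, two for the closed ball around
   that centre. *)
have e30 : 0 < e / 3 by rewrite divr_gt0.
have [k _ /(_ k (leqnn k)) /= ke] := near_infty_natSinv_lt (PosNum e30).
have k0 : 0 < k.+1%:R^-1 :> R by rewrite invr_gt0.
have /choice[p pP] : forall i : 'I_d,
    exists p : rat, `|ratr p - x ord0 i| < k.+1%:R^-1.
  move=> i; have /rat_in_itvoo[p] :
      x ord0 i - k.+1%:R^-1 < x ord0 i + k.+1%:R^-1.
    by rewrite ltrBlDr -addrA ltrDl addr_gt0.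
  by rewrite in_itv/= => /andP[p1 p2]; exists p; rewrite ltr_distl p1 p2.
pose P : 'rV[rat]_d * nat := (\row_i p i, k).
have cx : ball (ctr P) k.+1%:R^-1 x.
  by apply/ball_rVP => // i; rewrite !mxE.
exists (pickle P), (ctr P), k.+1%:R^-1; split=> //.
rewrite /q pickleK asboolT// => y yP; apply: xeU.
have : ball (ctr P) (e / 3 + e / 3) y.
  apply: closed_ball_subset yP => //; rewrite (lt_le_trans ke)// lerDl.
  exact: ltW.
have : ball x (e / 3) (ctr P) by apply: ball_sym; exact: le_ball (ltW ke) _ cx.
by move=> /ball_triangle/[apply]; apply: le_ball; lra.
Qed.

(** A diagonal choice: [f k] joins the balls among the first k codes, with bumps of steepness k + 1.
    Each point of [U] lies in some ball of the list, and once that ball is included [f k] dominates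
    a bump that tends to 1 there. *)
Lemma open_indicator_tests U : open U -> exists f : ('rV[R]_d -> R^o)^nat,
  [/\ forall k, test_function U (f k), forall k x, 0 <= f k x <= 1 &
      forall x, f k x @[k --> \oo] --> (\1_U x : R)].
Proof.
move=> oU; have [q [qU Uq]] := open_ball_enum oU.
pose f m k := bump_union q k.+1%:R m.
have fS m k x : f m.+1 k x = f m k x + (1 - f m k x) *
    (if q m is Some (c, r) then bump c r k.+1%:R x else 0).
  by rewrite /f/=; case: (q m) => [[c r]|] //; rewrite mulr0 addr0.
have f01 m k x : 0 <= f m k x <= 1.
  elim: m => [|m /andP[f0 f1]]; first by rewrite /f/= lexx ler01.
  rewrite fS; case: (q m) => [[c r]|]; last by rewrite mulr0 addr0 f0.
  have := bump_ge0 c r k.+1%:R x; have := bump_le1 c r k.+1%:R x.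
  by move: f0 f1; set a := f m k x; set b := bump _ _ _ _ => *; apply/andP; split; nra.
have f_nd m n k x : (m <= n)%N -> f m k x <= f n k x.
  move=> /subnK <-; elim: (n - m)%N => [|j ih]; first by rewrite add0n.
  rewrite addSn fS (le_trans ih)// lerDl mulr_ge0//.
    by rewrite subr_ge0; have /andP[] := f01 (j + m)%N k x.
  by case: (q _) => [[c r]|] //; exact: bump_ge0.
exists (fun k => f k k); split=> [k|k x|x].
- rewrite /f; elim: {2}k => [|m ih]; first exact: test_function0.
  rewrite /=; case qm : (q m) => [[c r]|] //; have [r0 crU] := qU _ _ _ qm.
  apply: test_functionD => //; apply: test_functionMl.
    apply: smoothD; first exact: smooth_cst.
    rewrite (_ : - _ = cst (-1) * bump_union q k.+1%:R m).
      by apply: smoothM; [exact: smooth_cst|exact: test_function_smooth ih].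
    by apply/funext => x; rewrite !fctE mulN1r.
  exact: test_function_bump.
- exact: f01.
have [Ux|nUx] := pselect (U x); last first.
  rewrite indicE memNset//= (_ : (fun k => _) = cst 0); first exact: cvg_cst.
  apply/funext => k; rewrite /f; elim: {2}k => // m ih /=.
  case qm : (q m) => [[c r]|] //; have [r0 crU] := qU _ _ _ qm.
  by rewrite !fctE ih add0r bump_eq0 ?mulr0// => /subset_closed_ball/crU.
have [n [c [r [qn cx]]]] := Uq x Ux.
rewrite indicE mem_set//=.
apply: (@squeeze_cvgr _ _ _ _ (fun k => bump c r k.+1%:R x) (cst 1)).
- exists n.+1 => // k /= nk; apply/andP; split; last by have /andP[] := f01 k k x.
  apply: le_trans (f_nd _ _ k x nk); rewrite fS qn.
  have /andP[f0 f1] := f01 n k x; have := bump_le1 c r k.+1%:R x.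
  by move: f0 f1; set a := f n k x; set b := bump _ _ _ _ => *; nra.
- exact: bump_cvg.
- exact: cvg_cst.
Qed.

End test_functions.

(** * Lebesgue measure on row vectors *)

Section integral_mrestr.
Context {dT} {T : measurableType dT} {R : realType}.
Variables (mu : {measure set T -> \bar R}) (D : set T) (mD : measurable D).

(** [mu] is the sum of its restrictions to [D] and to the complement; for the latter [F] is 0 almost
    everywhere. *)
Lemma ge0_integral_mrestr (F : T -> \bar R) : measurable_fun [set: T] F ->
  (forall x, 0 <= F x)%E -> (forall x, ~ D x -> F x = 0%E) ->
  (\int[mrestr mu mD]_x F x = \int[mu]_x F x)%E.
Proof.
move=> mF F0 FD; have mDC := measurableC mD.
rewrite (eq_measure_integral (measure_add (mrestr mu mD) (mrestr mu mDC)) (m1 := mu)).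
  rewrite ge0_integral_measure_add// [X in (_ + X)%E](_ : _ = 0)%E ?adde0//.
  rewrite (ae_eq_integral (cst 0%E))//; first exact: integral0.
  have D0 : mrestr mu mDC D = 0%E by rewrite /mrestr setICr measure0.
  exists D; split=> // x /= /not_implyP[_ Fx]; apply: contrapT => /FD; exact: Fx.
move=> A mA _; rewrite [RHS](measure_addE (mrestr mu mD) (mrestr mu mDC)).
transitivity (mu ((A `&` D) `|` (A `&` ~` D))).
  by rewrite -setIUr setUCr setIT.
apply: measureU.
- exact: measurableI.
- exact: measurableI.
- by rewrite setIACA setICr setI0.
Qed.

Lemma integral_mrestrE (F : T -> \bar R) : measurable_fun [set: T] F ->
  (forall x, ~ D x -> F x = 0%E) ->
  (\int[mrestr mu mD]_x F x = \int[mu]_x F x)%E.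
Proof.
move=> mF FD; rewrite [LHS]integralE [RHS]integralE.
congr (_ - _)%E; apply: ge0_integral_mrestr => //.
- exact: measurable_funepos.
- by move=> x /FD Fx; rewrite funeposE Fx maxxx.
- exact: measurable_funeneg.
- by move=> x /FD Fx; rewrite funenegE Fx oppe0 maxxx.
Qed.

End integral_mrestr.

Section lebesgue_rV_theory.
Context {R : realType}.

Lemma lebesgue_measure_translation (v : R) (A : set R) :
  measurable (A : set (measurableTypeR R)) ->
  pushforward lebesgue_measure
    ((fun x => x + v) : measurableTypeR R -> measurableTypeR R) A = lebesgue_measure A.
Proof.
move=> mA; apply/esym/lebesgue_measure_unique => //=.
  exact: measurable_funD.
move=> mv _ [[a b]] _ <-; rewrite /pushforward.
rewrite (_ : _ @^-1` _ = `]a - v, b - v]%classic); last first.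
  by apply/seteqP; split=> x /=; rewrite !in_itv/= ltrBlDr lerBrDr.
rewrite !lebesgue_measure_itv/= !lte_fin ltrD2r.
by case: ifPn => // _; rewrite -!EFinD; congr EFin; ring.
Qed.

Lemma continuous_measurable_rV n (f : 'rV[R]_n -> R) : continuous f ->
  measurable_fun [set: 'rV[R]_n] f.
Proof.
move=> cf; apply: (measurability _ (RGenOpens.measurableE R)).
move=> _ [_ [a [b ->]] <-]; rewrite setTI; apply: open_measurable_rV.
by apply: open_comp => [x _|]; [exact: cf|exact: interval_open].
Qed.

Lemma measurable_translation_rV n (v : 'rV[R]_n) :
  measurable_fun [set: 'rV[R]_n] (fun x => x + v).
Proof.
apply: measurable_fun_rV => i; apply: continuous_measurable_rV.
under eq_fun do rewrite mxE.
move=> x; apply: (@continuousD _ _ _ (fun z : 'rV[R]_n => z ord0 i) (cst _)).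
  exact: coord_continuous.
exact: cst_continuous.
Qed.

(** A copy of the map behind [lebesgue_rV_succ], convertible to it, so that the recursion for
    [lebesgue_rV] holds by computation. *)
Let cons_rV n (p : measurableTypeR R * 'rV[R]_n) : 'rV[R]_n.+1 :=
  row_mx (\row_(i < 1) p.1) p.2.

Let cons_rV0 n (p : measurableTypeR R * 'rV[R]_n) : cons_rV p ord0 ord0 = p.1.
Proof.
have -> : ord0 = lshift n ord0 :> 'I_(1 + n) by apply: val_inj.
by apply: (etrans (row_mxEl (\row_(i < 1) p.1) p.2 ord0 ord0)); rewrite mxE.
Qed.

Let cons_rVS n (p : measurableTypeR R * 'rV[R]_n) (i : 'I_n) :
  cons_rV p ord0 (lift ord0 i) = p.2 ord0 i.
Proof.
have -> : lift ord0 i = rshift 1 i :> 'I_(1 + n) by apply: val_inj.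
exact: (row_mxEr (\row_(i < 1) p.1) p.2 ord0 i).
Qed.

Let measurable_cons_rV n : measurable_fun [set: _] (@cons_rV n).
Proof.
apply: measurable_fun_rV => i; case: (unliftP ord0 i) => [j|] ->.
- under eq_fun do rewrite cons_rVS.
  by apply: (measurableT_comp (measurable_coord_rV j)); exact: measurable_snd.
- under eq_fun do rewrite cons_rV0.
  exact: measurable_fst.
Qed.

Let lebesgue_rVS n (A : set 'rV[R]_n.+1) :
  lebesgue_rV n.+1 A =
    (@lebesgue_measure R \x @lebesgue_rV R n)%E (@cons_rV n @^-1` A).
Proof. by []. Qed.

(** Balls for the norm of row vectors are cubes of side 2 r, so the product measure gives their
    volume directly. *)
Lemma lebesgue_rV_ball n (c : 'rV[R]_n) (r : R) : 0 < r ->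
  lebesgue_rV n (ball c r) = ((2 * r) ^+ n)%:E.
Proof.
move=> r0; elim: n c => [|n ih] c.
  rewrite /= diracE mem_set ?expr0//.
  by apply/ball_rVP => // -[].
pose c' : 'rV[R]_n := \row_i c ord0 (lift ord0 i).
rewrite lebesgue_rVS (_ : _ @^-1` _ = `]c ord0 ord0 - r, c ord0 ord0 + r[%classic `*` ball c' r).
  rewrite product_measure1E//; last by apply: open_measurable_rV; exact: ball_open.
  transitivity ((2 * r)%:E * ((2 * r) ^+ n)%:E)%E; last by rewrite -EFinM exprS.
  congr (_ * _)%E; last exact: ih.
  apply: (etrans (lebesgue_measure_itv _)).
  rewrite /= lte_fin ltrBlDr -addrA ltrDl addr_gt0// -EFinB.
  by congr EFin; ring.
apply/seteqP; split=> [[t x]/= /ball_rVP cx|[t x]/= [+ /ball_rVP cx]].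
  have {}cx := cx r0; split.
    by rewrite in_itv/=; have := cx ord0; rewrite cons_rV0/= ltr_distlC.
  by apply/ball_rVP => // i; have := cx (lift ord0 i); rewrite cons_rVS mxE.
rewrite in_itv/= -ltr_distlC => tr; apply/ball_rVP => // i.
case: (unliftP ord0 i) => [j|] ->; last by rewrite cons_rV0.
by rewrite cons_rVS; have := cx r0 j; rewrite mxE.
Qed.

Lemma lebesgue_rV_translation n (v : 'rV[R]_n) (A : set 'rV[R]_n) : measurable A ->
  pushforward (@lebesgue_rV R n) (fun x => x + v) A = lebesgue_rV n A.
Proof.
elim: n v A => [|n ih] v A mA.
  by rewrite /pushforward/= (_ : _ @^-1` _ = A)//; apply/seteqP; split=> x /=;
    rewrite [_ + v](_ : _ = x)//; apply/rowP => -[].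
pose v' : 'rV[R]_n := \row_i v ord0 (lift ord0 i).
pose tr (p : measurableTypeR R * 'rV[R]_n) : measurableTypeR R * 'rV[R]_n :=
  (p.1 + v ord0 ord0, p.2 + v').
have mtr : measurable_fun [set: _] tr.
  apply: measurable_fun_pair.
    by apply: measurable_funD => //; exact: measurable_fst.
  by apply: (measurableT_comp (measurable_translation_rV v')); exact: measurable_snd.
have mcA : measurable (@cons_rV n @^-1` A).
  by rewrite -[X in measurable X]setTI; exact: measurable_cons_rV.
rewrite /pushforward !lebesgue_rVS.
rewrite (_ : cons_rV (n := n) @^-1` _ = tr @^-1` (@cons_rV n @^-1` A)); last first.
  suff E p : cons_rV p + v = cons_rV (tr p) by apply/seteqP; split=> p /=; rewrite E.
  apply/rowP => i; rewrite mxE; case: (unliftP ord0 i) => [j|] ->.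
    by rewrite !cons_rVS !mxE.
  by rewrite !cons_rV0.
rewrite [RHS](product_measure_unique
  (m' := pushforward (@lebesgue_measure R \x @lebesgue_rV R n)%E tr))//.
move=> B C mB mC.
transitivity ((@lebesgue_measure R \x @lebesgue_rV R n)%E
  (((fun x => x + v ord0 ord0) @^-1` B) `*` ((fun x => x + v') @^-1` C))) => //.
rewrite product_measure1E.
- congr (_ * _)%E; last exact: (ih v' C mC).
  exact: (lebesgue_measure_translation (v ord0 ord0) mB).
- rewrite -[X in measurable X]setTI.
  by apply: (@measurable_funD _ (measurableTypeR R)) => //.
- by rewrite -[X in measurable X]setTI; exact: measurable_translation_rV.
Qed.

Lemma ge0_integral_translation n (v : 'rV[R]_n) (F : 'rV[R]_n -> \bar R) :
  measurable_fun [set: _] F -> (forall x, 0 <= F x)%E ->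
  (\int[lebesgue_rV n]_x F (x + v)%R = \int[lebesgue_rV n]_x F x)%E.
Proof.
move=> mF F0.
have mv := measurable_translation_rV v.
transitivity (\int[pushforward (@lebesgue_rV R n) (fun x => (x + v)%R)]_x F x)%E.
  by rewrite ge0_integral_pushforward.
by apply: eq_measure_integral => A mA _; exact: lebesgue_rV_translation.
Qed.

Lemma integral_translation n (v : 'rV[R]_n) (F : 'rV[R]_n -> \bar R) :
  measurable_fun [set: _] F ->
  (\int[lebesgue_rV n]_x F (x + v)%R = \int[lebesgue_rV n]_x F x)%E.
Proof.
move=> mF; rewrite [LHS]integralE [RHS]integralE; congr (_ - _)%E.
- under eq_integral do rewrite funeposE; under [RHS]eq_integral do rewrite funeposE.
  apply: (ge0_integral_translation v (F := fun x => maxe (F x) 0)%E).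
    exact: measurable_maxe.
  by move=> x; rewrite le_max lexx orbT.
- under eq_integral do rewrite funenegE; under [RHS]eq_integral do rewrite funenegE.
  apply: (ge0_integral_translation v (F := fun x => maxe (- F x) 0)%E).
    by apply: measurable_maxe => //; exact: measurableT_comp.
  by move=> x; rewrite le_max lexx orbT.
Qed.

End lebesgue_rV_theory.

Lemma Rdominated_cvg dT (T : measurableType dT) (R : realType)
    (mu : {measure set T -> \bar R}) (g : (T -> R)^nat) (f G : T -> R) :
  (forall n, measurable_fun [set: T] (g n)) -> measurable_fun [set: T] f ->
  mu.-integrable [set: T] (EFin \o G) -> (forall n x, `|g n x| <= G x) ->
  (forall x, g n x @[n --> \oo] --> f x) ->
  (\int[mu]_x g n x) @[n --> \oo] --> \int[mu]_x f x.
Proof.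
move=> mg mf iG gG gf.
have mg' n : measurable_fun [set: T] (EFin \o g n) by exact/measurable_EFinP.
have mf' : measurable_fun [set: T] (EFin \o f) by exact/measurable_EFinP.
have gf' : \forall x \ae mu, [set: T] x -> (EFin \o g n) x @[n --> \oo] --> (EFin \o f) x.
  by apply: nearW => x _; apply: cvg_EFin; [exact: nearW|exact: gf].
have gG' : \forall x \ae mu, forall n, [set: T] x -> (`|(EFin \o g n) x| <= (EFin \o G) x)%E.
  by apply: nearW => x n _; rewrite lee_fin.
have [fi _] := dominated_convergence measurableT mg' mf' gf' iG gG'.
by move=> h; apply: fine_cvg; rewrite fineK//; exact: integrable_fin_num fi.
Qed.

(** * Calculus along coordinate lines and integrals of derivatives *)

Section line_calculus.
Context {R : realType} {d : nat}.
Implicit Types (f g : 'rV[R]_d -> R^o) (x v : 'rV[R]_d).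

Lemma is_derive_line f x v (t : R) : differentiable f (x + t *: v) ->
  is_derive t (1 : R) (fun s : R => f (x + s *: v)) ('D_v f (x + t *: v)).
Proof.
move=> df; pose phi : R^o -> R^o := fun s => f (x + s *: v).
have E : (fun h : R => h^-1 *: ((phi \o shift t) (h *: (1 : R^o)) - phi t)) =
    (fun h : R => h^-1 *: ((f \o shift (x + t *: v)) (h *: v) - f (x + t *: v))).
  apply/funext => h; rewrite /phi /comp /shift.
  by rewrite -[h *: (1 : R^o)]/(h * 1) mulr1 scalerDl addrCA.
apply: (@DeriveDef R R^o R^o t 1 phi).
- by rewrite /derivable E; exact: diff_derivable.
- by rewrite /derive E.
Qed.

Lemma smooth_MVT f i x (h : R) : smooth f -> 0 <= h ->
  exists2 c, 0 <= c <= h &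
    f (x + h *: delta_mx ord0 i) - f x = h * pderiv i f (x + c *: delta_mx ord0 i).
Proof.
move=> sf h0; set v : 'rV[R]_d := delta_mx ord0 i.
have dphi t : is_derive t (1 : R) (fun s : R => f (x + s *: v)) (pderiv i f (x + t *: v)).
  exact/is_derive_line/smooth_differentiable.
have [c ch E] := @MVT_segment R (fun s => f (x + s *: v))
  (fun s => pderiv i f (x + s *: v)) 0 h h0 (fun s _ => dphi s)
  (derivable_within_continuous (fun s _ => @ex_derive _ _ _ _ _ _ _ (dphi s))).
exists c; first by move: ch; rewrite in_itv.
by move: E; rewrite scale0r addr0 subr0 mulrC.
Qed.

(** Two mean value steps: the difference quotient is a value of [pderiv i f] at a point within h on
    the line, and the second derivative bounds the change from x to that point. *)
Lemma smooth_taylor f i x (h M : R) : smooth f ->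
  (forall y, `|pderiv i (pderiv i f) y| <= M) -> 0 < h ->
  `|pderiv i f x - h^-1 * (f (x + h *: delta_mx ord0 i) - f x)| <= M * h.
Proof.
move=> sf fM h0; have [c /andP[c0 ch] ->] := smooth_MVT i x sf (ltW h0).
have [c' _] := smooth_MVT i x (smooth_pderiv i sf) c0.
rewrite mulrA mulVf ?gt_eqF// mul1r distrC => ->.
by rewrite normrM ger0_norm// mulrC ler_pM.
Qed.

Lemma test_function_bounded U f : test_function U f ->
  exists2 M, 0 <= M & forall x, `|f x| <= M.
Proof.
move=> /[dup] /test_function_smooth sf /test_function_supp[K [cK _ f0]].
have : compact (f @` K).
  apply: continuous_compact => //; apply: continuous_subspaceT.
  exact: smooth_continuous.
move=> /compact_bounded[M [_ /(_ (`|M| + 1))]].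
rewrite (le_lt_trans (ler_norm M)) ?ltrDl// => /(_ isT) fM.
exists (`|M| + 1) => [|x]; first by rewrite addr_ge0.
have [Kx|/f0 ->] := pselect (K x); first by apply: fM; exists x.
by rewrite normr0 addr_ge0.
Qed.

Lemma smooth_measurable f : smooth f -> measurable_fun [set: 'rV[R]_d] (f : _ -> R).
Proof. by move=> sf; apply: continuous_measurable_rV; exact: smooth_continuous. Qed.

Lemma lebesgue_rV_ball_lty (c : 'rV[R]_d) (r : R) : (lebesgue_rV d (ball c r) < +oo)%E.
Proof.
have [r0|r0] := ltP 0 r; first by rewrite lebesgue_rV_ball ?ltry.
rewrite (_ : ball c r = set0) ?measure0//; apply/seteqP; split=> // y [].
by rewrite ltNge r0.
Qed.

Lemma bounded_supp_integrable (F : 'rV[R]_d -> R) (M r : R) :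
  measurable_fun [set: 'rV[R]_d] F -> (forall x, `|F x| <= M) ->
  (forall x, ~ ball (0 : 'rV[R]_d) r x -> F x = 0) ->
  (lebesgue_rV d).-integrable [set: _] (EFin \o F).
Proof.
move=> mF FM F0; set B := ball (0 : 'rV[R]_d) r.
have mB : measurable B by apply: open_measurable_rV; exact: ball_open.
have iB : (lebesgue_rV d).-integrable [set: _] (EFin \o (fun x => M * \1_B x)).
  apply: (@integrableZl _ _ _ (lebesgue_rV d) _ _ M (EFin \o \1_B)) => //.
  apply/integrableP; split; first exact/measurable_EFinP/measurable_indic.
  under eq_integral do rewrite gee0_abs ?lee_fin//.
  by rewrite integral_indic// setIT; exact: lebesgue_rV_ball_lty.
apply: le_integrable iB => //; first exact/measurable_EFinP.
move=> x _ /=; rewrite lee_fin.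
have [Bx|/F0 ->] := pselect (B x); last by rewrite normr0.
by rewrite indicE mem_set// mulr1 (le_trans (FM x))// ler_norm.
Qed.

Lemma compact_sub_ball (K : set 'rV[R]_d) : compact K ->
  exists2 r : R, 0 < r & K `<=` ball 0 r.
Proof.
move=> /compact_bounded[M [_ /(_ (`|M| + 1))]].
rewrite (le_lt_trans (ler_norm M)) ?ltrDl// => /(_ isT) KM.
exists (`|M| + 2) => [|x Kx]; first by rewrite ltr_wpDl.
rewrite normed_ballE sub0r normrN (le_lt_trans (KM x Kx))// ltrD2l.
by rewrite ltr1n.
Qed.

(** The difference quotients have integral 0 by translation invariance, and dominated convergence
    passes this to the derivative. *)
Lemma integral_pderiv0 U f i : test_function U f ->
  \int[lebesgue_rV d]_x pderiv i f x = 0.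
Proof.
move=> tf; have sf := test_function_smooth tf.
have [K [cK KU f0]] := test_function_supp tf.
have [M M0 fM] := test_function_bounded (test_function_pderiv i tf).
have [M1 _ fM1] := test_function_bounded tf.
have [r r0 Kr] := compact_sub_ball cK.
set v : 'rV[R]_d := delta_mx ord0 i.
(* The ball of radius [s] holds the supports of all translates by [h n *: v], since h n <= 1. *)
pose s := r + `|v|; have rs : r <= s by rewrite lerDl.
have s0 : 0 < s by rewrite (lt_le_trans r0).
pose h (n : nat) : R := n.+1%:R^-1.
have h0 n : 0 < h n by rewrite invr_gt0.
have h1 n : h n <= 1 by rewrite invf_le1// ler1n.
pose g n x : R := (h n)^-1 * (f (x + h n *: v) - f x).
have mf : measurable_fun [set: 'rV[R]_d] (f : _ -> R) by exact: smooth_measurable.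
have mfv n : measurable_fun [set: 'rV[R]_d] (fun x => f (x + h n *: v) : R).
  by apply: measurableT_comp => //; exact: measurable_translation_rV.
have mg n : measurable_fun [set: 'rV[R]_d] (EFin \o g n).
  by apply/measurable_EFinP; apply: measurable_funM => //; exact: measurable_funB.
set B := ball (0 : 'rV[R]_d) s.
have mB : measurable B by apply: open_measurable_rV; exact: ball_open.
have f0' x : ~ ball (0 : 'rV[R]_d) r x -> f x = 0 by move=> nx; apply: f0 => /Kr.
have outside n x : ~ B x -> f (x + h n *: v) = 0 /\ f x = 0.
  move=> nBx; split; apply: f0'; last by move=> /(le_ball rs).
  apply: contra_not nBx; rewrite /B !normed_ballE !sub0r !normrN => xv.
  rewrite -[x](addrK (h n *: v)) (le_lt_trans (ler_normB _ _))// ltr_leD//.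
  by rewrite normrZ gtr0_norm// ler_piMl.
have iB : (lebesgue_rV d).-integrable [set: _] (EFin \o (fun x => M * \1_B x)).
  apply: (@bounded_supp_integrable _ M s).
  - by apply: measurable_funM => //; exact: measurable_indic.
  - move=> x; rewrite normrM ger0_norm// ler_piMr// indicE.
    by case: (_ \in _); rewrite ?normr1 ?normr0.
  - by move=> x nBx; rewrite indicE memNset// mulr0.
have gB n x : `|g n x| <= M * \1_B x.
  have [Bx|nBx] := pselect (B x); last first.
    have [E1 E2] := outside n x nBx.
    by rewrite /g E1 E2 subrr mulr0 normr0 mulr_ge0.
  rewrite indicE mem_set// mulr1 /g.
  have [c _ ->] := smooth_MVT i x sf (ltW (h0 n)).
  by rewrite mulrA mulVf ?mul1r// gt_eqF.

have [M2 M20 fM2] := test_function_bounded (test_function_pderiv i (test_function_pderiv i tf)).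
have cg x : g n x @[n --> \oo] --> pderiv i f x.
  apply/cvgrPdist_le => e e0; have e1 : 0 < e / (M2 + 1) by rewrite divr_gt0// ltr_pwDr.
  have [N _ NP] := near_infty_natSinv_lt (PosNum e1).
  exists N => // n /NP/= nN; rewrite /g.
  rewrite (le_trans (smooth_taylor x sf fM2 (h0 n)))//.
  rewrite (le_trans (ler_wpM2l M20 (ltW nN)))// mulrCA ler_piMr ?(ltW e0)//.
  by rewrite ler_pdivrMr ?mul1r ?lerDl// ltr_pwDr.
have ig (F : 'rV[R]_d -> R) : measurable_fun [set: 'rV[R]_d] F ->
    (forall x, `|F x| <= M1) -> (forall x, ~ B x -> F x = 0) ->
    (lebesgue_rV d).-integrable [set: _] (EFin \o F).
  by move=> mF FM1 FB; exact: (@bounded_supp_integrable F M1 s).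
have G0 n : \int[lebesgue_rV d]_x g n x = 0.
  have i1 : (lebesgue_rV d).-integrable [set: _] (EFin \o (fun x => f (x + h n *: v))).
    by apply: ig => // x /(outside n)[].
  have i2 : (lebesgue_rV d).-integrable [set: _] (EFin \o f).
    by apply: ig => // x /(outside n)[].
  rewrite RintegralZl//; last first.
    apply: (@bounded_supp_integrable _ (M1 + M1) s).
    - exact: measurable_funB.
    - by move=> x; rewrite (le_trans (ler_normB _ _))// lerD.
    - by move=> x /(outside n)[-> ->]; rewrite subrr.
  rewrite RintegralB// [X in X - _](_ : _ = \int[lebesgue_rV d]_x f x) ?subrr ?mulr0//.
  congr fine; apply: (integral_translation _ (F := fun x => (f x)%:E)).
  exact/measurable_EFinP.
have mg' n : measurable_fun [set: 'rV[R]_d] (g n) by exact/measurable_EFinP.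
have mpf : measurable_fun [set: 'rV[R]_d] (pderiv i f : _ -> R).
  by apply: smooth_measurable; exact: smooth_pderiv.
have := Rdominated_cvg mg' mpf iB gB cg.
under eq_fun do rewrite G0.
by move=> /(cvg_lim (@Rhausdorff R)) <-; rewrite lim_cst.
Qed.

End line_calculus.

(** * Weak derivatives *)

(** The sets over which [u] integrates to 0 form a Dynkin system. It contains the open sets, which
    are stable under intersection and generate the Borel sets. *)
Lemma integral_open_eq0 (R : realType) (n : nat)
    (mu : {measure set 'rV[R]_n -> \bar R}) (u : 'rV[R]_n -> R) :
  mu.-integrable [set: _] (EFin \o u) ->
  (forall U, open U -> (\int[mu]_(x in U) (u x)%:E = 0)%E) ->
  u = cst 0 %[ae mu].
Proof.
move=> iu u0; have mu' := measurable_int _ iu.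
pose H : set (set 'rV[R]_n) := [set A | measurable A /\ (\int[mu]_(x in A) (u x)%:E = 0)%E].
have dH : dynkin H.
  split=> [|A [mA A0]|F tF HF].
  - by split=> //; apply: u0; exact: openT.
  - split; first exact: measurableC.
    have : (\int[mu]_(x in A `|` ~` A) (u x)%:E = 0)%E.
      by rewrite setUCr; apply: u0; exact: openT.
    rewrite integral_setU ?A0 ?add0e//; first exact: measurableC.
    + exact: measurable_funTS.
    + by apply/disj_setPCl.
  - split; first by apply: bigcup_measurable => k _; have [] := HF k.
    rewrite integral_bigcup//.
    + by rewrite eseries0// => k _ _; have [] := HF k.
    + by move=> k; have [] := HF k.
    + apply: integrableS iu => //; apply: bigcup_measurable => k _.
      by have [] := HF k.
have all0 A : measurable A -> (\int[mu]_(x in A) (u x)%:E = 0)%E.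
  move=> mA; suff : H A by case.
  apply: (@lambda_system_subset _ [set U : set 'rV[R]_n | open U] _ setT H) => //.
  - by move=> U V oU oV; exact: openI.
  - exact/dynkin_lambda_system.
  - by move=> U oU; split; [exact: open_measurable_rV|exact: u0].
have : ae_eq mu setT (EFin \o u) (cst 0%E).
  apply: integral_ae_eq => // E _ mE; rewrite all0//.
  by rewrite integral0.
by apply: filterS => x /= h xT; have [] := h xT.
Qed.

(** * Density of test functions in L_2 of a bounded open set *)

Section domain_theory.
Context {R : realType} {d : nat}.
Variable Omega : set 'rV[R]_d.
Hypotheses (oOmega : open Omega) (bOmega : bounded_set Omega).
Local Notation vol := (volume oOmega).
Local Notation L2O := (LspaceType2 vol).
Local Notation od := (on_domain oOmega).
Implicit Types (f g : 'rV[R]_d -> R^o) (u v w : L2O).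

Lemma bounded_sub_ball : exists2 r : R, 0 < r & Omega `<=` ball 0 r.
Proof.
move: bOmega => [M [_ /(_ (`|M| + 1))]].
rewrite (le_lt_trans (ler_norm M)) ?ltrDl// => /(_ isT) KM.
exists (`|M| + 2) => [|x Kx]; first by rewrite ltr_wpDl.
rewrite normed_ballE sub0r normrN (le_lt_trans (KM x Kx))// ltrD2l.
by rewrite ltr1n.
Qed.

Lemma volumeE (A : set 'rV[R]_d) : vol A = lebesgue_rV d (A `&` Omega).
Proof. by []. Qed.

Lemma volume_finite : (vol setT < +oo)%E.
Proof.
have [r r0 Or] := bounded_sub_ball.
rewrite volumeE setTI; apply: le_lt_trans (lebesgue_rV_ball_lty (0 : 'rV[R]_d) r).
apply: le_measure => //; rewrite inE; apply: open_measurable_rV => //.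
exact: ball_open.
Qed.

Lemma volume_ae_Omega : \forall x \ae vol, Omega x.
Proof.
have mO := open_measurable_rV oOmega.
exists (~` Omega); split; first exact: measurableC.
  by rewrite volumeE setICl measure0.
by move=> x.
Qed.

Lemma volume_Rintegral (F : 'rV[R]_d -> R) : measurable_fun [set: _] F ->
  (forall x, ~ Omega x -> F x = 0) ->
  \int[vol]_x F x = \int[lebesgue_rV d]_x F x.
Proof.
move=> mF F0; congr fine; apply: integral_mrestrE; first exact/measurable_EFinP.
by move=> x /F0 ->.
Qed.

Lemma bounded_integrable (F : 'rV[R]_d -> R) (M : R) :
  measurable_fun [set: _] F -> (forall x, `|F x| <= M) ->
  vol.-integrable [set: _] (EFin \o F).
Proof. by move=> mF FM; exact: (finite_bounded_integrable volume_finite mF FM). Qed.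

Lemma bounded_Lfun2 (F : 'rV[R]_d -> R) (M : R) :
  measurable_fun [set: _] F -> (forall x, `|F x| <= M) -> F \in Lfun vol 2%:E.
Proof. by move=> mF FM; exact: (finite_bounded_Lfun2 volume_finite mF FM). Qed.

Lemma test_Lfun2 f : test_function Omega f -> (f : _ -> R) \in Lfun vol 2%:E.
Proof.
move=> tf; have [M _ fM] := test_function_bounded tf.
by apply: bounded_Lfun2 fM; apply: smooth_measurable; exact: test_function_smooth tf.
Qed.

Lemma L2dot_on_domain u (F : 'rV[R]_d -> R) : F \in Lfun vol 2%:E ->
  L2dot u (od F) = \int[vol]_x (u x * F x).
Proof.
move=> FL; apply: L2dot_ae.
- exact: nearW.
- exact: L2class_ae.
- exact: Lspace2_measurable.
- by have /Lfun2P[] := FL.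
Qed.

Lemma test_on_domainD f g : test_function Omega f -> test_function Omega g ->
  od (f + g) = od f + od g.
Proof. by move=> /test_Lfun2 fL /test_Lfun2 gL; exact: L2classD. Qed.

Lemma test_on_domainZ (k : R) f : test_function Omega f ->
  od (cst k * f) = k *: od f.
Proof. by move=> /test_Lfun2 fL; exact: L2classZ. Qed.

(** Test functions tend boundedly to the indicator of [U] intersected with [Omega], so [u]
    integrates to 0 over every open set. *)
Lemma test_dot_eq0 u : (forall f, test_function Omega f -> L2dot u (od f) = 0) -> u = 0.
Proof.
move=> uf.
have u1 : vol.-integrable [set: _] (EFin \o u).
  apply/Lfun1_integrable; apply: Lfun_subset12 (Lspace2_Lfun u).
  by rewrite ge0_fin_numE//; exact: volume_finite.
apply/Lspace_eqP.
have : u = cst 0 %[ae vol].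
  apply: integral_open_eq0 => // U oU.
  have [f [tf f01 fU]] := open_indicator_tests (openI oU oOmega).
  have tfO k : test_function Omega (f k) by apply: test_function_subset (tf k).
  have : \int[vol]_x (u x * f k x) @[k --> \oo] -->
      \int[vol]_x (u x * \1_(U `&` Omega) x).
    have mu' := Lspace2_measurable u.
    have mUO : measurable (U `&` Omega) by apply: open_measurable_rV; exact: openI.
    apply: (@Rdominated_cvg _ _ _ _ _ _ (fun x => `|u x|)).
    - move=> k; apply: measurable_funM => //.
      by apply: smooth_measurable; exact: test_function_smooth (tf k).
    - by apply: measurable_funM => //; exact: measurable_indic.
    - exact: integrable_norm u1.
    - move=> k x; rewrite normrM ler_piMr//.
      by have /andP[f0 f1] := f01 k x; rewrite ger0_norm.
    - by move=> x; apply: cvgM; [exact: cvg_cst|exact: fU].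
  under eq_fun => k do rewrite -(L2dot_on_domain u (test_Lfun2 (tfO k))) uf//.
  move=> /(cvg_lim (@Rhausdorff R)); rewrite lim_cst// => I0.
  have -> : (\int[vol]_(x in U) (u x)%:E = \int[vol]_x (u x * \1_(U `&` Omega) x)%:E)%E.
    rewrite integral_mkcond; apply: ae_eq_integral => //.
    + apply/(measurable_restrictT _ _).1; first exact: open_measurable_rV.
      by apply: measurable_funTS; apply/measurable_EFinP; exact: Lspace2_measurable.
    + apply/measurable_EFinP; apply: measurable_funM; first exact: Lspace2_measurable.
      by apply: measurable_indic; apply: open_measurable_rV; exact: openI.
    + move: volume_ae_Omega; apply: filterS => x Ox _.
      rewrite patchE indicE in_setI [x \in Omega]mem_set// andbT.
      by case: (x \in U); rewrite ?mulr1 ?mulr0.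
  rewrite [LHS](_ : _ = (\int[vol]_x (u x * \1_(U `&` Omega) x))%:E); first by rewrite -I0.
  rewrite fineK//; apply: integrable_fin_num => //.
  apply: (le_integrable _ _ _ u1) => //.
    apply/measurable_EFinP; apply: measurable_funM; first exact: Lspace2_measurable.
    by apply: measurable_indic; apply: open_measurable_rV; exact: openI.
  move=> x _ /=; rewrite lee_fin normrM ler_piMr// indicE.
  by case: (_ \in _); rewrite ?normr1 ?normr0.
move=> u0; have : (0 : L2O) = cst 0 %[ae vol].
  have := @Lspace_scaleE _ _ _ vol _ (lee1n 2) 0 (0 : L2O); rewrite scale0r.
  by apply: filterS => x h xT; rewrite h//= scale0r.
by move: u0; apply: filterS2 => x h1 h2 xT; rewrite h1// h2.
Qed.

(** The projection of [w] on the closure of the test functions, obtained as the limit of a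
    minimizing sequence, differs from [w] by an element orthogonal to all test functions, that is,
    by 0. *)
Lemma test_dense w (e : R) : 0 < e ->
  exists2 f, test_function Omega f & `|od f - w| < e.
Proof.
move=> e0; pose D : set L2O := [set od f | f in test_function Omega].
have od0 : od (cst 0) = 0.
  have := test_on_domainZ 0 (test_function0 Omega).
  by rewrite scale0r => <-; congr od; apply/funext => x; rewrite !fctE mul0r.
have [|_ _ [f tf <-] [g tg <-]|k _ [f tf <-]|||||||u Du|v [vD cv vw]] :=
  @quadratic_minimizing_sequence R L2O D (fun u v => L2dot u v) (fun v => L2dot w v)
  (`|w| ^+ 2).
- by exists (cst 0) => //; exact: test_function0.
- by exists (f + g); [exact: test_functionD|exact: test_on_domainD].
- by exists (cst k * f); [exact: test_functionZ|exact: test_on_domainZ].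
- by move=> *; exact: L2dotC.
- by move=> *; exact: L2dotDl.
- by move=> *; exact: L2dotZl.
- by move=> *; exact: L2dot_ge0.
- by move=> *; exact: L2dotDr.
- by move=> *; exact: L2dotZr.
- rewrite L2dot_norm -exprMn -[leLHS]real_normK ?num_real//.
  by rewrite lerXn2r ?nnegrE ?mulr_ge0// L2dot_CauchySchwarz.
have cauv : cauchyn v.
  move=> e' e'0; have [N NP] := cv (e' ^+ 2) (exprn_gt0 _ e'0).
  exists N => m n Nm Nn; rewrite -ltr_sqr ?nnegrE//; last exact: ltW.
  by rewrite -L2dot_norm NP.
have [l vl] := L2_complete cauv.
have lw : l - w = 0.
  apply: test_dot_eq0 => f tf; rewrite L2dotBl.
  have Df : D (od f) by exists f.
  have h : L2dot (v n) (od f) @[n --> \oo] --> L2dot l (od f).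
    apply/cvgrPdist_lt => e' e'0.
    have e1 : 0 < e' / (`|od f| + 1) by rewrite divr_gt0// ltr_pwDr.
    have [N _ NP] := cvgr_dist_lt _ _ vl _ e1.
    exists N => // n /NP/= nN; rewrite -L2dotBl.
    rewrite (le_lt_trans (L2dot_CauchySchwarz _ _))//.
    rewrite (@le_lt_trans _ _ (`|l - v n| * (`|od f| + 1)))//.
      by rewrite ler_wpM2l// lerDl.
    by rewrite -ltr_pdivlMr// ltr_pwDr.
  by rewrite -(cvg_lim (@Rhausdorff R) h) (cvg_lim (@Rhausdorff R) (vw _ Df)) subrr.
have {}lw : l = w by apply/eqP; rewrite -subr_eq0 lw.
have [N _ NP] := cvgr_distC_lt _ _ vl _ e0.
have [f tf fE] := vD N; exists f => //; rewrite fE -lw.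
exact: (NP N (leqnn N)).
Qed.

End domain_theory.

Lemma psd_CauchySchwarz (R : realFieldType) (E : lmodType R) (D : set E)
    (a : E -> E -> R) :
  (forall u v, D u -> D v -> D (u + v)) -> (forall k u, D u -> D (k *: u)) ->
  (forall u v, D u -> D v -> a u v = a v u) ->
  (forall u v w, D u -> D v -> D w -> a (u + v) w = a u w + a v w) ->
  (forall k u w, D u -> D w -> a (k *: u) w = k * a u w) ->
  (forall u, D u -> 0 <= a u u) ->
  forall u v, D u -> D v -> a u v ^+ 2 <= a u u * a v v.
Proof.
move=> DD DZ aC aDl aZl a0 u v Du Dv.
have quad k : 0 <= a u u + 2 * k * a u v + k ^+ 2 * a v v.
  have DZv := DZ k _ Dv; have := a0 _ (DD _ _ Du DZv).
  rewrite aDl//; last exact: DD.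
  rewrite (aC u)//; last exact: DD.
  rewrite (aC (k *: v))//; last exact: DD.
  rewrite !aDl// !aZl// (aC v (k *: v))// aZl// (aC v u)//.
  by rewrite (aC u (k *: v))// aZl// (aC v u)//; lra.
have := a0 _ Dv; rewrite le_eqVlt => /predU1P[v0|v0].
  rewrite -v0 mulr0; have [->|uv0] := eqVneq (a u v) 0; first by rewrite expr0n.
  (* When a(v, v) = 0 the quadratic is affine in k, and this k gives it the value -1. *)
  have := quad (- (a u u + 1) / (2 * a u v)); rewrite -v0 mulr0 addr0.
  rewrite (_ : 2 * _ * _ = - (a u u + 1)); last by field.
  lra.
have := quad (- a u v / a v v).
rewrite (_ : _ + _ = (a u u * a v v - a u v ^+ 2) / a v v).
  by rewrite pmulr_lge0 ?invr_gt0// subr_ge0.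
by field; rewrite gt_eqF.
Qed.

Section weak_derivatives.
Context {R : realType} {d : nat}.
Variable Omega : set 'rV[R]_d.
Hypotheses (oOmega : open Omega) (bOmega : bounded_set Omega).
Local Notation vol := (volume oOmega).
Local Notation L2O := (LspaceType2 vol).
Local Notation od := (on_domain oOmega).
Implicit Types (f : 'rV[R]_d -> R^o) (u v w g : L2O) (i : 'I_d).

Local Opaque Lspace_class Lspace_repr L2class.

Lemma is_weak_derivP i u g : is_weak_deriv i u g <->
  forall f, test_function Omega f -> L2dot u (od (pderiv i f)) = - L2dot g (od f).
Proof.
split=> ug f tf; have tpf := test_function_pderiv i tf.
  by rewrite !L2dot_on_domain ?ug//; exact: test_Lfun2.
by have := ug f tf; rewrite !L2dot_on_domain//; exact: test_Lfun2.
Qed.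

Lemma is_weak_deriv_unique i u g (g' : L2O) :
  is_weak_deriv i u g -> is_weak_deriv i u g' -> g = g'.
Proof.
move=> /is_weak_derivP ug /is_weak_derivP ug'; apply/eqP; rewrite -subr_eq0.
apply/eqP/(test_dot_eq0 bOmega) => f tf; rewrite L2dotBl.
by apply/eqP; rewrite subr_eq0 -eqr_opp -ug// -ug'.
Qed.

Lemma weak_derivE i u g : is_weak_deriv i u g -> weak_deriv i u = g.
Proof.
move=> ug; apply: (@is_weak_deriv_unique i u) => //.
exact: (@xgetI _ 0 [set g | is_weak_deriv i u g] g).
Qed.

Local Opaque weak_deriv.

Lemma weak_derivP i u : H1 oOmega u -> is_weak_deriv i u (weak_deriv i u).
Proof. by move=> /(_ i)[g ug]; rewrite (weak_derivE ug). Qed.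

Lemma is_weak_derivD i u v g (h : L2O) : is_weak_deriv i u g -> is_weak_deriv i v h ->
  is_weak_deriv i (u + v) (g + h).
Proof.
move=> /is_weak_derivP ug /is_weak_derivP vh; apply/is_weak_derivP => f tf.
by rewrite !L2dotDl ug// vh// opprD.
Qed.

Lemma is_weak_derivZ i (k : R) u g : is_weak_deriv i u g ->
  is_weak_deriv i (k *: u) (k *: g).
Proof.
move=> /is_weak_derivP ug; apply/is_weak_derivP => f tf.
by rewrite !L2dotZl ug// mulrN.
Qed.

Lemma H1D u v : H1 oOmega u -> H1 oOmega v -> H1 oOmega (u + v).
Proof.
move=> Hu Hv i; exists (weak_deriv i u + weak_deriv i v).
by apply: is_weak_derivD; exact: weak_derivP.
Qed.

Lemma H1Z (k : R) u : H1 oOmega u -> H1 oOmega (k *: u).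
Proof.
by move=> Hu i; exists (k *: weak_deriv i u); apply: is_weak_derivZ; exact: weak_derivP.
Qed.

Lemma H1N u : H1 oOmega u -> H1 oOmega (- u).
Proof. by rewrite -scaleN1r; exact: H1Z. Qed.

Lemma H1B u v : H1 oOmega u -> H1 oOmega v -> H1 oOmega (u - v).
Proof. by move=> Hu /H1N; exact: H1D. Qed.

Lemma H1_0 : H1 oOmega 0.
Proof.
move=> i; exists 0; apply/is_weak_derivP => f tf.
by rewrite !L2dot0l oppr0.
Qed.

Lemma weak_derivD i u v : H1 oOmega u -> H1 oOmega v ->
  weak_deriv i (u + v) = weak_deriv i u + weak_deriv i v.
Proof. by move=> Hu Hv; apply/weak_derivE/is_weak_derivD; exact: weak_derivP. Qed.

Lemma weak_derivZ i (k : R) u : H1 oOmega u ->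
  weak_deriv i (k *: u) = k *: weak_deriv i u.
Proof. by move=> Hu; apply/weak_derivE/is_weak_derivZ; exact: weak_derivP. Qed.

Lemma weak_derivB i u v : H1 oOmega u -> H1 oOmega v ->
  weak_deriv i (u - v) = weak_deriv i u - weak_deriv i v.
Proof.
move=> Hu Hv; have -> : u - v = u + (-1) *: v by rewrite scaleN1r.
rewrite weak_derivD; [|exact: Hu|exact: H1Z].
by rewrite weak_derivZ; [rewrite scaleN1r|exact: Hv].
Qed.

Lemma dirichletE u v : dirichlet u v = \sum_i L2dot (weak_deriv i u) (weak_deriv i v).
Proof.
rewrite /dirichlet.
elim: (index_enum _) => [|i s ih].
  under eq_Rintegral do rewrite big_nil; rewrite big_nil.
  by rewrite Rintegral_cst// mul0r.
under eq_Rintegral do rewrite big_cons; rewrite big_cons -ih.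
rewrite RintegralD//; first exact: L2dot_integrable.
elim: s {ih} => [|j s ih].
  rewrite (_ : _ \o _ = cst 0%E); first exact: integrable0.
  by apply/funext => x /=; rewrite big_nil.
rewrite (_ : _ \o _ = ((EFin \o (fun x => weak_deriv j u x * weak_deriv j v x)%R) \+
  (EFin \o (fun x => \sum_(j <- s) weak_deriv j u x * weak_deriv j v x)%R))%E).
  by apply: integrableD => //; exact: L2dot_integrable.
by apply/funext => x /=; rewrite big_cons.
Qed.

Local Opaque dirichlet L2dot.

Lemma dirichletC u v : dirichlet u v = dirichlet v u.
Proof. by rewrite !dirichletE; apply: eq_bigr => i _; rewrite L2dotC. Qed.

Lemma dirichletDl u v w : H1 oOmega u -> H1 oOmega v ->
  dirichlet (u + v) w = dirichlet u w + dirichlet v w.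
Proof.
move=> Hu Hv; rewrite !dirichletE -big_split/=; apply: eq_bigr => i _.
by rewrite weak_derivD// L2dotDl.
Qed.

Lemma dirichletZl (k : R) u w : H1 oOmega u ->
  dirichlet (k *: u) w = k * dirichlet u w.
Proof.
move=> Hu; rewrite !dirichletE mulr_sumr; apply: eq_bigr => i _.
by rewrite weak_derivZ// L2dotZl.
Qed.

Lemma dirichletBl u v w : H1 oOmega u -> H1 oOmega v ->
  dirichlet (u - v) w = dirichlet u w - dirichlet v w.
Proof.
by move=> Hu Hv; rewrite -scaleN1r dirichletDl ?dirichletZl ?mulN1r//; exact: H1Z.
Qed.

Lemma dirichlet_ge0 u : 0 <= dirichlet u u.
Proof. by rewrite dirichletE sumr_ge0// => i _; exact: L2dot_ge0. Qed.

Lemma dirichlet_CauchySchwarz u v : H1 oOmega u -> H1 oOmega v ->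
  dirichlet u v ^+ 2 <= dirichlet u u * dirichlet v v.
Proof.
apply: (@psd_CauchySchwarz R L2O (H1 oOmega) (@dirichlet _ _ _ oOmega)).
- by move=> *; exact: H1D.
- by move=> *; exact: H1Z.
- by move=> *; exact: dirichletC.
- by move=> *; exact: dirichletDl.
- by move=> *; exact: dirichletZl.
- by move=> *; exact: dirichlet_ge0.
Qed.

Lemma H1norm_sqr u : H1norm oOmega u ^+ 2 = `|u| ^+ 2 + dirichlet u u.
Proof.
rewrite /H1norm sqr_sqrtr ?L2dot_norm//.
by rewrite addr_ge0 ?dirichlet_ge0// L2dot_ge0.
Qed.

Lemma H1norm_ge0 u : 0 <= H1norm oOmega u.
Proof. exact: sqrtr_ge0. Qed.

Local Opaque H1norm.

Lemma norm_le_H1norm u : `|u| <= H1norm oOmega u.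
Proof.
rewrite -ler_sqr ?nnegrE ?H1norm_ge0// H1norm_sqr lerDl.
exact: dirichlet_ge0.
Qed.

Lemma weak_deriv_le_dirichlet i u : `|weak_deriv i u| ^+ 2 <= dirichlet u u.
Proof.
have le_sum (F : 'I_d -> R) : (forall j, 0 <= F j) -> F i <= \sum_j F j.
  by move=> F0; rewrite (bigD1 i)//= lerDl sumr_ge0.
rewrite dirichletE -L2dot_norm.
by apply: (le_sum (fun j => L2dot (weak_deriv j u) (weak_deriv j u))) => j; exact: L2dot_ge0.
Qed.

Lemma weak_deriv_le_H1norm i u : `|weak_deriv i u| <= H1norm oOmega u.
Proof.
rewrite -ler_sqr ?nnegrE ?H1norm_ge0// H1norm_sqr.
by rewrite (le_trans (weak_deriv_le_dirichlet i u))// lerDr.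
Qed.

Lemma dirichlet_le_H1norm u : dirichlet u u <= H1norm oOmega u ^+ 2.
Proof. by rewrite H1norm_sqr lerDr. Qed.

Lemma H1normZ (k : R) u : H1 oOmega u -> H1norm oOmega (k *: u) = `|k| * H1norm oOmega u.
Proof.
move=> Hu; apply/eqP; rewrite -(@eqrXn2 _ 2) ?mulr_ge0 ?H1norm_ge0//; apply/eqP.
rewrite [RHS]exprMn [in RHS](H1norm_sqr u) (H1norm_sqr (k *: u)) normrZ.
rewrite dirichletZl; last exact: Hu.
rewrite dirichletC dirichletZl; last exact: Hu.
move: (dirichlet u u) (`|u|) => p q.
by rewrite exprMn real_normK ?num_real//; ring.
Qed.

Lemma H1normD u v : H1 oOmega u -> H1 oOmega v ->
  H1norm oOmega (u + v) <= H1norm oOmega u + H1norm oOmega v.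
Proof.
move=> Hu Hv; pose a u v := L2dot u v + dirichlet u v.
have aE w : H1norm oOmega w ^+ 2 = a w w by rewrite H1norm_sqr /a L2dot_norm.
have a0 w : H1 oOmega w -> 0 <= a w w by move=> _; rewrite -aE sqr_ge0.
have CS : a u v ^+ 2 <= a u u * a v v.
  apply: (@psd_CauchySchwarz R L2O (H1 oOmega) a _ _ _ _ _ a0 u v Hu Hv).
  - by move=> ? ? ? ?; exact: H1D.
  - by move=> ? ? ?; exact: H1Z.
  - by move=> p q _ _; rewrite /a L2dotC dirichletC.
  - move=> p q w Hp Hq _; rewrite /a L2dotDl dirichletDl; [|exact: Hp|exact: Hq].
    by rewrite addrACA.
  - move=> k p w Hp _; rewrite /a L2dotZl dirichletZl; last exact: Hp.
    by rewrite mulrDr.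
have aD : a (u + v) (u + v) = a u u + 2 * a u v + a v v.
  have HD := H1D Hu Hv.
  rewrite /a !(L2dotDl, L2dotDr) dirichletDl; [|exact: Hu|exact: Hv].
  rewrite (dirichletC u (u + v)) dirichletDl; [|exact: Hu|exact: Hv].
  rewrite (dirichletC v (u + v)) dirichletDl; [|exact: Hu|exact: Hv].
  rewrite (L2dotC v u) (dirichletC v u).
  move: (L2dot u u) (L2dot u v) (L2dot v v) (dirichlet u u) (dirichlet u v) (dirichlet v v).
  by move=> *; ring.
move: (aE u) (aE v) (aE (u + v)) (H1norm_ge0 u) (H1norm_ge0 v) (H1norm_ge0 (u + v)).
move: (H1norm oOmega u) (H1norm oOmega v) (H1norm oOmega (u + v)) aD CS.
move: (a u u) (a v v) (a u v) (a (u + v) (u + v)) => p q b s x y z -> CS xp yq zE x0 y0 z0.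
rewrite -ler_sqr ?nnegrE ?addr_ge0// zE sqrrD xp yq.
rewrite lerD2r lerD2l -[leRHS]mulr_natl ler_wpM2l//.
apply: (le_trans (ler_norm _)); rewrite -ler_sqr ?nnegrE ?mulr_ge0//.
by rewrite real_normK ?num_real// exprMn xp yq.
Qed.

Lemma H1norm_lim0 (v : L2O^nat) u : (forall n, H1 oOmega (v n)) -> H1 oOmega u ->
  v @ \oo --> u -> (forall i, weak_deriv i (v n) @[n --> \oo] --> weak_deriv i u) ->
  H1norm oOmega (v n - u) @[n --> \oo] --> (0 : R).
Proof.
move=> Hv Hu vu dvu.
have norm_cvg (w : L2O^nat) l : w @ \oo --> l -> `|w n - l| ^+ 2 @[n --> \oo] --> (0 : R).
  move=> wl; rewrite -[X in _ --> X](expr0n R 2) expr2.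
  under eq_fun do rewrite expr2.
  have : `|w n - l| @[n --> \oo] --> (0 : R).
    apply/cvgrPdist_lt => e e0; have [N _ NP] := cvgr_distC_lt _ _ wl _ e0.
    by exists N => // n /NP /=; rewrite sub0r normrN normr_id.
  by move=> h; apply: cvgM.
have : (`|v n - u| ^+ 2 + \sum_i `|weak_deriv i (v n) - weak_deriv i u| ^+ 2)
    @[n --> \oo] --> (0 + \sum_(i < d) 0 : R).
  apply: cvgD; first exact: norm_cvg.
  by apply: cvg_big => [|i _]; [exact: add_continuous|exact: norm_cvg].
rewrite add0r big1// => h.
have {h} h := continuous_cvg _ (@sqrt_continuous R 0) h.
rewrite sqrtr0 in h.
rewrite (_ : (fun n => _) = (fun n => Num.sqrt (`|v n - u| ^+ 2 +
    \sum_i `|weak_deriv i (v n) - weak_deriv i u| ^+ 2))); first exact: h.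
apply/funext => n.
rewrite -[LHS]ger0_norm ?H1norm_ge0// -sqrtr_sqr H1norm_sqr dirichletE.
congr (Num.sqrt (_ + _)); apply: eq_bigr => i _.
by rewrite weak_derivB; [rewrite L2dot_norm|exact: Hv|exact: Hu].
Qed.

Lemma L2dot_cvgl (w : L2O^nat) (l v : L2O) : w @ \oo --> l ->
  L2dot (w n) v @[n --> \oo] --> L2dot l v.
Proof.
move=> wl; apply/cvgrPdist_lt => e e0.
have e1 : 0 < e / (`|v| + 1) by rewrite divr_gt0// ltr_pwDr.
have [N _ NP] := cvgr_dist_lt _ _ wl _ e1.
exists N => // n /NP/= nN; rewrite -L2dotBl.
rewrite (le_lt_trans (L2dot_CauchySchwarz _ _))//.
rewrite (@le_lt_trans _ _ (`|l - w n| * (`|v| + 1)))//.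
  by rewrite ler_wpM2l// lerDl.
by rewrite -ltr_pdivlMr// ltr_pwDr.
Qed.

(** For a fixed test function both sides of the identity defining a weak derivative are continuous
    in L_2, so the limits of the derivatives are the derivatives of the limit. *)
Lemma H1_complete (v : L2O^nat) : (forall n, H1 oOmega (v n)) ->
  (forall e : R, 0 < e -> exists N, forall m n, (N <= m)%N -> (N <= n)%N ->
    H1norm oOmega (v m - v n) < e) ->
  exists2 u, H1 oOmega u & H1norm oOmega (v n - u) @[n --> \oo] --> (0 : R).
Proof.
move=> Hv cv.
have [u vu] : exists u, v @ \oo --> u.
  apply: L2_complete => e /cv[N NP]; exists N => m n Nm Nn.
  exact: le_lt_trans (norm_le_H1norm _) (NP _ _ Nm Nn).
have /choice[g vg] : forall i, exists g, weak_deriv i (v n) @[n --> \oo] --> g.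
  move=> i; apply: L2_complete => e /cv[N NP]; exists N => m n Nm Nn.
  by rewrite -weak_derivB// (le_lt_trans (weak_deriv_le_H1norm i _))// NP.
have ug i : is_weak_deriv i u (g i).
  apply/is_weak_derivP => f tf.
  have h1 := L2dot_cvgl (v := od (pderiv i f)) vu.
  have h2 : (- L2dot (weak_deriv i (v n)) (od f)) @[n --> \oo] --> - L2dot (g i) (od f).
    by apply: cvgN; exact: L2dot_cvgl.
  rewrite -(cvg_lim (@Rhausdorff R) h1) -(cvg_lim (@Rhausdorff R) h2).
  rewrite (_ : (fun n => L2dot (v n) (od (pderiv i f))) =
    (fun n => - L2dot (weak_deriv i (v n)) (od f))); first by [].
  apply/funext => n.
  by have /is_weak_derivP -> := weak_derivP i (Hv n).
have Hu : H1 oOmega u by move=> i; exists (g i).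
exists u => //; apply: H1norm_lim0 => // i.
by rewrite (weak_derivE (ug i)).
Qed.

(** The product [f * h] is again a test function, and the integral of its derivative is 0. *)
Lemma test_is_weak_deriv i f : test_function Omega f ->
  is_weak_deriv i (od f) (od (pderiv i f)).
Proof.
move=> tf; apply/is_weak_derivP => h th.
have sf := test_function_smooth tf; have sh := test_function_smooth th.
have tpf := test_function_pderiv i tf; have tph := test_function_pderiv i th.
have mS (k : 'rV[R]_d -> R^o) : test_function Omega k -> measurable_fun [set: _] (k : _ -> R).
  by move=> tk; apply: smooth_measurable; exact: test_function_smooth tk.
rewrite (L2dot_ae (L2class_ae (test_Lfun2 oOmega bOmega tf)) (L2class_ae (test_Lfun2 oOmega bOmega tph)) (mS _ tf) (mS _ tph)).
rewrite (L2dot_ae (L2class_ae (test_Lfun2 oOmega bOmega tpf)) (L2class_ae (test_Lfun2 oOmega bOmega th)) (mS _ tpf) (mS _ th)).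
apply/eqP; rewrite -addr_eq0; apply/eqP.
rewrite -RintegralD//; last 2 first.
- exact: Lfun2_mul_integrable (test_Lfun2 oOmega bOmega tf) (test_Lfun2 oOmega bOmega tph).
- exact: Lfun2_mul_integrable (test_Lfun2 oOmega bOmega tpf) (test_Lfun2 oOmega bOmega th).
have tfh : test_function Omega (f * h) by exact: test_functionMl.
rewrite -(integral_pderiv0 i tfh) -[RHS](volume_Rintegral oOmega).
- by apply: eq_Rintegral => x _; rewrite pderivM// fctE [X in _ + X]mulrC.
- by apply: mS; exact: test_function_pderiv.
- have [K [_ KO f0]] := test_function_supp (test_function_pderiv i tfh).
  by move=> x nOx; apply: f0 => /KO.
Qed.

Lemma test_H1 f : test_function Omega f -> H1 oOmega (od f).
Proof. by move=> tf i; exists (od (pderiv i f)); exact: test_is_weak_deriv. Qed.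

Lemma weak_deriv_test i f : test_function Omega f ->
  weak_deriv i (od f) = od (pderiv i f).
Proof. by move=> tf; apply/weak_derivE/test_is_weak_deriv. Qed.

(* [U] is arbitrary: compact support only serves to bound [h] and its derivatives. *)
Lemma is_weak_deriv_mul (U : set 'rV[R]_d) i (h : 'rV[R]_d -> R^o) u g :
  test_function U h -> is_weak_deriv i u g ->
  is_weak_deriv i (od (fun x => h x * u x))
    (od (fun x => h x * g x) + od (fun x => pderiv i h x * u x)).
Proof.
move=> th ug; have sh := test_function_smooth th.
have [M _ hM] := test_function_bounded th.
have [M' _ hM'] := test_function_bounded (test_function_pderiv i th).
have mh := smooth_measurable sh.
have mh' := smooth_measurable (smooth_pderiv i sh).
have L1 := Lfun2_bdM mh hM (Lspace2_Lfun u).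
have L2 := Lfun2_bdM mh hM (Lspace2_Lfun g).
have L3 := Lfun2_bdM mh' hM' (Lspace2_Lfun u).
apply/is_weak_derivP => f tf; have sf := test_function_smooth tf.
have tpf := test_function_pderiv i tf.
have tfL := test_Lfun2 oOmega bOmega tf; have tpfL := test_Lfun2 oOmega bOmega tpf.
rewrite L2dotDl !L2dot_on_domain//.
have E (F : 'rV[R]_d -> R) k : F \in Lfun vol 2%:E -> measurable_fun [set: _] k ->
    \int[vol]_x (od F x * k x) = \int[vol]_x (F x * k x).
  move=> FL mk; have /Lfun2P[mF _] := FL.
  apply: eq_Rintegral_ae.
  - by apply: measurable_funM => //; exact: Lspace2_measurable.
  - exact: measurable_funM.
  - by move: (L2class_ae FL); apply: filterS => x Fx xT; rewrite /on_domain Fx.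
have mf := smooth_measurable sf.
have mpf := smooth_measurable (smooth_pderiv i sf).
rewrite !E//.
have := ug _ (test_functionMl sh tf); rewrite pderivM//.
under eq_Rintegral do rewrite fctE mulrDr.
rewrite RintegralD//; last 2 first.
- have -> : (fun x => u x * (h x * pderiv i f x)) =
    (fun x => (h x * u x) * pderiv i f x) by apply/funext => x; ring.
  exact: Lfun2_mul_integrable.
- have -> : (fun x => u x * (f x * pderiv i h x)) =
    (fun x => (pderiv i h x * u x) * f x) by apply/funext => x; ring.
  exact: Lfun2_mul_integrable.
move=> H; rewrite opprD.
have -> : \int[vol]_x (h x * g x * f x) = \int[vol]_x (g x * (h * f) x).
  by apply: eq_Rintegral => x _; rewrite fctE; ring.

rewrite -H.
have -> : \int[vol]_x (u x * (f * pderiv i h) x) = \int[vol]_x (pderiv i h x * u x * f x).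
  by apply: eq_Rintegral => x _; rewrite fctE; ring.
have -> : \int[vol]_x (u x * (h x * pderiv i f x)) = \int[vol]_x (h x * u x * pderiv i f x).
  by apply: eq_Rintegral => x _; ring.
by rewrite addrK.
Qed.

End weak_derivatives.

(** * Difference quotients *)

Section translates.
Context {R : realType} {d : nat}.
Implicit Types (f : 'rV[R]_d -> R^o) (v x : 'rV[R]_d) (i : 'I_d).

Lemma pderiv_translate i f v :
  pderiv i (fun x => f (x + v)) = (fun x => pderiv i f (x + v)).
Proof.
apply/funext => x; rewrite /pderiv /derive.
by under eq_fun do rewrite /= -addrA.
Qed.

Lemma smooth_translate f v : smooth f -> smooth (fun x => f (x + v)).
Proof.
move=> sf; apply: (@smooth_coind R d [set h | exists2 g, smooth g & h = fun x => g (x + v)]).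
  move=> _ [g sg ->]; split=> [x|i].
    apply: (@differentiable_comp _ _ _ _ (fun x => x + v) g).
      by apply: differentiableD.
    exact: smooth_differentiable.
  by exists (pderiv i g); [exact: smooth_pderiv|exact: pderiv_translate].
by exists f.
Qed.

Lemma test_function_translate (U V : set 'rV[R]_d) f v :
  (forall x, U x -> V (x - v)) -> test_function U f ->
  test_function V (fun x => f (x + v)).
Proof.
move=> UV tf; have [K [cK KU f0]] := test_function_supp tf.
apply: (@supp_test_function _ _ V ((fun x => x - v) @` K)).
- exact/smooth_translate/(test_function_smooth tf).
- apply: continuous_compact => //; apply: continuous_subspaceT => x.
  by apply: (@continuousB _ _ _ id (cst v)) => //; exact: cst_continuous.
- by move=> _ [x Kx <-]; exact/UV/KU.
- move=> x nx; apply: f0; apply: contra_not nx => Kx.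
  by exists (x + v) => //; rewrite addrK.
Qed.

End translates.

Section difference_quotient.
Context {R : realType} {d : nat}.
Variables Omega U : set 'rV[R]_d.
Hypotheses (oOmega : open Omega) (bOmega : bounded_set Omega) (oU : open U).
Local Notation vol := (volume oOmega).
Variables (i : 'I_d) (h : R).
Hypothesis h0 : 0 < h.
Local Notation e := (delta_mx ord0 i : 'rV[R]_d).
Hypothesis UO : forall x, U x -> forall s, 0 <= s <= h -> Omega (x + s *: e).

Let USO : U `<=` Omega.
Proof. by move=> x /UO/(_ 0); rewrite lexx (ltW h0) scale0r addr0; exact. Qed.

Let bU : bounded_set U.
Proof.
move: bOmega => [M [Mr OM]]; exists M; split=> // N /OM ON x /USO; exact: ON.
Qed.

Lemma norm_translate_test (f : 'rV[R]_d -> R^o) (s : R) : 0 <= s <= h ->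
  test_function U f ->
  `|on_domain oOmega (fun x => f (x - s *: e))| = `|on_domain oU f|.
Proof.
move=> sh tf.
have tfv : test_function Omega (fun x => f (x - s *: e)).
  by apply: test_function_translate tf => x Ux; rewrite opprK; exact: UO.
have mf := smooth_measurable (test_function_smooth tf).
have mfv := smooth_measurable (test_function_smooth tfv).
have [K [_ KU f0]] := test_function_supp tf.
have [K' [_ KO fv0]] := test_function_supp tfv.
apply/eqP; rewrite -(@eqrXn2 _ 2)//; apply/eqP.
transitivity (\int[lebesgue_rV d]_x (f x ^+ 2)).
  rewrite L2norm_class; last exact: test_Lfun2.
  rewrite volume_Rintegral.
  - congr fine; apply: (integral_translation (- (s *: e)) (F := fun x => (f x ^+ 2)%:E)).
    by apply/measurable_EFinP; exact: measurable_funX.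
  - exact: measurable_funX.
  - by move=> x nOx; rewrite fv0 ?expr0n// => /KO.
rewrite L2norm_class; last exact: test_Lfun2.
rewrite volume_Rintegral//; first exact: measurable_funX.
by move=> x nUx; rewrite f0 ?expr0n// => /KU.
Qed.

(** An everywhere defined, bounded representative that is 0 off [Omega], so that [F (x + h *: e)] is
    meaningful pointwise. *)
Variables (F : 'rV[R]_d -> R) (MF : R) (g : LspaceType2 vol).
Hypotheses (mF : measurable_fun [set: 'rV[R]_d] F) (FM : forall x, `|F x| <= MF)
  (F0 : forall x, ~ Omega x -> F x = 0) (Fg : is_weak_deriv i (on_domain oOmega F) g).

(* The increment of [f] over a segment is, up to O(delta), the derivative of a
   sum of translates of [f]. *)
Lemma increment_as_derivative (f : 'rV[R]_d -> R^o) (M delta : R) (m : nat) :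
  test_function U f -> (forall x, `|pderiv i (pderiv i f) x| <= M) ->
  0 < delta -> m%:R * delta <= h ->
  exists Phi : 'rV[R]_d -> R^o, [/\ test_function Omega Phi,
    `|on_domain oOmega Phi| <= m%:R * delta * `|on_domain oU f| &
    forall x, `|f (x - (m%:R * delta) *: e) - f x + pderiv i Phi x| <=
      m%:R * (M * delta ^+ 2)].
Proof.
move=> tf fM delta0; elim: m => [_|m ih mh].
  exists (cst 0); split; first exact: test_function0.
    have -> : cst 0 = cst 0 * cst 0 :> ('rV[R]_d -> R^o).
      by apply/funext => x; rewrite fctE mul0r.
    by rewrite test_on_domainZ ?scale0r ?normr0 ?mul0r//; exact: test_function0.
  by move=> x; rewrite !mul0r scale0r subr0 subrr pderiv_cst addr0 normr0.
have md : m%:R * delta <= h.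
  by rewrite (le_trans _ mh)// ler_pM2r// ler_nat.
have [Phi [tPhi nPhi pPhi]] := ih md.
have m1h : 0 <= m.+1%:R * delta <= h by rewrite mh mulr_ge0// ltW.
set s := m.+1%:R * delta in mh m1h *.
have tfs : test_function Omega (fun x => f (x - s *: e)).
  by apply: test_function_translate tf => x Ux; rewrite opprK; exact: UO.
have tdfs := test_functionZ delta tfs.
(* [Phi] is the Riemann sum, by right endpoints, of the integral of [f (x - t *: e)] over t. Every
   translate has the norm of [f], whence the factor m delta. *)
exists (cst delta * (fun x => f (x - s *: e)) + Phi); split.
- exact: test_functionD.
- rewrite test_on_domainD// test_on_domainZ// (le_trans (ler_normD _ _))//.
  rewrite normrZ gtr0_norm// (norm_translate_test m1h tf) /s -[m.+1%:R]natr1 mulrDl mul1r mulrDl addrC.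
  by rewrite lerD.
move=> x; set y := x - s *: e.
have sfs := test_function_smooth tfs.
have -> : pderiv i (cst delta * (fun x => f (x - s *: e)) + Phi) x =
    delta * pderiv i f y + pderiv i Phi x.
  rewrite pderivD; [|exact: test_function_smooth tdfs|exact: test_function_smooth tPhi].
  rewrite pderivM; [|exact: smooth_cst|exact: sfs].
  by rewrite pderiv_cst pderiv_translate !fctE mulr0 addr0.
have ye : y + delta *: e = x - (m%:R * delta) *: e.
  by rewrite /y /s -[m.+1%:R]natr1 mulrDl mul1r scalerDl opprD addrA subrK.
have := smooth_taylor y (test_function_smooth tf) fM delta0; rewrite ye => T.
have {}T : `|f y - f (x - (m%:R * delta) *: e) + delta * pderiv i f y| <= M * delta ^+ 2.
  have -> : f y - f (x - (m%:R * delta) *: e) + delta * pderiv i f y =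
     delta * (pderiv i f y - delta^-1 * (f (x - (m%:R * delta) *: e) - f y)).
    by field; rewrite gt_eqF.
  rewrite normrM gtr0_norm// expr2 mulrA [leRHS]mulrC ler_wpM2l// ltW//.
have := pPhi x; move: T.
rewrite -[m.+1%:R]natr1 mulrDl mul1r.
set p := f y; set q := f (x - _); set r := f x; set a := delta * _; set b := pderiv i Phi x.
move=> T1 T2; have -> : p - r + (a + b) = (q - r + b) + (p - q + a) by ring.
by rewrite (le_trans (ler_normD _ _))// lerD.
Qed.

(** Translation invariance moves the increment onto [f]. That increment is nearly minus the
    derivative of a test function [Phi] of norm at most h times that of [f], and the weak derivative
    [g] turns the integral of [F] against it into the inner product of [g] and [Phi]. *)
Lemma difference_dot_bound (f : 'rV[R]_d -> R^o) : test_function U f ->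
  `|\int[lebesgue_rV d]_x ((F (x + h *: e) - F x) * f x)| <=
    h * `|g| * `|on_domain oU f|.
Proof.
move=> tf; have sf := test_function_smooth tf; have mf := smooth_measurable sf.
have [M M0 fM] := test_function_bounded (test_function_pderiv i (test_function_pderiv i tf)).
have [Mf _ fb] := test_function_bounded tf.
have [K [cK KU f0]] := test_function_supp tf.
have MF0 : 0 <= MF by apply: le_trans (FM 0).
have tfh : test_function Omega (fun x => f (x - h *: e)).
  apply: test_function_translate tf => x Ux; rewrite opprK; apply: UO => //.
  by rewrite lexx ltW.
have mfh := smooth_measurable (test_function_smooth tfh).
have [r r0 Or] := bounded_sub_ball bOmega.
have int_bd (G : 'rV[R]_d -> R) C : measurable_fun [set: 'rV[R]_d] G -> (forall x, `|G x| <= C) ->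
    (forall x, ~ Omega x -> G x = 0) -> (lebesgue_rV d).-integrable [set: _] (EFin \o G).
  move=> mG GC G0; apply: (@bounded_supp_integrable _ _ G C r) => // x nx.
  by apply: G0 => /Or.
have mFh : measurable_fun [set: 'rV[R]_d] (fun x => F (x + h *: e)).
  by apply: measurableT_comp => //; exact: measurable_translation_rV.
have E1 : \int[lebesgue_rV d]_x ((F (x + h *: e) - F x) * f x) =
    \int[lebesgue_rV d]_x (F x * (f (x - h *: e) - f x)).
  under eq_Rintegral do rewrite mulrBl.
  under [RHS]eq_Rintegral do rewrite mulrBr.
  have i1 : (lebesgue_rV d).-integrable [set: _] (EFin \o (fun x => F x * f x)).
    apply: (int_bd _ (MF * Mf)); first exact: measurable_funM.
      by move=> x; rewrite normrM ler_pM.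
    by move=> x /F0 ->; rewrite mul0r.
  rewrite RintegralB//; last first.
    apply: (int_bd _ (MF * Mf)); first exact: measurable_funM.
      by move=> x; rewrite normrM ler_pM.
    by move=> x nOx; rewrite f0 ?mulr0// => /KU/USO.
  rewrite RintegralB//; last first.
    apply: (int_bd _ (MF * Mf)); first exact: measurable_funM.
      by move=> x; rewrite normrM ler_pM.
    by move=> x /F0 ->; rewrite mul0r.
  congr (_ - _); congr fine.
  rewrite -[RHS](integral_translation (h *: e)).
    by apply: eq_integral => x _; rewrite addrK.
  by apply/measurable_EFinP; exact: measurable_funM.
rewrite E1; apply/ler_addgt0Pr => eps eps0.
(* With N + 1 steps of length h / (N + 1), the total error is at most [C] / (N + 1). *)
pose C := MF * (h ^+ 2 * M) * fine (vol setT).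
have C0 : 0 <= C.
  apply: mulr_ge0; last by apply: fine_ge0; exact: measure_ge0.
  by rewrite mulr_ge0// mulr_ge0// sqr_ge0.
have [N _ NP] := near_infty_natSinv_lt (PosNum (divr_gt0 eps0 (ltr_wpDl C0 ltr01 : 0 < C + 1))).
have := NP N (leqnn N); rewrite /= => {}NP.
pose delta := h / N.+1%:R.
have delta0 : 0 < delta by rewrite divr_gt0.
have Nd : N.+1%:R * delta = h by rewrite mulrCA divff ?mulr1// pnatr_eq0.
have [Phi [tPhi nPhi pPhi]] :=
  increment_as_derivative tf fM delta0 (eq_ind_r (fun z => z <= h) (lexx h) Nd).
rewrite Nd in nPhi pPhi.
have mPhi := smooth_measurable (smooth_pderiv i (test_function_smooth tPhi)).
have FL : F \in Lfun vol 2%:E by exact: (@bounded_Lfun2 _ _ _ oOmega bOmega _ MF).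
have tpPhi := test_function_pderiv i tPhi.
have [MP _ PhiM] := test_function_bounded tpPhi.
have E2 : \int[lebesgue_rV d]_x (F x * pderiv i Phi x) =
    - L2dot g (on_domain oOmega Phi).
  rewrite -(volume_Rintegral oOmega).
  - rewrite -((is_weak_derivP bOmega i (on_domain oOmega F) g).1 Fg Phi tPhi).
    symmetry; apply: L2dot_ae => //.
    + exact: L2class_ae.
    + exact/L2class_ae/test_Lfun2.
  - exact: measurable_funM.
  - by move=> x /F0 ->; rewrite mul0r.
have E3 : `|\int[lebesgue_rV d]_x (F x * (f (x - h *: e) - f x + pderiv i Phi x))| <= eps.
  set G := fun x => F x * _.
  have mG : measurable_fun [set: 'rV[R]_d] G.
    by apply: measurable_funM => //; apply: measurable_funD => //; exact: measurable_funB.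
  have Gb x : `|G x| <= MF * (N.+1%:R * (M * delta ^+ 2)).
    by rewrite normrM ler_pM.
  have iG : vol.-integrable [set: _] (EFin \o G) by exact: (@bounded_integrable _ _ _ oOmega bOmega _ _ mG Gb).
  rewrite -(volume_Rintegral oOmega)//; last by move=> x /F0; rewrite /G => ->; rewrite mul0r.
  rewrite (le_trans (le_normr_Rintegral _ iG))//.
  rewrite (@le_trans _ _ (\int[vol]_x (cst (MF * (N.+1%:R * (M * delta ^+ 2))) x)))//.
    apply: le_Rintegral => //; first exact: integrable_norm iG.
    by apply: (@bounded_integrable _ _ _ oOmega bOmega _ `|MF * (N.+1%:R * (M * delta ^+ 2))|) => //.
  rewrite Rintegral_cst//.
  have -> : MF * (N.+1%:R * (M * delta ^+ 2)) * fine (vol setT) = C * N.+1%:R^-1.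
    by rewrite /C /delta; field.
  rewrite (le_trans (ler_wpM2l C0 (ltW NP)))// mulrCA ler_piMr ?(ltW eps0)//.
  by rewrite ler_pdivrMr ?mul1r ?lerDl// ltr_wpDl.
have E4 : \int[lebesgue_rV d]_x (F x * (f (x - h *: e) - f x)) =
   \int[lebesgue_rV d]_x (F x * (f (x - h *: e) - f x + pderiv i Phi x)) +
   L2dot g (on_domain oOmega Phi).
  under [X in _ = X + _]eq_Rintegral do rewrite mulrDr.
  rewrite RintegralD//.
  - by rewrite E2 subrK.
  - apply: (int_bd _ (MF * (Mf + Mf))).
    + by apply: measurable_funM => //; exact: measurable_funB.
    + by move=> x; rewrite normrM ler_pM// (le_trans (ler_normB _ _))// lerD.
    + by move=> x /F0 ->; rewrite mul0r.
  - apply: (int_bd _ (MF * MP)).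
    + exact: measurable_funM.
    + by move=> x; rewrite normrM ler_pM.
    + by move=> x /F0 ->; rewrite mul0r.
rewrite E4 (le_trans (ler_normD _ _))// addrC lerD//.
rewrite (le_trans (L2dot_CauchySchwarz _ _))//.
by rewrite mulrAC [leRHS]mulrC ler_wpM2l.
Qed.

(** By duality: [difference_dot_bound] controls the pairing of the increment with every test
    function of [U], and these are dense in L_2(U). *)
Lemma difference_quotient_bound :
  \int[lebesgue_rV d]_(x in U) (F (x + h *: e) - F x) ^+ 2 <= h ^+ 2 * `|g| ^+ 2.
Proof.
pose D x := F (x + h *: e) - F x.
have mFh : measurable_fun [set: 'rV[R]_d] (fun x => F (x + h *: e)).
  by apply: measurableT_comp => //; exact: measurable_translation_rV.
have mD : measurable_fun [set: 'rV[R]_d] D by exact: measurable_funB.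
have DL : D \in Lfun (volume oU) 2%:E.
  apply: (@bounded_Lfun2 _ _ _ oU bU _ (MF + MF)) => // x.
  by rewrite (le_trans (ler_normB _ _))// lerD.
have mU := open_measurable_rV oU.
have mDU : measurable_fun [set: 'rV[R]_d] ((fun x => D x ^+ 2) \_ U).
  apply/(measurable_restrictT _ _).1; first exact: mU.
  by apply: measurable_funTS; exact: measurable_funX.
have -> : \int[lebesgue_rV d]_(x in U) (F (x + h *: e) - F x) ^+ 2 =
    `|on_domain oU D| ^+ 2.
  rewrite L2norm_class// Rintegral_mkcond -(volume_Rintegral oU).
  - apply: eq_Rintegral_ae.
    + exact: mDU.
    + exact: measurable_funX.
    + move: (volume_ae_Omega oU); apply: filterS => x Ux _.
      by rewrite patchE mem_set.
  - exact: mDU.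
  - by move=> x nUx; rewrite patchE memNset.
set w := on_domain oU D.
have wf f : test_function U f -> `|L2dot w (on_domain oU f)| <= h * `|g| * `|on_domain oU f|.
  move=> tf; apply: le_trans (difference_dot_bound tf).
  have [K [_ KU f0]] := test_function_supp tf.
  have mf := smooth_measurable (test_function_smooth tf).
  rewrite (L2dot_ae (L2class_ae DL) (L2class_ae (test_Lfun2 oU bU tf)) mD mf).
  rewrite volume_Rintegral//; first exact: measurable_funM.
  by move=> x nUx; rewrite f0 ?mulr0// => /KU.
(* The increment [w] is paired with a test function close to [w] itself. *)
have key : `|w| ^+ 2 <= h * `|g| * `|w|.
  apply/ler_addgt0Pr => eps eps0.
  pose c := h * `|g| + `|w| + 1.
  have c0 : 0 < c by rewrite ltr_wpDl// addr_ge0// mulr_ge0// ltW.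
  have [f tf fw] := test_dense bU w (divr_gt0 eps0 c0).
  have fw' : `|on_domain oU f| <= `|w| + `|on_domain oU f - w|.
    by rewrite -{1}[on_domain oU f](subrK w) addrC ler_normD.
  have := wf f tf; have := L2dot_CauchySchwarz w (on_domain oU f - w).
  rewrite -L2dot_norm; have -> : L2dot w w = L2dot w (on_domain oU f) - L2dot w (on_domain oU f - w).
    by rewrite L2dotBr opprB addrCA subrr addr0.
  move: (L2dot w (on_domain oU f)) (L2dot w (on_domain oU f - w)) fw fw'.
  move: (`|on_domain oU f|) (`|on_domain oU f - w|) (normr_ge0 (on_domain oU f - w)).
  move: (`|w|) (normr_ge0 w) @c c0 (mulr_ge0 (ltW h0) (normr_ge0 g)).
  move: (h * `|g|) => hg W W0 c c0 hg0 a b b0 p q bc ab.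
  rewrite ltr_pdivlMr// in bc; rewrite /c in bc.
  rewrite !ler_norml => /andP[q1 q2] /andP[p1 p2].
  have h1 : hg * a <= hg * (W + b) by rewrite ler_wpM2l.
  have h2 : 0 <= b by []. nra.
have : `|w| <= h * `|g|.
  have [->|w0] := eqVneq `|w| 0; first by rewrite mulr_ge0// ltW.
  by rewrite -(ler_pM2r (x := `|w|)) ?lt_def ?w0//= -expr2.
by rewrite -exprMn => ?; rewrite lerXn2r// nnegrE// mulr_ge0// ltW.
Qed.

End difference_quotient.

(** * Covering by balls *)

Section hausdorff_covers.
Context {R : realType} {d : nat}.
Implicit Types (A F : set 'rV[R]_d) (n : nat).

Lemma unit_ball_volume_gt0 n : 0 < unit_ball_volume n :> R.
Proof.
suff: 0 < unit_ball_volume n :> R /\ 0 < unit_ball_volume n.+1 :> R by case.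
elim: n => [|n [ih1 ih2]]; first by split; rewrite /= ?ltr01 ?ltr0n.
split=> //; rewrite [unit_ball_volume n.+2]/=.
by rewrite mulr_gt0// divr_gt0// mulr_gt0// pi_gt0.
Qed.

Lemma coord_le_enorm i (x : 'rV[R]_d) : `|x ord0 i| <= enorm x.
Proof.
rewrite -sqrtr_sqr ler_wsqrtr// (bigD1 i)//= lerDl sumr_ge0// => j _.
exact: sqr_ge0.
Qed.

Lemma enorm_le_ediam F x y : F x -> F y -> ((enorm (x - y))%:E <= ediam F)%E.
Proof. by move=> Fx Fy; apply: ereal_sup_ubound; exists (x, y). Qed.

Lemma ediam_fin_num F (delta : R) x : F x -> (ediam F <= delta%:E)%E ->
  ediam F \is a fin_num.
Proof.
move=> Fx Fd; rewrite fin_real// (lt_le_trans _ (enorm_le_ediam Fx Fx)) ?ltNyr//.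
by rewrite (le_lt_trans Fd)// ltry.
Qed.

Lemma hausdorff_gauge_ge0 n F : (0 <= hausdorff_gauge n F)%E.
Proof.
rewrite /hausdorff_gauge; case: eqVneq => // /set0P[x Fx].
rewrite mule_ge0 ?expe_ge0//; last first.
  by rewrite (le_trans _ (enorm_le_ediam Fx Fx))// lee_fin sqrtr_ge0.
by rewrite lee_fin divr_ge0 ?exprn_ge0// ltW// unit_ball_volume_gt0.
Qed.

Lemma exprD_le2 n (a b : R) : 0 <= a -> 0 <= b ->
  (a + b) ^+ n <= 2 ^+ n * (a ^+ n + b ^+ n).
Proof.
move=> a0 b0; wlog ab : a b a0 b0 / a <= b => [H|].
  have [/H|/ltW/H] := leP a b; first exact.
  by rewrite addrC [b ^+ n + _]addrC; apply.
rewrite (@le_trans _ _ ((2 * b) ^+ n))//.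
  by apply: lerXn2r; rewrite ?nnegrE ?addr_ge0 ?mulr_ge0//; lra.
by rewrite exprMn ler_wpM2l ?exprn_ge0// lerDr exprn_ge0.
Qed.

Lemma sum_half_le1 N : \sum_(k < N) (2 ^- k.+1 : R) <= 1.
Proof.
suff -> : \sum_(k < N) (2 ^- k.+1 : R) = 1 - 2 ^- N.
  by rewrite gerDl oppr_le0 invr_ge0 exprn_ge0.
elim: N => [|N ih]; first by rewrite big_ord0 expr0 invr1 subrr.
by rewrite big_ord_recr/= ih !exprS; field; rewrite ?expf_neq0.
Qed.

(** Each set of a nearly optimal cover that meets [A] is replaced by a ball centred at one of its
    points in [A]. The radius is the diameter plus a small [t k], because the ball is open and the
    diameter may be 0. Sets that miss [A] get radius 0, that is, an empty ball. *)
Lemma hausdorff_ball_cover n : (0 < n)%N -> exists2 C : R, 0 < C &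
  forall A (delta eps : R), 0 < delta -> 0 < eps -> (hausdorff n A < +oo)%E ->
  exists (x : nat -> 'rV[R]_d) (r : nat -> R),
   [/\ forall k, 0 <= r k <= delta, forall k, 0 < r k -> A (x k),
       A `<=` \bigcup_k ball (x k) (r k) &
       forall N, \sum_(k < N) r k ^+ n <= C * (fine (hausdorff n A) + eps)].
Proof.
move=> n0; pose c : R := unit_ball_volume n / 2 ^+ n.
have c0 : 0 < c by rewrite divr_gt0 ?exprn_gt0// unit_ball_volume_gt0.
(* The gauge of a nonempty set is c times its diameter to the power n, and (a + b)^n <= 2^n (a^n +
   b^n). *)
exists (2 ^+ n * (c^-1 + 1)); first by rewrite mulr_gt0 ?exprn_gt0// addr_gt0// invr_gt0.
move=> A delta eps delta0 eps0 Aoo.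
have d20 : 0 < delta / 2 by rewrite divr_gt0.
have hA0 : (0 <= hausdorff n A)%E by [].
have hAf : hausdorff n A \is a fin_num by rewrite ge0_fin_numE.
have sA : (hausdorff_size n (delta / 2) A <= hausdorff n A)%E.
  by apply: ereal_sup_ubound; exists (delta / 2).
have sA0 : (0 <= hausdorff_size n (delta / 2) A)%E.
  apply: le_ereal_inf_tmp => _ [F _ <-]; apply: nneseries_ge0 => k _ _.
  exact: hausdorff_gauge_ge0.
have sf : hausdorff_size n (delta / 2) A \is a fin_num.
  by rewrite ge0_fin_numE// (le_lt_trans sA).
have [_ [F [AF dF] <-] FA] := lb_ereal_inf_adherent eps0 sf.
have gf k : hausdorff_gauge n (F k) \is a fin_num.
  rewrite /hausdorff_gauge; case: eqVneq => [//|/set0P[x Fx]].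
  by rewrite fin_numM// fin_numX// (ediam_fin_num Fx (dF k)).
(* At most delta / 2 to keep the radius within delta, at most 1 so that the n-th power is no larger,
   and at most the k-th term of a series with sum eps. *)
pose t k : R := Num.min (delta / 2) (Num.min 1 (eps * 2 ^- k.+1)).
have t0 k : 0 < t k by rewrite !lt_min d20 ltr01 mulr_gt0// invr_gt0 exprn_gt0.
have tn k : t k ^+ n <= eps * 2 ^- k.+1.
  have t1 : t k <= 1 by rewrite !ge_min lexx orbT.
  rewrite (@le_trans _ _ (t k))//; last by rewrite !ge_min lexx !orbT.
  by rewrite -(prednK n0) exprS ler_piMr ?(ltW (t0 k))// exprn_ile1// ltW.
have /choice[p pP] k : exists p : 'rV[R]_d * R, [/\ 0 <= p.2 <= delta,
    0 < p.2 -> A p.1, F k `&` A `<=` ball p.1 p.2 &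
    p.2 ^+ n <= 2 ^+ n * (c^-1 * fine (hausdorff_gauge n (F k)) + eps * 2 ^- k.+1)].
  have [[a [Fa Aa]]|nFA] := pselect (exists a, (F k `&` A) a); last first.
    exists (0, 0) => /=; split; rewrite ?lexx ?ltxx ?(ltW delta0)//.
      by move=> a FAa; case: nFA; exists a.
    rewrite expr0n gtn_eqF// mulr_ge0 ?exprn_ge0// addr_ge0//.
      by rewrite mulr_ge0 ?invr_ge0 ?(ltW c0)// fine_ge0// hausdorff_gauge_ge0.
    by rewrite mulr_ge0 ?invr_ge0 ?exprn_ge0// ltW.
  have Df := ediam_fin_num Fa (dF k).
  pose D := fine (ediam (F k)); have DE : ediam (F k) = D%:E by rewrite fineK.
  have FD x y : F k x -> F k y -> enorm (x - y) <= D.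
    by move=> Fx Fy; have := enorm_le_ediam Fx Fy; rewrite DE lee_fin.
  have D0 : 0 <= D by apply: le_trans (FD _ _ Fa Fa); exact: sqrtr_ge0.
  have Dd : D <= delta / 2 by have := dF k; rewrite DE lee_fin.
  have r0 : 0 < D + t k by rewrite ltr_wpDl.
  exists (a, D + t k) => /=; split.
  - by rewrite (ltW r0)/= [leRHS]splitr lerD// !ge_min lexx.
  - by [].
  - move=> y [Fy _]; apply/(ball_rVP _ _ r0) => i.
    have := coord_le_enorm i (a - y); rewrite !mxE => /le_lt_trans; apply.
    by rewrite (le_lt_trans (FD _ _ Fa Fy))// ltrDl.
  - rewrite (le_trans (exprD_le2 n D0 (ltW (t0 k))))// ler_wpM2l ?exprn_ge0// lerD//.
    have -> : hausdorff_gauge n (F k) = (c * D ^+ n)%:E.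
      rewrite /hausdorff_gauge; case: eqVneq => [F0|_]; first by rewrite F0 in Fa.
      by rewrite DE [RHS]EFinM EFin_expe.
    by rewrite /= mulKf// gt_eqF.
exists (fun k => (p k).1), (fun k => (p k).2); split.
- by move=> k; case: (pP k).
- by move=> k; case: (pP k).
- by move=> x Ax; have [k _ Fx] := AF x Ax; exists k => //; have [_ _ h _] := pP k; exact: h.
move=> N.
have GN : \sum_(k < N) fine (hausdorff_gauge n (F k)) <= fine (hausdorff n A) + eps.
  rewrite -lee_fin EFinD fineK// -sumEFin.
  rewrite (@le_trans _ _ (\sum_(k <oo) hausdorff_gauge n (F k))%E)//; last first.
    by rewrite (le_trans (ltW FA))// leeD2r.
  rewrite (eq_bigr (fun k : 'I_N => hausdorff_gauge n (F k))); last by move=> k _; rewrite fineK.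
  rewrite -(big_mkord xpredT (fun k => hausdorff_gauge n (F k))).
  by apply: nneseries_lim_ge => k _ _; exact: hausdorff_gauge_ge0.
rewrite (@le_trans _ _ (\sum_(k < N) 2 ^+ n * (c^-1 * fine (hausdorff_gauge n (F k)) + eps * 2 ^- k.+1)))//.
  by apply: ler_sum => k _; case: (pP k).
rewrite -mulr_sumr big_split/= -!mulr_sumr -mulrA ler_wpM2l ?exprn_ge0//.
have c1 : 0 <= c^-1 by rewrite invr_ge0 ltW.
have := sum_half_le1 N; have := fine_ge0 hA0.
move: GN; move: (fine _) (\sum_(k < N) fine _) (\sum_(k < N) 2 ^- _) => s S H SS s0 H1.
by rewrite mulrDl mul1r lerD// ?ler_wpM2l// (@le_trans _ _ eps) ?lerDr// ler_piMr// ltW.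
Qed.

Lemma level_sum_le dT (T : measurableType dT) (mu : {measure set T -> \bar R})
    (A : nat -> set T) (a : nat -> R) (f : T -> R) N :
  (mu setT < +oo)%E -> (forall j, measurable (A j)) -> (forall j, 0 <= a j) ->
  (forall j k x, A j x -> A k x -> j = k) -> (forall j x, A j x -> a j <= f x) ->
  (forall x, 0 <= f x) -> mu.-integrable [set: T] (EFin \o f) ->
  \sum_(j < N) a j * fine (mu (A j)) <= \int[mu]_x f x.
Proof.
move=> muoo mA a0 dA af f0 fi.
have muf j : mu (A j) \is a fin_num.
  by rewrite ge0_fin_numE// (le_lt_trans _ muoo)// le_measure// inE.
have pt x : \sum_(j < N) a j * \1_(A j) x <= f x.
  have [[j Aj]|nA] := pselect (exists j : 'I_N, A j x); last first.
    by rewrite big1// => j _; rewrite indicE memNset ?mulr0// => Aj; case: nA; exists j.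
  rewrite (bigD1 j)//= [X in _ + X]big1 ?addr0.
    by rewrite indicE mem_set// mulr1; exact: af Aj.
  move=> k kj; rewrite indicE memNset ?mulr0// => Ak.
  by move/eqP: kj; apply; apply: val_inj; exact: dA Ak Aj.
rewrite -lee_fin /Rintegral fineK; last exact: integrable_fin_num.
rewrite (@le_trans _ _ (\int[mu]_x (\sum_(j < N) a j * \1_(A j) x)%:E)%E)//; last first.
  apply: ge0_le_integral => //.
  - by move=> x _; rewrite lee_fin sumr_ge0// => j _; rewrite mulr_ge0// indicE.
  - apply/measurable_EFinP; apply: measurable_sum => j.
    by apply: measurable_funM => //; exact: measurable_indic.
  - exact: measurable_int fi.
  - by move=> x _; rewrite lee_fin.
under eq_integral do rewrite -sumEFin.
rewrite ge0_integral_sum//.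
- rewrite -sumEFin; apply: lee_sum => j _.
  under eq_integral do rewrite EFinM.
  rewrite ge0_integralZl_EFin//.
  + by rewrite integral_indic// setIT EFinM fineK.
  + by apply/measurable_EFinP; exact: measurable_indic.
- move=> j; apply/measurable_EFinP; apply: measurable_funM => //; exact: measurable_indic.
- by move=> j x _; rewrite lee_fin mulr_ge0// indicE.
Qed.

Lemma compact_finite_subcover (K : set 'rV[R]_d) (O : nat -> set 'rV[R]_d) :
  compact K -> (forall k, open (O k)) -> K `<=` \bigcup_k O k ->
  exists N, K `<=` \bigcup_(k in `I_N) O k.
Proof.
move=> /compact_near_coveringP cK oO KO.
have [] := cK nat \oo (fun N x => (\bigcup_(k in `I_N) O k) x) _.
  move=> x /KO[k _ Okx]; exists (O k, [set N | (k < N)%N]).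
    by split=> /=; [exact: (open_nbhs_nbhs (conj (oO k) Okx))|exact: nbhs_infty_gt].
  by move=> [y N] /= [Oy kN]; exists k.
by move=> N _ /(_ N (leqnn N)) KN; exists N.
Qed.

(* Covering each level set of [w] separately by balls centered in it keeps the
   weighted sum below the integral of [w]. *)
Lemma weighted_ball_cover n : (0 < n)%N -> exists2 C : R, 0 < C &
  forall (K : set 'rV[R]_d) (mK : measurable K) (w : 'rV[R]_d -> R) (M delta eps : R),
  compact K -> (hausdorff n K < +oo)%E -> measurable_fun [set: 'rV[R]_d] w ->
  (forall x, 0 <= w x <= M) -> 0 < delta -> 0 < eps ->
  exists s : seq ('rV[R]_d * R),
   [/\ forall p, p \in s -> 0 < p.2 <= delta /\ K p.1,
       forall x, K x -> exists2 p, p \in s & ball p.1 p.2 x,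
       \sum_(p <- s) p.2 ^+ n <= C * (fine (hausdorff n K) + eps) &
       \sum_(p <- s) p.2 ^+ n * w p.1 <=
         C * (\int[mrestr (hausdorff n) mK]_x w x + eps)].
Proof.
move=> n0; have [C C0 HC] := hausdorff_ball_cover n0; exists C => //.
move=> K mK w M delta eps cK Koo mw wM delta0 eps0.
set mu := mrestr _ mK; set sg := fine (hausdorff n K).
have muE X : mu X = hausdorff n (X `&` K) by [].
have muoo : (mu setT < +oo)%E by rewrite muE setTI.
have sg0 : 0 <= sg by exact: fine_ge0.
(* The height of the levels: rounding [w] up to the next level adds at most e1 times the measure,
   hence at most eps / 2. *)
pose e1 : R := eps / (2 * (sg + 1)).
have e10 : 0 < e1 by rewrite divr_gt0// mulr_gt0// ltr_wpDl.
pose J := (Num.truncn (M / e1)).+1.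
(* Each of the J covers wastes e2. The total waste is at most J e2 without weights and J^2 e1 e2
   with them; both fit in eps / 2 for e2 = eps / (2 Q). *)
pose Q : R := J%:R ^+ 2 * e1 + J%:R + 1.
have Q0 : 0 < Q by rewrite ltr_wpDl// addr_ge0// mulr_ge0 ?sqr_ge0// ltW.
pose e2 := eps / (2 * Q).
have e20 : 0 < e2 by rewrite divr_gt0// mulr_gt0.
pose A (j : nat) := K `&` [set x | j%:R * e1 <= w x < j.+1%:R * e1].
have mA j : measurable (A j).
  apply: measurableI => //; rewrite (_ : [set x | _] = w @^-1` `[j%:R * e1, j.+1%:R * e1[%classic).
    by rewrite -[X in measurable X]setTI; apply: mw => //; exact: measurable_itv.
  by apply/seteqP; split=> x /=; rewrite in_itv.
have AK j : A j `<=` K by move=> x [].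
have hA j : hausdorff n (A j) = mu (A j) by rewrite muE setIidl.
have hAoo j : (hausdorff n (A j) < +oo)%E.
  by rewrite (le_lt_trans _ Koo)// le_measure// inE.
have dA j k x : A j x -> A k x -> j = k.
  move=> [_ /= /andP[j1 j2]] [_ /= /andP[k1 k2]].
  have := le_lt_trans j1 k2; have := le_lt_trans k1 j2.
  rewrite !ltr_pM2r// !ltr_nat !ltnS => kj jk.
  by apply/eqP; rewrite eqn_leq jk kj.
have /choice[x /choice[r xr]] j := HC (A j) delta e2 delta0 e20 (hAoo j).
(* Radius 0 marks an empty ball and is dropped. *)
pose s N := [seq p <- [seq (x j k, r j k) | j <- iota 0 J, k <- iota 0 N] | 0 < p.2].
have KO : K `<=` \bigcup_k \bigcup_(j in `I_J) ball (x j k) (r j k).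
  move=> y Ky; have w0 : 0 <= w y / e1.
    by rewrite divr_ge0 ?(ltW e10)//; case/andP: (wM y).
  have /andP[t1 t2] := truncn_itv w0; set j := Num.truncn (w y / e1) in t1 t2.
  have Ajy : A j y by split => //=; rewrite -ler_pdivlMr// -ltr_pdivrMr// t1 t2.
  have jJ : (j < J)%N.
    rewrite ltnS; apply: le_truncn; rewrite ler_pM2r ?invr_gt0//.
    by case/andP: (wM y).
  by have [_ _ /(_ y Ajy)[k _ yk] _] := xr j; exists k => //; exists j.
have [|N KN] := compact_finite_subcover cK _ KO.
  by move=> k; apply: bigcup_open => j _; exact: ball_open.
have iotaE (h : nat -> R) m : \sum_(j <- iota 0 m) h j = \sum_(j < m) h j.
  by rewrite -(big_mkord xpredT) /index_iota subn0.
have sumE (G : 'rV[R]_d * R -> R) : (forall p, 0 <= p.2 -> 0 <= G p) ->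
    \sum_(p <- s N) G p <= \sum_(j < J) \sum_(k < N) G (x j k, r j k).
  move=> G0; rewrite /s big_filter big_mkcond big_allpairs_dep.
  rewrite iotaE; apply: ler_sum => j _; rewrite iotaE.
  apply: ler_sum => k _; case: ifPn => // _; apply: G0.
  by have [/(_ k) /andP[]] := xr j.
have M0 : 0 <= M by have /andP[w0] := wM 0; exact: le_trans.
have lev (a : nat -> R) f : (forall j, 0 <= a j) -> (forall j y, A j y -> a j <= f y) ->
    (forall y, 0 <= f y <= M + 1) -> measurable_fun [set: 'rV[R]_d] f ->
    \sum_(j < J) a j * fine (mu (A j)) <= \int[mu]_x f x.
  move=> a0 af f0 mf; apply: level_sum_le => //.
    by move=> y; case/andP: (f0 y).
  have fM y : `|f y| <= M + 1 by have /andP[fy0 fy] := f0 y; rewrite ger0_norm.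
  exact: (finite_bounded_integrable muoo mf fM).
have s1 : \sum_(j < J) 1 * fine (mu (A j)) <= sg.
  have -> : sg = \int[mu]_x cst 1 x.
    rewrite Rintegral_cst// mul1r; congr fine.
    by have := muE setT; rewrite setTI => /esym.
  apply: (lev (fun=> 1) (cst 1)) => //.
  by move=> y /=; rewrite ler01 lerDr.
exists (s N); split.
- move=> p; rewrite mem_filter => /andP[p0 /allpairsP[[j k] [_ _ /= pE]]].
  have [/(_ k) /andP[_ rd] /(_ k) Ax _ _] := xr j.
  by subst p; rewrite /= in p0 *; rewrite p0 rd; split=> //; exact/AK/Ax.
- move=> y /KN[k /= kN [j /= jJ yb]]; exists (x j k, r j k) => //.
  rewrite mem_filter; apply/andP; split; first by case: yb.
  have jI : j \in iota 0 J by rewrite mem_iota.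
  have kI : k \in iota 0 N by rewrite mem_iota.
  exact: (allpairs_f (fun j k => (x j k, r j k)) jI kI).
- rewrite (le_trans (sumE (fun p => p.2 ^+ n) _))//; first by move=> p p0; rewrite exprn_ge0.
  rewrite (@le_trans _ _ (\sum_(j < J) C * (1 * fine (mu (A j)) + e2)))//.
    by apply: ler_sum => j _; rewrite mul1r -hA; have [_ _ _ ] := xr j; apply.
  rewrite -mulr_sumr big_split/= ler_wpM2l ?(ltW C0)// lerD ?s1//.
  rewrite sumr_const card_ord -mulr_natl /e2 mulrA ler_pdivrMr; last by rewrite mulr_gt0.
  rewrite mulrC ler_wpM2l ?(ltW eps0)// /Q.
  have := sqr_ge0 (J%:R : R); have := ler0n R J; nra.
- rewrite (le_trans (sumE (fun p => p.2 ^+ n * w p.1) _))//.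
    by move=> p p0; rewrite mulr_ge0 ?exprn_ge0//; case/andP: (wM p.1).
  rewrite (@le_trans _ _ (\sum_(j < J) C * (j.+1%:R * e1 * (fine (mu (A j)) + e2))))//.
    apply: ler_sum => j _; have [r0 rA _ rs] := xr j.
    rewrite (@le_trans _ _ (\sum_(k < N) r j k ^+ n * (j.+1%:R * e1)))//.
      apply: ler_sum => k _; have [/andP[rjk _]] := (r0 k, tt).
      have [->|rn0] := eqVneq (r j k) 0; first by rewrite expr0n gtn_eqF// !mul0r.
      rewrite ler_wpM2l ?exprn_ge0//; have [|_ /= /andP[_ /ltW//]] := rA k.
      by rewrite lt_def rn0.
    have je0 : 0 <= j.+1%:R * e1 by rewrite mulr_ge0// ltW.
    rewrite -mulr_suml [leRHS]mulrCA [leRHS]mulrC ler_wpM2r//.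
    by rewrite -hA.
  rewrite -mulr_sumr ler_wpM2l ?(ltW C0)//.
  rewrite (@le_trans _ _ (\sum_(j < J) (j%:R * e1 * fine (mu (A j)) +
      (e1 * (1 * fine (mu (A j))) + J%:R * e1 * e2))))//.
    apply: ler_sum => j _; have jJ : j.+1%:R <= J%:R :> R by rewrite ler_nat.
    rewrite mulrDr addrA lerD//.
      by rewrite -natr1 mul1r mulrDl mul1r mulrDl.
    by rewrite ler_wpM2r ?(ltW e20)// ler_wpM2r// ltW.
  rewrite !big_split/= -mulr_sumr lerD//.
    apply: (lev (fun j => j%:R * e1) w) => //.
    - by move=> j; rewrite mulr_ge0// ltW.
    - by move=> j y [_ /= /andP[]].
    - by move=> y; have /andP[-> wy] := wM y; rewrite (le_trans wy)// lerDl.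
  rewrite sumr_const card_ord [eps]splitr lerD//.
    rewrite (le_trans (ler_wpM2l (ltW e10) s1))// /e1.
    have -> : eps / (2 * (sg + 1)) * sg = eps / 2 * (sg / (sg + 1)).
      by field; rewrite gt_eqF// ltr_wpDl.
    by rewrite ler_piMr ?divr_ge0 ?(ltW eps0)// ler_pdivrMr ?ltr_wpDl// mul1r lerDl.
  rewrite -(mulr_natl (J%:R * e1 * e2)); have -> : J%:R * (J%:R * e1 * e2) = eps / 2 * ((J%:R ^+ 2 * e1) / Q).
    by rewrite /e2; field; rewrite gt_eqF.
  rewrite ler_piMr ?divr_ge0 ?(ltW eps0)// ler_pdivrMr// mul1r /Q -addrA lerDl.
  by rewrite addr_ge0.
Qed.

Lemma within_continuous_measurable_rV (K : set 'rV[R]_d) (v : 'rV[R]_d -> R) :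
  measurable K -> {within K, continuous v} -> measurable_fun [set: 'rV[R]_d] (v \_ K).
Proof.
move=> mK cv; apply/(measurable_restrictT _ _).1; first exact: mK.
apply: (measurability _ (RGenOpens.measurableE R)).
move=> _ [_ [a [b ->] <-]]; move/continuousP : cv => /(_ _ (interval_open _ _)).
move=> /(_ (BRight a) (BLeft b) isT isT) /open_subspaceP[V oV VD].
by rewrite setIC -VD; apply: measurableI => //; exact: open_measurable_rV.
Qed.

End hausdorff_covers.

(** * Continuous functions in H^1 and their boundary values *)

Section boundary_values.
Context {R : realType} {d : nat}.
Variable Omega : set 'rV[R]_d.
Hypotheses (oOmega : open Omega) (bOmega : bounded_set Omega).
Hypothesis sOmega : (hausdorff d.-1 (boundary Omega) < +oo)%E.
Local Notation vol := (volume oOmega).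
Local Notation surf := (surface Omega).
Local Notation od := (on_domain oOmega).
Local Notation ob := (on_boundary Omega).
Local Notation K := (closure Omega).
Implicit Types (v w : 'rV[R]_d -> R).

Local Opaque Lspace_class Lspace_repr L2class.

Lemma compact_closure_domain : compact K.
Proof.
have [r r0 Or] := bounded_sub_ball bOmega.
apply: (subclosed_compact _ (@closed_ball_compact R d 0 r)); first exact: closed_closure.
by apply: closureS; exact: subset_trans Or (@subset_refl _ _).
Qed.

Lemma boundaryE : boundary Omega = K `\` Omega.
Proof. by rewrite /boundary (interior_id _).1. Qed.

Lemma boundary_sub : boundary Omega `<=` K.
Proof. by move=> x []. Qed.

Lemma compact_boundary : compact (boundary Omega).
Proof.
apply: (subclosed_compact _ compact_closure_domain boundary_sub).
rewrite boundaryE setDE; apply: closedI; first exact: closed_closure.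
by rewrite closedC.
Qed.

Lemma surface_finite : (surf setT < +oo)%E.
Proof. by rewrite /surface/= /mrestr setTI. Qed.

Lemma surface_ae_boundary : \forall x \ae surf, boundary Omega x.
Proof.
have mB := measurable_boundary Omega.
exists (~` boundary Omega); split; first exact: measurableC.
  by rewrite /surface/= /mrestr setICl measure0.
by move=> x.
Qed.

(** A function of [H1C] is constrained on the closure only; its extension by 0 is a Borel
    representative on the whole space. *)
Lemma H1C_measurable v : H1C oOmega v -> measurable_fun [set: 'rV[R]_d] (v \_ K).
Proof.
move=> [cv _]; apply: within_continuous_measurable_rV => //.
by apply: closed_measurable_rV; exact: closed_closure.
Qed.

Lemma within_bounded v : {within K, continuous v} ->
  exists2 M, 0 <= M & forall x, `|(v \_ K) x| <= M.
Proof.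
move=> cv; have : compact (v @` K) by apply: continuous_compact compact_closure_domain.
move=> /compact_bounded[M [_ /(_ (`|M| + 1))]].
rewrite (le_lt_trans (ler_norm M)) ?ltrDl// => /(_ isT) vM.
exists (`|M| + 1) => [|x]; first by rewrite addr_ge0.
rewrite patchE; case: ifPn => [/set_mem Kx|_]; last by rewrite normr0 addr_ge0.
by apply: vM; exists x.
Qed.

Lemma H1C_bounded v : H1C oOmega v -> exists2 M, 0 <= M & forall x, `|(v \_ K) x| <= M.
Proof. by move=> [/within_bounded]. Qed.

Lemma surface_bounded_Lfun2 (F : 'rV[R]_d -> R) (M : R) :
  measurable_fun [set: _] F -> (forall x, `|F x| <= M) -> F \in Lfun surf 2%:E.
Proof. by move=> mF FM; exact: (finite_bounded_Lfun2 surface_finite mF FM). Qed.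

Lemma on_boundaryE v : ob v = ob (v \_ K).
Proof.
apply: L2class_eq; move: surface_ae_boundary; apply: filterS => x /boundary_sub Kx _.
by rewrite patchE mem_set.
Qed.

Lemma on_domainE v : od v = od (v \_ K).
Proof.
apply: L2class_eq; move: (volume_ae_Omega oOmega); apply: filterS => x Ox _.
by rewrite patchE mem_set//; exact: subset_closure.
Qed.

Lemma H1C_surface_Lfun2 v : H1C oOmega v -> (v \_ K) \in Lfun surf 2%:E.
Proof.
move=> Hv; have [M _ vM] := H1C_bounded Hv.
exact: (surface_bounded_Lfun2 (H1C_measurable Hv) vM).
Qed.

Lemma H1C_volume_Lfun2 v : H1C oOmega v -> (v \_ K) \in Lfun vol 2%:E.
Proof.
move=> Hv; have [M _ vM] := H1C_bounded Hv.
exact: (bounded_Lfun2 oOmega bOmega (H1C_measurable Hv) vM).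
Qed.

Lemma on_boundary_ae v : H1C oOmega v -> ob v = v \_ K %[ae surf].
Proof. by move=> Hv; rewrite on_boundaryE; exact/L2class_ae/H1C_surface_Lfun2. Qed.

Lemma on_domain_ae v : H1C oOmega v -> od v = v \_ K %[ae vol].
Proof. by move=> Hv; rewrite on_domainE; exact/L2class_ae/H1C_volume_Lfun2. Qed.

Lemma H1C_H1 v : H1C oOmega v -> H1 oOmega (od v).
Proof. by move=> [_ [u Hu /L2classE uv]]; rewrite /on_domain uv. Qed.

Lemma patchD v w : (v + w) \_ K = (fun x => (v \_ K) x + (w \_ K) x).
Proof. by apply/funext => x; rewrite !patchE; case: ifPn => // _; rewrite addr0. Qed.

Lemma patchZ (k : R) v : (k *: v) \_ K = (fun x => k * (v \_ K) x).
Proof. by apply/funext => x; rewrite !patchE; case: ifPn => // _; rewrite mulr0. Qed.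

Lemma on_boundaryD v w : H1C oOmega v -> H1C oOmega w -> ob (v + w) = ob v + ob w.
Proof.
move=> /H1C_surface_Lfun2 vL /H1C_surface_Lfun2 wL.
by rewrite on_boundaryE patchD [ob v]on_boundaryE [ob w]on_boundaryE; exact: L2classD.
Qed.

Lemma on_boundaryZ (k : R) v : H1C oOmega v -> ob (k *: v) = k *: ob v.
Proof.
move=> /H1C_surface_Lfun2 vL.
by rewrite on_boundaryE patchZ [ob v]on_boundaryE; exact: L2classZ.
Qed.

Lemma on_domainD v w : H1C oOmega v -> H1C oOmega w -> od (v + w) = od v + od w.
Proof.
move=> /H1C_volume_Lfun2 vL /H1C_volume_Lfun2 wL.
by rewrite on_domainE patchD [od v]on_domainE [od w]on_domainE; exact: L2classD.
Qed.

Lemma on_domainZ (k : R) v : H1C oOmega v -> od (k *: v) = k *: od v.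
Proof.
move=> /H1C_volume_Lfun2 vL.
by rewrite on_domainE patchZ [od v]on_domainE; exact: L2classZ.
Qed.

Lemma H1CP v : {within K, continuous v} -> H1 oOmega (od v) -> H1C oOmega v.
Proof.
move=> cv Hv; split=> //; exists (od v) => //.
have [M _ vM] := within_bounded cv.
have mv : measurable_fun [set: 'rV[R]_d] (v \_ K).
  apply: within_continuous_measurable_rV => //.
  by apply: closed_measurable_rV; exact: closed_closure.
have vL := bounded_Lfun2 oOmega bOmega mv vM.
rewrite on_domainE; have := L2class_ae vL; have := volume_ae_Omega oOmega.
apply: filterS2 => x Ox + _ => /(_ I) -> .
by rewrite patchE mem_set//; exact: subset_closure.
Qed.

Lemma H1CD v w : H1C oOmega v -> H1C oOmega w -> H1C oOmega (v + w).
Proof.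
move=> Hv Hw; apply: H1CP.
  by move: Hv Hw => [cv _] [cw _] x; apply: continuousD; [exact: cv|exact: cw].
by rewrite on_domainD//; apply: H1D => //; exact: H1C_H1.
Qed.

Lemma H1CZ (k : R) v : H1C oOmega v -> H1C oOmega (k *: v).
Proof.
move=> Hv; apply: H1CP.
  by move: Hv => [cv _] x; apply: continuousZr; exact: cv.
by rewrite on_domainZ//; apply: H1Z => //; exact: H1C_H1.
Qed.

Lemma H1CN v : H1C oOmega v -> H1C oOmega (- v).
Proof. by rewrite -scaleN1r; exact: H1CZ. Qed.

Lemma H1CB v w : H1C oOmega v -> H1C oOmega w -> H1C oOmega (v - w).
Proof. by move=> Hv Hw; apply: H1CD => //; exact: H1CN. Qed.

Lemma on_domainB v w : H1C oOmega v -> H1C oOmega w -> od (v - w) = od v - od w.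
Proof.
move=> Hv Hw; rewrite on_domainD ?H1CN//; last exact: H1CN.
by rewrite -scaleN1r on_domainZ// scaleN1r.
Qed.

Lemma on_boundaryB v w : H1C oOmega v -> H1C oOmega w -> ob (v - w) = ob v - ob w.
Proof.
move=> Hv Hw; rewrite on_boundaryD//; last exact: H1CN.
by rewrite -scaleN1r on_boundaryZ// scaleN1r.
Qed.

Lemma test_H1C f : test_function Omega f -> H1C oOmega f /\ ob f = 0.
Proof.
move=> tf; split.
  apply: H1CP; last exact: test_H1.
  by apply: continuous_subspaceT => x; apply: smooth_continuous; exact: test_function_smooth tf.
have [C [_ CO f0]] := test_function_supp tf.
transitivity (ob (0 : 'rV[R]_d -> R)).
  apply: L2class_eq; move: surface_ae_boundary; apply: filterS => x Bx _.
  by rewrite f0// => /CO Ox; move: Bx; rewrite boundaryE => -[].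
have -> : ob 0 = ob (fun x => 0 * (0 : LspaceType2 surf) x).
  by congr on_boundary; apply/funext => x; rewrite mul0r.
by rewrite /on_boundary L2classZ ?scale0r//; exact: Lspace2_Lfun.
Qed.

Lemma H1C0 : H1C oOmega 0.
Proof. by have [] := test_H1C (test_function0 Omega). Qed.

Lemma on_domain0 : od 0 = 0.
Proof. by rewrite -(scale0r 0) on_domainZ ?scale0r//; exact: H1C0. Qed.

Lemma H1CM U h v : test_function U h -> H1C oOmega v -> H1C oOmega (fun x => h x * v x).
Proof.
move=> th Hv; have sh := test_function_smooth th; apply: H1CP.
  have ch : {within K, continuous (h : 'rV[R]_d -> R)}.
    by apply: continuous_subspaceT => y; exact: smooth_continuous.
  by move: Hv => [cv _] x; exact: (continuousM (ch x) (cv x)).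
have -> : od (fun x => h x * v x) = od (fun x => h x * od v x).
  apply: L2class_eq; have := on_domain_ae Hv; have := volume_ae_Omega oOmega.
  apply: filterS2 => x Ox /(_ I) -> _.
  by rewrite patchE mem_set//; exact: subset_closure.
move=> i; have [g Hg] := H1C_H1 Hv i.
have W := is_weak_deriv_mul bOmega th Hg.
by eexists; exact: W.
Qed.

Lemma on_boundaryM U h v : test_function U h -> H1C oOmega v ->
  ob (fun x => h x * v x) = ob (fun x => h x * ob v x).
Proof.
move=> th Hv; apply: L2class_eq.
have := on_boundary_ae Hv; have := surface_ae_boundary.
apply: filterS2 => x /boundary_sub Kx /(_ I) -> _.
by rewrite patchE mem_set.
Qed.

Lemma on_domainM U h v : test_function U h -> H1C oOmega v ->
  od (fun x => h x * v x) = od (fun x => h x * od v x).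
Proof.
move=> th Hv; apply: L2class_eq; have := on_domain_ae Hv; have := volume_ae_Omega oOmega.
apply: filterS2 => x Ox /(_ I) -> _.
by rewrite patchE mem_set//; exact: subset_closure.
Qed.

Lemma on_boundary_norm v : H1C oOmega v ->
  `|ob v| ^+ 2 = \int[surf]_x (v \_ K) x ^+ 2.
Proof. by move=> Hv; rewrite on_boundaryE L2norm_class//; exact: H1C_surface_Lfun2. Qed.

End boundary_values.

(** * The Maz'ya inequality *)

Section integrable_EFin.
Context {dT} {T : measurableType dT} {R : realType}.
Variable mu : {measure set T -> \bar R}.
Implicit Types f : T -> R.

Lemma integrable_EFinZ (c : R) f : mu.-integrable [set: T] (EFin \o f) ->
  mu.-integrable [set: T] (EFin \o (fun x => c * f x)).
Proof.
move=> fi; have -> : EFin \o (fun x => c * f x) = (fun x => c%:E * (EFin \o f) x)%E.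
  by apply/funext => x /=; rewrite EFinM.
exact: integrableZl.
Qed.

Lemma integrable_EFinD f1 f2 : mu.-integrable [set: T] (EFin \o f1) ->
  mu.-integrable [set: T] (EFin \o f2) ->
  mu.-integrable [set: T] (EFin \o (fun x => f1 x + f2 x)).
Proof.
move=> i1 i2; have -> : EFin \o (fun x => f1 x + f2 x) = ((EFin \o f1) \+ (EFin \o f2))%E.
  by apply/funext => x /=; rewrite EFinD.
exact: integrableD.
Qed.

End integrable_EFin.

(** * Lipschitz cutoffs vanishing on finitely many balls *)

Section cutoff.
Context {R : realType} {d : nat}.
Implicit Types (x y : 'rV[R]_d) (p : 'rV[R]_d * R) (s : seq ('rV[R]_d * R)).

(** For p = (c, r): 0 on the ball of radius r around c, 1 off the ball of radius 2 r, Lipschitz with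
    constant 1/r. *)
Definition cut1 p x : R := Num.min 1 (Num.max 0 (`|x - p.1| / p.2 - 1)).
Definition cutoff s x : R := \prod_(p <- s) cut1 p x.

Lemma clamp_lip (a b : R) :
  `|Num.min 1 (Num.max 0 a) - Num.min 1 (Num.max 0 b)| <= `|a - b|.
Proof.
wlog ab : a b / a <= b => [H|].
  have [/H//|/ltW/H] := leP a b.
  by rewrite distrC [leRHS]distrC.
rewrite [leRHS]distrC (@ger0_norm _ (b - a)) ?subr_ge0// ler_norml.
by rewrite /Num.min /Num.max; repeat case: ifPn; rewrite -?leNgt; lra.
Qed.

Lemma cut1_ge0 p x : 0 <= cut1 p x.
Proof. by rewrite /cut1 le_min ler01 le_max lexx. Qed.

Lemma cut1_le1 p x : cut1 p x <= 1.
Proof. by rewrite /cut1 ge_min lexx. Qed.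

Lemma cut1_eq0 p x : 0 < p.2 -> `|x - p.1| <= p.2 -> cut1 p x = 0.
Proof.
move=> p0 xp; rewrite /cut1 (max_idPl _); first by rewrite (min_idPr _)// ler01.
by rewrite subr_le0 ler_pdivrMr// mul1r.
Qed.

Lemma cut1_eq1 p x : 0 < p.2 -> 2 * p.2 <= `|x - p.1| -> cut1 p x = 1.
Proof.
move=> p0 xp; rewrite /cut1 (min_idPl _)// le_max; apply/orP; right.
by rewrite lerBrDr ler_pdivlMr//; lra.
Qed.

Lemma cut1_lip p x y : 0 < p.2 -> `|cut1 p x - cut1 p y| <= `|x - y| / p.2.
Proof.
move=> p0; rewrite (le_trans (clamp_lip _ _))// opprB addrA subrK -mulrBl.
rewrite normrM (@gtr0_norm _ p.2^-1) ?invr_gt0// ler_wpM2r ?invr_ge0 ?(ltW p0)//.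
by rewrite (le_trans (ler_dist_dist _ _))// opprB addrA subrK.
Qed.

Lemma cutoff_ge0 s x : 0 <= cutoff s x.
Proof. by rewrite prodr_ge0// => p _; exact: cut1_ge0. Qed.

Lemma cutoff_le1 s x : cutoff s x <= 1.
Proof. by apply: prodr_ile1 => p _; rewrite cut1_ge0 cut1_le1. Qed.

Lemma cutoff_eq0 s p x : p \in s -> 0 < p.2 -> `|x - p.1| <= p.2 -> cutoff s x = 0.
Proof.
move=> ps p0 xp; apply/eqP; rewrite prodf_seq_eq0; apply/hasP; exists p => //=.
by rewrite cut1_eq0.
Qed.

Lemma cutoff_eq1 s x : (forall p, p \in s -> 0 < p.2 /\ 2 * p.2 <= `|x - p.1|) ->
  cutoff s x = 1.
Proof.
by move=> sx; rewrite /cutoff big_seq big1// => p /sx[p0 xp]; exact: cut1_eq1.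
Qed.

(** Telescoping over the factors, all of which lie in [0, 1]. *)
Lemma cutoff_dist s x y :
  `|cutoff s x - cutoff s y| <= \sum_(p <- s) `|cut1 p x - cut1 p y|.
Proof.
rewrite /cutoff; elim: s => [|p s ih]; first by rewrite !big_nil subrr normr0.
rewrite !big_cons.
set a := cut1 p x; set b := cut1 p y; set P := \prod_(_ <- _) _; set Q := \prod_(_ <- _) _.
have -> : a * P - b * Q = (a - b) * P + b * (P - Q) by ring.
rewrite (le_trans (ler_normD _ _))// !normrM lerD//.
  by rewrite ler_piMr// ger0_norm ?cutoff_ge0// cutoff_le1.
by rewrite (le_trans _ ih)// ler_piMl// ger0_norm ?cut1_ge0// cut1_le1.
Qed.

Lemma measurable_cutoff s : measurable_fun [set: 'rV[R]_d] (cutoff s).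
Proof.
have mcut p : measurable_fun [set: 'rV[R]_d] (cut1 p).
  have mn : measurable_fun [set: 'rV[R]_d] (fun x => `|x - p.1|).
    have mnorm : measurable_fun [set: 'rV[R]_d] (fun x => `|x|).
      by apply: continuous_measurable_rV; exact: norm_continuous.
    exact: (measurableT_comp mnorm (measurable_translation_rV (- p.1))).
  apply: measurable_minr => //; apply: measurable_maxr => //.
  by apply: measurable_funB => //; apply: measurable_funM.
rewrite /cutoff; elim: s => [|p s ih].
  by under eq_fun do rewrite big_nil; exact: measurable_cst.
by under eq_fun do rewrite big_cons; exact: measurable_funM.
Qed.

End cutoff.

(** * The estimate for a function cut off near the boundary *)

Section friedrichs.
Context {R : realType} {d : nat}.
Variable Omega : set 'rV[R]_d.
Hypotheses (oOmega : open Omega) (bOmega : bounded_set Omega).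
Local Notation vol := (volume oOmega).
Local Notation leb := (lebesgue_rV d).
Local Notation K := (closure Omega).

Lemma norm_scale_delta (j : 'I_d) (t : R) : 0 <= t ->
  `|t *: (delta_mx ord0 j : 'rV[R]_d)| <= t.
Proof.
move=> t0; apply/ler_addgt0Pr => e e0; apply: ltW.
have te : 0 < t + e by rewrite ltr_wpDl.
suff : ball (0 : 'rV[R]_d) (t + e) (t *: delta_mx ord0 j).
  by rewrite normed_ballE sub0r normrN.
apply/(ball_rVP _ _ te) => k; rewrite !mxE sub0r normrN normrM (ger0_norm t0).
rewrite (@le_lt_trans _ _ t) ?ltrDl// ler_piMr//.
by case: (_ && _); rewrite ?normr1 ?normr0.
Qed.

Lemma compact_subset_radius (C U : set 'rV[R]_d) : compact C -> open U -> C `<=` U ->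
  exists2 r : R, 0 < r & forall x, C x -> ball x r `<=` U.
Proof.
move=> /compact_near_coveringP cC oU CU.
have [] := cC nat \oo (fun N x => ball x (N.+1%:R^-1) `<=` U) _.
  move=> x /CU Ux; have /nbhs_ballP[e /= e0 eU] := open_nbhs_nbhs (conj oU Ux).
  have e20 : 0 < e / 2 by rewrite divr_gt0.
  exists (ball x (e / 2), [set N | N.+1%:R^-1 < e / 2]).
    by split=> /=; [exact: nbhsx_ballx|exact: near_infty_natSinv_lt (PosNum e20)].
  move=> [y N] /= [xy Ne] z yz; apply: eU; rewrite [e]splitr.
  by apply: ball_triangle xy _; apply: le_ball yz; exact: ltW.
move=> N _ /(_ N (leqnn N)) CN; exists N.+1%:R^-1; first by rewrite invr_gt0.
by move=> x /CN.
Qed.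

Lemma step_exists (s : seq ('rV[R]_d * R)) (r : R) : 0 < r ->
  (forall p, p \in s -> 0 < p.2) ->
  exists2 h : R, 0 < h < r & forall p, p \in s -> h <= p.2.
Proof.
move=> r0; elim: s => [_|p s ih sp].
  by exists (r / 2) => //; apply/andP; split; lra.
have [|h /andP[h0 hr] hs] := ih; first by move=> q qs; apply: sp; rewrite inE qs orbT.
have p0 : 0 < p.2 by apply: sp; rewrite inE eqxx.
exists (Num.min h p.2); first by rewrite lt_min h0 p0 gt_min hr.
move=> q; rewrite inE => /predU1P[->|/hs hq]; first by rewrite ge_min lexx orbT.
by rewrite ge_min hq.
Qed.

Lemma integral_ball_sum (s : seq ('rV[R]_d * R)) (c : 'rV[R]_d * R -> R) (k : R) :
  0 < k -> (forall p, p \in s -> 0 < p.2) ->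
  leb.-integrable [set: _] (EFin \o (fun x => \sum_(p <- s) c p * \1_(ball p.1 (k * p.2)) x)) /\
  \int[leb]_x (\sum_(p <- s) c p * \1_(ball p.1 (k * p.2)) x) =
    \sum_(p <- s) c p * (2 * (k * p.2)) ^+ d.
Proof.
move=> k0; elim: s => [_|p s ih sp].
  under eq_fun do rewrite big_nil; rewrite big_nil; split.
    exact: integrable0.
  by rewrite /Rintegral integral0.
have [|iSs Is] := ih; first by move=> q qs; apply: sp; rewrite inE qs orbT.
have p0 : 0 < p.2 by apply: sp; rewrite inE eqxx.
have kp0 : 0 < k * p.2 by rewrite mulr_gt0.
have mB : measurable (ball p.1 (k * p.2)) by apply: open_measurable_rV; exact: ball_open.
have iB : leb.-integrable [set: _] (EFin \o (fun x => \1_(ball p.1 (k * p.2)) x : R)).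
  apply: (bounded_supp_integrable (M := 1) (r := `|p.1| + k * p.2)).
  - exact: measurable_indic.
  - by move=> x; rewrite indicE; case: (_ \in _); rewrite ?normr1 ?normr0.
  - move=> x nx; rewrite indicE memNset// normed_ballE => px; apply: nx.
    rewrite normed_ballE sub0r normrN (_ : x = p.1 - (p.1 - x)); last by rewrite subKr.
    by rewrite (le_lt_trans (ler_normB _ _))// ltrD2l.
have iB' := integrable_EFinZ (c p) iB.
split.
  under eq_fun do rewrite big_cons.
  exact: (integrable_EFinD iB' iSs).
under eq_Rintegral do rewrite big_cons.
rewrite RintegralD// Is big_cons; congr (_ + _).
rewrite RintegralZl//; congr (_ * _).
transitivity (fine ((2 * (k * p.2)) ^+ d)%:E) => //.
rewrite /Rintegral integral_indic// setIT; congr fine; exact: lebesgue_rV_ball.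
Qed.

Variables (i : 'I_d) (L M : R) (F : 'rV[R]_d -> R) (g : LspaceType2 vol).
Hypotheses (L0 : 0 < L) (OL : Omega `<=` ball 0 L).
Hypotheses (mF : measurable_fun [set: 'rV[R]_d] F) (FM : forall x, `|F x| <= M)
  (F0 : forall x, ~ Omega x -> F x = 0) (Fg : is_weak_deriv i (on_domain oOmega F) g).
Variables (s : seq ('rV[R]_d * R)) (m : 'rV[R]_d * R -> R).
Hypotheses (s0 : forall p, p \in s -> 0 < p.2)
  (sB : forall x, boundary Omega x -> exists2 p, p \in s & ball p.1 p.2 x)
  (sm : forall p x, p \in s -> ball p.1 (3 * p.2) x -> F x ^+ 2 <= m p).

(* With u := F * cutoff s, integrating x_i (u(x)^2 - u(x + h e_i)^2) over R^d
   gives h * int u^2 by translation invariance. *)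
Lemma cutoff_friedrichs :
  2^-1 * \int[leb]_x (F x * cutoff s x) ^+ 2 <= 2 * (L + 1) ^+ 2 * `|g| ^+ 2 +
    2 * (L + 1) * \sum_(p <- s) m p / p.2 * (2 * (3 * p.2)) ^+ d.
Proof.
pose u x := F x * cutoff s x.
(* A compact set outside of which [u] is 0. It lies in [Omega] because the balls cover the
   boundary. *)
pose C := K `&` ~` (\bigcup_(p in [set p | p \in s]) ball p.1 p.2).
have cC : compact C.
  apply: (subclosed_compact _ (compact_closure_domain bOmega)).
    apply: closedI; first exact: closed_closure.
    by rewrite closedC; apply: bigcup_open => p _; exact: ball_open.
  by move=> x [].
have CO : C `<=` Omega.
  move=> x [Kx nx]; apply: contrapT => nOx; apply: nx.
  by have [|p ps xp] := sB (x := x); [rewrite boundaryE//; split|exists p].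
have uC x : u x != 0 -> C x.
  rewrite /u mulf_eq0 negb_or => /andP[Fx cx]; split.
    by apply: subset_closure; apply: contrapT => /F0 F0x; rewrite F0x eqxx in Fx.
  move=> [p /= ps]; rewrite normed_ballE => xp; move/eqP: cx; apply.
  by apply: cutoff_eq0 ps (s0 ps) _; rewrite distrC ltW.
have uO x : ~ Omega x -> u x = 0.
  by move=> nOx; apply/eqP; apply: contrapT => /negP/uC/CO.
have m0 p : p \in s -> 0 <= m p.
  move=> ps; apply: le_trans (sm (x := p.1) ps _); first exact: sqr_ge0.
  by rewrite normed_ballE subrr normr0 mulr_gt0// s0.
have [rho rho0 rhoO] := compact_subset_radius cC oOmega CO.
(* The step [h] will be below rho / 2, to stay in [Omega] when leaving the rho / 2 neighbourhood of
   [C]; below 1, so that L + 1 bounds the coordinates after translation; and at most every radius,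
   so that translation changes a cutoff only near its ball. *)
have rho20 : 0 < Num.min (rho / 2) 1 by rewrite lt_min ltr01 divr_gt0.
have [h /andP[h0]] := step_exists rho20 s0.
rewrite lt_min => /andP[hrho h1] hs.
pose e : 'rV[R]_d := delta_mx ord0 i.
have he : `|h *: e| <= h by exact/norm_scale_delta/ltW.
pose U := \bigcup_(y in C) ball y (rho / 2).
have oU : open U by apply: bigcup_open => y _; exact: ball_open.
have UO x : U x -> forall t, 0 <= t <= h -> Omega (x + t *: e).
  move=> [y Cy]; rewrite normed_ballE => yx t /andP[t0 th].
  apply: (rhoO y Cy); rewrite normed_ballE opprD addrA.
  rewrite (le_lt_trans (ler_normB _ _))// [rho]splitr ltrD//.
  by rewrite (le_lt_trans (norm_scale_delta i t0))// (le_lt_trans th).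
have DU := difference_quotient_bound bOmega oU h0 UO mF FM F0 Fg.
pose D (x : 'rV[R]_d) : R := F (x + h *: e) - F x.
pose Q : 'rV[R]_d -> R := (fun x => D x ^+ 2) \_ U.
pose L1 := L + 1.
(* With u_h the translate, u^2 - u_h^2 = - (u_h - u)(u_h + u). The part of u_h - u containing the
   increment of [F] is treated by Young's inequality with weight h / 4, which uses up half of h
   times the integral of u^2 and explains the factor 1/2 in the statement. The part containing the
   increment of the cutoff goes into the sum over the balls. *)
have pt (x : 'rV[R]_d) : x ord0 i * u x ^+ 2 - x ord0 i * u (x + h *: e) ^+ 2 <=
   2 * L1 ^+ 2 / h * Q x +
   (h / 4 * (u (x + h *: e) ^+ 2 + u x ^+ 2) +
   h * L1 * \sum_(p <- s) (2 * m p / p.2) * \1_(ball p.1 (3 * p.2)) x).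
  set xh := x + h *: e.
  have sum0 : 0 <= \sum_(p <- s) (2 * m p / p.2) * \1_(ball p.1 (3 * p.2)) x.
    rewrite big_seq sumr_ge0// => p ps; rewrite mulr_ge0 ?indicE//.
    by rewrite divr_ge0 ?(ltW (s0 ps))// mulr_ge0// m0.
  have L10 : 0 < L1 by rewrite addr_gt0.
  have [[ux0 uxh0]|nu] := pselect (u x = 0 /\ u xh = 0).
    rewrite ux0 uxh0 expr0n/= !mulr0 subrr addr0 mulr0 add0r addr_ge0//.
      rewrite mulr_ge0//; first by rewrite divr_ge0 ?(ltW h0)// mulr_ge0// sqr_ge0.
      by rewrite /Q patchE; case: ifPn => // _; exact: sqr_ge0.
    by rewrite mulr_ge0// mulr_ge0 ?(ltW h0)// ltW.
  have CC : C x \/ C xh.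
    have [/eqP ux0|/uC] := boolP (u x == 0); last by left.
    by right; apply: uC; apply/eqP => uxh0; exact: nu.
  have Ux : U x.
    case: CC => Cy; [exists x => //|exists xh => //]; rewrite normed_ballE.
      by rewrite subrr normr0 divr_gt0.
    by rewrite addrAC subrr add0r (le_lt_trans he).
  have xL1 : `|x ord0 i| <= L1.
    case: CC => /CO/OL/(ball_rVP _ _ L0)/(_ i); rewrite !mxE sub0r normrN.
      by move=> /ltW xL; rewrite (le_trans xL)// lerDl.
    rewrite !eqxx mulr1 => xL; rewrite -[x ord0 i](addrK h) (le_trans (ler_normB _ _))//.
    by rewrite (gtr0_norm h0) lerD// ltW.
  rewrite /Q patchE (mem_set Ux).
  have E : u xh - u x = cutoff s x * D x + F xh * (cutoff s xh - cutoff s x).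
    by rewrite /u /D -/xh; ring.
  have b1 : `|x ord0 i * cutoff s x| <= L1.
    rewrite normrM (le_trans _ xL1)// ler_piMr//.
    by rewrite ger0_norm ?cutoff_ge0// cutoff_le1.
  have b2 : - (x ord0 i * F xh * (cutoff s xh - cutoff s x) * (u xh + u x)) <=
      h * L1 * \sum_(p <- s) (2 * m p / p.2) * \1_(ball p.1 (3 * p.2)) x.
    rewrite (le_trans (ler_norm _))// normrN !normrM -!mulrA mulrCA.
    rewrite (@le_trans _ _ (L1 * (`|F xh| * (`|cutoff s xh - cutoff s x| * `|u xh + u x|))))//.
      by rewrite mulrCA ler_wpM2r// mulr_ge0// mulr_ge0.
    rewrite [leRHS]mulrCA ler_wpM2l ?(ltW L10)//.
    rewrite (@le_trans _ _ (`|F xh| * `|u xh + u x| * \sum_(p <- s) `|cut1 p xh - cut1 p x|))//.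
      rewrite [`|cutoff s xh - _| * _]mulrC mulrA ler_wpM2l ?mulr_ge0//; exact: cutoff_dist.
    rewrite !mulr_sumr big_seq [leRHS]big_seq; apply: ler_sum => p ps.
    have p0 := s0 ps; have mp0 := m0 p ps; have hp := hs p ps.
    have rhs0 : 0 <= h * (2 * m p / p.2 * \1_(ball p.1 (3 * p.2)) x).
      by rewrite mulr_ge0 ?(ltW h0)// mulr_ge0 ?indicE// divr_ge0 ?(ltW p0)// mulr_ge0.
    have [dc0|dc] := eqVneq (cut1 p xh) (cut1 p x).
      by rewrite dc0 subrr normr0 mulr0.
    have hx : `|xh - p.1| <= `|x - p.1| + p.2.
      by rewrite /xh addrAC (le_trans (ler_normD _ _))// lerD2l (le_trans he).
    have hx' : `|x - p.1| <= `|xh - p.1| + p.2.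
      rewrite (_ : x - p.1 = xh - p.1 - h *: e); last by rewrite /xh addrAC addrK.
      by rewrite (le_trans (ler_normB _ _))// lerD2l (le_trans he).
    (* From beyond 3 r, a step of length at most r stays beyond 2 r, so the cutoff is 1 at both
       ends. *)
    have x3 : `|x - p.1| < 3 * p.2.
      rewrite ltNge; apply: contra_neqN dc => x3.
      by rewrite !cut1_eq1//; lra.
    have xh3 : `|xh - p.1| < 3 * p.2.
      rewrite ltNge; apply: contra_neqN dc => xh3.
      by rewrite !cut1_eq1//; lra.
    have Fx2 : F x ^+ 2 <= m p by apply: (sm ps); rewrite normed_ballE distrC.
    have Fxh2 : F xh ^+ 2 <= m p by apply: (sm ps); rewrite normed_ballE distrC.
    rewrite indicE mem_set ?mulr1; last by rewrite normed_ballE distrC.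
    have -> : h * (2 * m p / p.2) = 2 * m p * (h / p.2) by rewrite mulrCA mulrA.
    apply: ler_pM => //.
      have uF y : `|u y| <= `|F y|.
        by rewrite normrM ler_piMr// ger0_norm ?cutoff_ge0// cutoff_le1.
      rewrite (@le_trans _ _ (`|F xh| * (`|F xh| + `|F x|)))//.
        by rewrite ler_wpM2l// (le_trans (ler_normD _ _))// lerD.
      rewrite -[F x ^+ 2]real_normK ?num_real// in Fx2.
      rewrite -[F xh ^+ 2]real_normK ?num_real// in Fxh2.
      move: Fx2 Fxh2; move: (`|F x|) (`|F xh|) (m p) => a b c ac bc.
      by have := sqr_ge0 (a - b); nra.
    rewrite (le_trans (cut1_lip _ _ p0))// ler_wpM2r ?invr_ge0 ?(ltW p0)//.
    by rewrite /xh addrAC subrr add0r.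
  have -> : x ord0 i * u x ^+ 2 - x ord0 i * u xh ^+ 2 =
     - (x ord0 i * cutoff s x * D x * (u xh + u x)) +
     - (x ord0 i * F xh * (cutoff s xh - cutoff s x) * (u xh + u x)).
    have -> : x ord0 i * u x ^+ 2 - x ord0 i * u xh ^+ 2 =
      - (x ord0 i * (u xh - u x) * (u xh + u x)) by ring.
    by rewrite E; ring.
  rewrite addrA lerD//.
  have : (x ord0 i * cutoff s x) ^+ 2 <= L1 ^+ 2.
    by rewrite -[leLHS]real_normK ?num_real// lerXn2r// nnegrE// ltW.
  move: (x ord0 i * cutoff s x) (D x) (u xh) (u x) => b D' A B bL.
  have hi : 0 < h^-1 by rewrite invr_gt0.
  (* Young's inequality as an identity, with the difference written as a sum of nonnegative
     terms. *)
  have -> : 2 * L1 ^+ 2 / h * D' ^+ 2 + h / 4 * (A ^+ 2 + B ^+ 2) =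
    - (b * D' * (A + B)) + (2 * h^-1 * D' ^+ 2 * (L1 ^+ 2 - b ^+ 2) +
      h^-1 / 8 * (4 * b * D' + h * (A + B)) ^+ 2 + h / 8 * (A - B) ^+ 2).
    by field; rewrite gt_eqF.
  rewrite lerDl addr_ge0 ?addr_ge0//.
  - by rewrite mulr_ge0 ?subr_ge0// mulr_ge0 ?sqr_ge0// mulr_ge0// ltW.
  - by rewrite mulr_ge0 ?sqr_ge0// divr_ge0// ltW.
  - by rewrite mulr_ge0 ?sqr_ge0// divr_ge0// ltW.
have M0 : 0 <= M by apply: le_trans (FM 0).
have uM x : `|u x| <= M.
  by rewrite normrM (le_trans _ (FM x))// ler_piMr// ger0_norm ?cutoff_ge0// cutoff_le1.
have u2M x : `|u x ^+ 2| <= M ^+ 2 by rewrite normrX lerXn2r// nnegrE.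
have mu : measurable_fun [set: 'rV[R]_d] u.
  by apply: measurable_funM => //; exact: measurable_cutoff.
have mh (G : 'rV[R]_d -> R) : measurable_fun [set: 'rV[R]_d] G ->
    measurable_fun [set: 'rV[R]_d] (fun x => G (x + h *: e)).
  by move=> mG; exact: (measurableT_comp mG (measurable_translation_rV _)).
have mx : measurable_fun [set: 'rV[R]_d] (fun x : 'rV[R]_d => x ord0 i) by exact: measurable_coord_rV.
have out0 x : ~ ball (0 : 'rV[R]_d) L1 x -> u x = 0 /\ u (x + h *: e) = 0.
  rewrite normed_ballE sub0r normrN => nx; split; apply: uO => /OL;
    rewrite normed_ballE sub0r normrN => xL; apply: nx.
    by rewrite (lt_trans xL)// ltrDl.
  rewrite (_ : x = x + h *: e - h *: e); last by rewrite addrK.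
  by rewrite (le_lt_trans (ler_normB _ _))// ltr_leD// (le_trans he)// ltW.
have ib (G : 'rV[R]_d -> R) B : measurable_fun [set: 'rV[R]_d] G -> (forall x, `|G x| <= B) ->
    (forall x, u x = 0 -> u (x + h *: e) = 0 -> G x = 0) ->
    leb.-integrable [set: _] (EFin \o G).
  move=> mG GB G0; apply: (bounded_supp_integrable (r := L1) mG GB) => x /out0[].
  exact: G0.
have bx x : u x != 0 \/ u (x + h *: e) != 0 -> `|x ord0 i| <= L1.
  move=> nu; have : ball (0 : 'rV[R]_d) L1 x.
    by apply: contrapT => /out0[u0 uh0]; case: nu; rewrite ?u0 ?uh0 eqxx.
  by move=> /(ball_rVP _ _ (addr_gt0 L0 ltr01))/(_ i); rewrite !mxE sub0r normrN => /ltW.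
have i1 : leb.-integrable [set: _] (EFin \o (fun x : 'rV[R]_d => x ord0 i * u x ^+ 2)).
  apply: (ib _ (L1 * M ^+ 2)).
  - by apply: measurable_funM => //; exact: measurable_funX.
  - move=> x; have [->|ux0] := eqVneq (u x) 0.
      by rewrite expr0n mulr0 normr0 mulr_ge0 ?sqr_ge0// addr_ge0// ltW.
    by rewrite normrM ler_pM// bx//; left.
  - by move=> x -> _; rewrite expr0n mulr0.
have i2 : leb.-integrable [set: _] (EFin \o (fun x : 'rV[R]_d => x ord0 i * u (x + h *: e) ^+ 2)).
  apply: (ib _ (L1 * M ^+ 2)).
  - by apply: measurable_funM => //; apply: measurable_funX; exact: mh.
  - move=> x; have [->|ux0] := eqVneq (u (x + h *: e)) 0.
      by rewrite expr0n mulr0 normr0 mulr_ge0 ?sqr_ge0// addr_ge0// ltW.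
    by rewrite normrM ler_pM// bx//; right.
  - by move=> x _ ->; rewrite expr0n mulr0.
have i3 : leb.-integrable [set: _] (EFin \o (fun x : 'rV[R]_d => u (x + h *: e) ^+ 2)).
  apply: (ib _ (M ^+ 2)) => //; first by apply: measurable_funX; exact: mh.
  by move=> x _ ->; rewrite expr0n.
have i4 : leb.-integrable [set: _] (EFin \o (fun x => u x ^+ 2)).
  apply: (ib _ (M ^+ 2)) => //; first exact: measurable_funX.
  by move=> x -> _; rewrite expr0n.
have mD : measurable_fun [set: 'rV[R]_d] D by apply: measurable_funB => //; exact: mh.
have iQ : leb.-integrable [set: _] (EFin \o Q).
  apply: (bounded_supp_integrable (M := (M + M) ^+ 2) (r := L)).
  - apply/(measurable_restrictT _ _).1; first exact: open_measurable_rV oU.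
    by apply: measurable_funTS; exact: measurable_funX.
  - move=> x; rewrite /Q patchE; case: ifPn => _; last by rewrite normr0 sqr_ge0.
    rewrite normrX lerXn2r ?nnegrE ?addr_ge0// (le_trans (ler_normB _ _))//.
    by rewrite lerD.
  - move=> x nx; rewrite /Q patchE memNset// => Ux; apply: nx; apply: OL.
    by have := UO x Ux 0; rewrite lexx (ltW h0) scale0r addr0; exact.
have [iS IS] := integral_ball_sum (fun p => 2 * m p / p.2) (ltr0Sn R 2) s0.
have IQ : \int[leb]_x Q x <= h ^+ 2 * `|g| ^+ 2.
  by apply: le_trans DU; rewrite [leRHS]Rintegral_mkcond.
set I := \int[leb]_x (F x * cutoff s x) ^+ 2.
have Ih : \int[leb]_x u (x + h *: e) ^+ 2 = I.
  congr fine; apply: (integral_translation (h *: e) (F := fun x => (u x ^+ 2)%:E)).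
  by apply/measurable_EFinP; exact: measurable_funX.
(* The change of variables replaces x_i by x_i - h; this is the source of h times the integral of
   u^2. *)
have I2 : \int[leb]_x (x ord0 i * u (x + h *: e) ^+ 2) =
    \int[leb]_x (x ord0 i * u x ^+ 2) - h * I.
  have -> : \int[leb]_x (x ord0 i * u x ^+ 2) - h * I =
      \int[leb]_x (x ord0 i * u x ^+ 2 - h * u x ^+ 2).
    by rewrite (RintegralB measurableT i1 (integrable_EFinZ h i4)) (RintegralZl h measurableT i4).
  transitivity (\int[leb]_x ((x ord0 i - h) * u x ^+ 2)).
    congr fine; rewrite -[RHS](integral_translation (h *: e)).
      apply: eq_integral => x _; congr (_%:E).
      by rewrite !mxE !eqxx mulr1 addrK.
    apply/measurable_EFinP; apply: measurable_funM; last exact: measurable_funX.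
    exact: measurable_funB.
  by apply: eq_Rintegral => x _; rewrite mulrBl.
pose c1 := 2 * L1 ^+ 2 / h; pose c3 := h * L1.
have j1 := integrable_EFinZ c1 iQ; have j2 := integrable_EFinZ (h / 4) (integrable_EFinD i3 i4).
have j3 := integrable_EFinZ c3 iS; have j4 := integrable_EFinD j2 j3.
have i12 := integrable_EFinD i1 (integrable_EFinZ (-1) i2).
have : \int[leb]_x (x ord0 i * u x ^+ 2 + -1 * (x ord0 i * u (x + h *: e) ^+ 2)) <=
    \int[leb]_x (c1 * Q x + (h / 4 * (u (x + h *: e) ^+ 2 + u x ^+ 2) +
   c3 * \sum_(p <- s) (2 * m p / p.2) * \1_(ball p.1 (3 * p.2)) x)).
  apply: (le_Rintegral measurableT i12 (integrable_EFinD j1 j4)) => x _.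
  by rewrite mulN1r; exact: pt.
rewrite (RintegralD measurableT i1 (integrable_EFinZ (-1) i2)) (RintegralZl _ measurableT i2).
rewrite I2 mulN1r opprB addrCA subrr addr0.
rewrite (RintegralD measurableT j1 j4) (RintegralD measurableT j2 j3).
rewrite (RintegralZl _ measurableT iQ) (RintegralZl _ measurableT (integrable_EFinD i3 i4)).
rewrite (RintegralZl _ measurableT iS) (RintegralD measurableT i3 i4) Ih -[\int[leb]_x u x ^+ 2]/I IS.
have -> : \sum_(p <- s) 2 * m p / p.2 * (2 * (3 * p.2)) ^+ d =
  2 * \sum_(p <- s) m p / p.2 * (2 * (3 * p.2)) ^+ d.
  by rewrite mulr_sumr; apply: eq_bigr => p _; rewrite !mulrA.
rewrite /c1 /c3 -/L1.
move: (\sum_(p <- s) _) (\int[leb]_x Q x) IQ => S q.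
move: {Ih I2} I (`|g| ^+ 2) => J G qg.
have hq : 2 * L1 ^+ 2 / h * q <= 2 * L1 ^+ 2 * h * G.
  have -> : 2 * L1 ^+ 2 * h * G = 2 * L1 ^+ 2 / h * (h ^+ 2 * G).
    by field; rewrite gt_eqF.
  by rewrite ler_wpM2l// divr_ge0 ?(ltW h0)// mulr_ge0 ?sqr_ge0.
move=> H; rewrite -(ler_pM2l h0).
have {}H := le_trans H (lerD hq (lexx _)).
have -> : h * (2^-1 * J) = h * J - h / 4 * (J + J) by field.
rewrite lerBlDr (le_trans H)// le_eqVlt; apply/orP; left; apply/eqP; ring.
Qed.

End friedrichs.

(** * Maz'ya's inequality by letting the balls shrink *)

Section friedrichs_inequality.
Context {R : realType} {d : nat}.
Variable Omega : set 'rV[R]_d.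
Hypotheses (d2 : (2 <= d)%N) (oOmega : open Omega) (bOmega : bounded_set Omega).
Hypothesis sOmega : (hausdorff d.-1 (boundary Omega) < +oo)%E.
Local Notation vol := (volume oOmega).
Local Notation leb := (lebesgue_rV d).
Local Notation K := (closure Omega).

Lemma compact_unif_continuous (A : set 'rV[R]_d) (v : 'rV[R]_d -> R) (e : R) :
  compact A -> {within A, continuous v} -> 0 < e ->
  exists2 r : R, 0 < r & forall x y, A x -> A y -> `|x - y| < r -> `|v x - v y| < e.
Proof.
move=> /compact_near_coveringP/near_covering_withinP cA /subspace_continuousP cv e0.
have e20 : 0 < e / 2 by rewrite divr_gt0.
have [] := cA nat \oo (fun N x => forall y, A y -> `|x - y| < N.+1%:R^-1 -> `|v x - v y| < e) _.
  move=> x Ax; have /cvgrPdist_lt/(_ _ e20) := cv x Ax.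
  rewrite near_withinE => /nbhs_ballP[r /= r0 rv].
  have r20 : 0 < r / 2 by rewrite divr_gt0.
  exists (ball x (r / 2), [set N | N.+1%:R^-1 < r / 2]).
    by split=> /=; [exact: nbhsx_ballx|exact: near_infty_natSinv_lt (PosNum r20)].
  move=> [z N] /= [xz Nr] Az y Ay zy.
  have h1 : `|v x - v z| < e / 2.
    by apply: rv => //; apply: le_ball xz; rewrite ler_pdivrMr// ler_pMr// ler1n.
  have h2 : `|v x - v y| < e / 2.
    apply: rv => //; rewrite [r]splitr; apply: ball_triangle xz _.
    by rewrite normed_ballE (lt_trans zy).
  rewrite (_ : v z - v y = (v x - v y) - (v x - v z)); last by ring.
  by rewrite (le_lt_trans (ler_normB _ _))// [e]splitr ltrD.
move=> N _ /(_ N (leqnn N)) AN; exists N.+1%:R^-1; first by rewrite invr_gt0.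
by move=> x y Ax Ay; exact: AN.
Qed.

(** In [cutoff_friedrichs] a ball of radius r contributes, up to an error, a term of order r^(d-1)
    v(x_k)^2, and [weighted_ball_cover] controls the sum of these. What the cutoff removes lives on
    a volume of order the sum of r^d, at most eps times the sum of r^(d-1). All errors together are
    at most eps times [C3]. *)
Lemma friedrichs_inequality : exists2 C : R, 0 < C &
  forall v, H1C oOmega v -> `|on_domain oOmega v| ^+ 2 <=
    C * (dirichlet (on_domain oOmega v) (on_domain oOmega v) + `|on_boundary Omega v| ^+ 2).
Proof.
pose i : 'I_d := Ordinal (leq_trans (isT : 0 < 2)%N d2).
have n0 : (0 < d.-1)%N by rewrite -ltnS prednK// (leq_trans _ d2).
have dE : d = d.-1.+1 by rewrite prednK// (leq_trans _ d2).
have [C0 C00 HC] := @weighted_ball_cover R d _ n0.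
have [L L0 OL] := bounded_sub_ball bOmega.
pose L1 := L + 1; have L10 : 0 < L1 by rewrite addr_gt0.
(* Twice the constants of [cutoff_friedrichs], whose left side carries the factor 1/2. In [C2] the
   factor 6^d comes from the balls of triple radius, and another 2 from the bound 2 v(x_k)^2 + 2
   eps^2 on v^2 near x_k. *)
pose C1 : R := 4 * L1 ^+ 2; pose C2 : R := 8 * L1 * 6 ^+ d * C0.
have C10 : 0 < C1 by rewrite mulr_gt0// exprn_gt0.
have C20 : 0 < C2 by rewrite !mulr_gt0// exprn_gt0.
exists (C1 + C2) => [|v Hv]; first exact: addr_gt0.
pose w := v \_ K; have mw := H1C_measurable Hv; have [M M0 wM] := H1C_bounded bOmega Hv.
have mO : measurable Omega by exact: open_measurable_rV.
(* Restricted to [Omega] itself: [w] may be nonzero on the boundary, where the zero extension has to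
   vanish. *)
pose F x := w x * \1_Omega x.
have FE x : Omega x -> F x = v x.
  by move=> Ox; rewrite /F /w patchE indicE !mem_set ?mulr1//; exact: subset_closure.
have F0 x : ~ Omega x -> F x = 0 by move=> nx; rewrite /F indicE memNset ?mulr0.
have mF : measurable_fun [set: 'rV[R]_d] F.
  by apply: measurable_funM => //; exact: measurable_indic.
have FM x : `|F x| <= M.
  rewrite normrM (le_trans _ (wM x))// ler_piMr// indicE.
  by case: (_ \in _); rewrite ?normr1 ?normr0.
have odF : on_domain oOmega v = on_domain oOmega F.
  apply: L2class_eq; have := volume_ae_Omega oOmega.
  by apply: filterS => x Ox _; rewrite FE.
have HF := H1C_H1 Hv; have := weak_derivP bOmega i HF.
have gd := weak_deriv_le_dirichlet i (on_domain oOmega v).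
set g := weak_deriv i _ in gd *; rewrite {1}odF => Fg.
set W := `|on_boundary Omega v| ^+ 2.
have WE : W = \int[surface Omega]_x (w x ^+ 2).
  exact: on_boundary_norm.
have W0 : 0 <= W by exact: sqr_ge0.
set Df := dirichlet _ _ in gd *.
pose IF := \int[leb]_x (F x ^+ 2).
have -> : `|on_domain oOmega v| ^+ 2 = IF.
  rewrite odF L2norm_class; last exact: (bounded_Lfun2 oOmega bOmega mF FM).
  by rewrite volume_Rintegral//; [exact: measurable_funX|move=> x /F0 ->; rewrite expr0n].
set sg := fine (hausdorff d.-1 (boundary Omega)).
have sg0 : 0 <= sg by exact: fine_ge0.
pose C3 := C2 + C2 * (sg + 1) + M ^+ 2 * 4 ^+ d * C0 * (sg + 1).
have C30 : 0 < C3.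
  rewrite ltr_pwDl ?ltr_pwDl//; first by rewrite mulr_ge0 ?(ltW C20)// addr_ge0.
  by rewrite mulr_ge0 ?addr_ge0// mulr_ge0 ?(ltW C00)// mulr_ge0 ?exprn_ge0.
apply/ler_addgt0Pr => eta eta0.
suff key (eps : R) : 0 < eps -> eps <= 1 -> IF <= C1 * `|g| ^+ 2 + C2 * W + eps * C3.
  pose eps := Num.min 1 (eta / C3).
  have eps0 : 0 < eps by rewrite lt_min ltr01 divr_gt0.
  have eps1 : eps <= 1 by rewrite ge_min lexx.
  have epsC : eps * C3 <= eta by rewrite -ler_pdivlMr// ge_min lexx orbT.
  have g1 : C1 * `|g| ^+ 2 <= C1 * Df by rewrite ler_wpM2l// ltW.
  have D0 : 0 <= Df by exact: dirichlet_ge0.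
  have g2 : 0 <= C2 * Df by rewrite mulr_ge0// ltW.
  have g3 : 0 <= C1 * W by rewrite mulr_ge0// ltW.
  rewrite (le_trans (key eps eps0 eps1))// lerD// mulrDl !mulrDr.
  move: (C1 * `|g| ^+ 2) (C1 * Df) (C2 * Df) (C1 * W) (C2 * W) g1 g2 g3.
  by move=> *; lra.
move=> eps0 eps1.
have cK := compact_closure_domain bOmega.
have [r r0 rv] := compact_unif_continuous cK (proj1 Hv) eps0.
(* At most a third of the modulus [r], so that v varies by less than eps on the balls of triple
   radius; at most eps, to bound the d-th power of a radius by eps times its (d-1)-th power. *)
pose delta := Num.min (r / 3) eps.
have delta0 : 0 < delta by rewrite lt_min eps0 divr_gt0.
have w2M x : 0 <= w x ^+ 2 <= M ^+ 2.
  by rewrite sqr_ge0/= -[w x ^+ 2]real_normK ?num_real// lerXn2r// nnegrE.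
have [s [sd sB sn swn]] := HC _ (measurable_boundary Omega) (fun x => w x ^+ 2)
  (M ^+ 2) delta eps (compact_boundary oOmega bOmega) sOmega (measurable_funX 2 mw)
  w2M delta0 eps0.
have s0 p : p \in s -> 0 < p.2 by move=> /sd[/andP[]].
pose m (p : 'rV[R]_d * R) := 2 * w p.1 ^+ 2 + 2 * eps ^+ 2.
have sm p x : p \in s -> ball p.1 (3 * p.2) x -> F x ^+ 2 <= m p.
  move=> ps; rewrite normed_ballE => px.
  have [Ox|/F0 ->] := pselect (Omega x); last first.
    by rewrite expr0n addr_ge0// mulr_ge0// sqr_ge0.
  have [/andP[p0 pd] /boundary_sub Kp] := sd p ps.
  have Kx := subset_closure Ox.
  have : `|v p.1 - v x| < eps.
    apply: rv => //; rewrite (lt_le_trans px)// mulrC -ler_pdivlMr//.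
    by rewrite (le_trans pd)// ge_min lexx.
  rewrite FE// /m /w patchE mem_set//; move: (v p.1) (v x) => a b.
  rewrite ltr_norml => /andP[h1 h2]; have := sqr_ge0 (2 * a - b); nra.
have CF := cutoff_friedrichs bOmega L0 OL mF FM F0 Fg s0 sB sm.
set I := \int[leb]_x _ in CF.
have S1 : \sum_(p <- s) m p / p.2 * (2 * (3 * p.2)) ^+ d <=
    6 ^+ d * (2 * (C0 * (W + eps)) + 2 * (eps * (C0 * (sg + 1)))).
  have -> : \sum_(p <- s) m p / p.2 * (2 * (3 * p.2)) ^+ d =
     6 ^+ d * (2 * \sum_(p <- s) p.2 ^+ d.-1 * w p.1 ^+ 2 +
       2 * (eps ^+ 2 * \sum_(p <- s) p.2 ^+ d.-1)).
    rewrite !mulr_sumr -big_split/= mulr_sumr big_seq [RHS]big_seq.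
    apply: eq_bigr => p /s0 p0; rewrite /m.
    have -> : (2 * (3 * p.2)) ^+ d = 6 ^+ d * (p.2 * p.2 ^+ d.-1).
      by rewrite -exprS -dE -exprMn mulrA -natrM.
    by field; rewrite gt_eqF.
  rewrite ler_wpM2l ?exprn_ge0// lerD ?ler_wpM2l//; first by rewrite WE.
  apply: ler_pM => //; first exact: sqr_ge0.
  - by rewrite big_seq sumr_ge0// => p /s0 /ltW p0; rewrite exprn_ge0.
  - by rewrite expr2 ler_piMl// ltW.
  - by rewrite (le_trans sn)// ler_wpM2l ?(ltW C00)// lerD2l.
have IFI : IF <= I + M ^+ 2 * (4 ^+ d * (eps * (C0 * (sg + 1)))).
  have [iS IS] := @integral_ball_sum R d s (fun=> M ^+ 2) 2 (ltr0Sn R 1) s0.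
  have iF : leb.-integrable [set: _] (EFin \o (fun x => F x ^+ 2)).
    apply: (bounded_supp_integrable (M := M ^+ 2) (r := L)).
    - exact: measurable_funX.
    - by move=> x; rewrite normrX lerXn2r// nnegrE.
    - by move=> x nx; rewrite F0 ?expr0n// => /OL.
  have iu : leb.-integrable [set: _] (EFin \o (fun x => (F x * cutoff s x) ^+ 2)).
    apply: (bounded_supp_integrable (M := M ^+ 2) (r := L)).
    - by apply: measurable_funX; apply: measurable_funM => //; exact: measurable_cutoff.
    - move=> x; rewrite normrX lerXn2r ?nnegrE// normrM (le_trans _ (FM x))//.
      by rewrite ler_piMr// ger0_norm ?cutoff_ge0// cutoff_le1.
    - by move=> x nx; rewrite F0 ?mul0r ?expr0n// => /OL.
  have pt x : F x ^+ 2 <= (F x * cutoff s x) ^+ 2 +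
      \sum_(p <- s) M ^+ 2 * \1_(ball p.1 (2 * p.2)) x.
    have sum0 (t : seq ('rV[R]_d * R)) :
        0 <= \sum_(p <- t) M ^+ 2 * \1_(ball p.1 (2 * p.2)) x.
      by rewrite sumr_ge0// => p _; rewrite mulr_ge0 ?sqr_ge0// indicE.
    have [[p ps px]|np] := pselect (exists2 p, p \in s & ball p.1 (2 * p.2) x).
      rewrite ler_wpDl ?sqr_ge0// (le_trans (y := M ^+ 2))//.
        by rewrite -[F x ^+ 2]real_normK ?num_real// lerXn2r// nnegrE.
      rewrite (perm_big _ (perm_to_rem ps)) big_cons indicE mem_set// mulr1 lerDl.
      exact: sum0.
    rewrite cutoff_eq1 ?mulr1 ?lerDl// => p ps; split; first exact: s0.
    rewrite leNgt; apply/negP => px; apply: np; exists p => //.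
    by rewrite normed_ballE distrC.
  have := le_Rintegral measurableT iF (integrable_EFinD iu iS) (fun x _ => pt x).
  rewrite (RintegralD measurableT iu iS) IS => /le_trans; apply; rewrite lerD2l.
  rewrite -mulr_sumr ler_wpM2l ?sqr_ge0//.
  rewrite (le_trans (y := 4 ^+ d * (eps * \sum_(p <- s) p.2 ^+ d.-1)))//; last first.
    rewrite ler_wpM2l ?exprn_ge0// ler_wpM2l ?(ltW eps0)// (le_trans sn)//.
    by rewrite ler_wpM2l ?(ltW C00)// lerD2l.
  rewrite !mulr_sumr big_seq [leRHS]big_seq; apply: ler_sum => p ps.
  have [/andP[p0 pd] _] := sd p ps.
  have -> : (2 * (2 * p.2)) ^+ d = 4 ^+ d * (p.2 * p.2 ^+ d.-1).
    by rewrite -exprS -dE -exprMn mulrA -natrM.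
  rewrite ler_wpM2l ?exprn_ge0// ler_wpM2r ?exprn_ge0// ?(ltW p0)//.
  by rewrite (le_trans pd)// ge_min lexx orbT.
rewrite (le_trans IFI)//.
have {}CF := le_trans CF (lerD (lexx _) (ler_wpM2l (mulr_ge0 (ler0n _ 2) (ltW L10)) S1)).
move: CF; rewrite -/L1 /C1 /C2 /C3 /C2; move: (6 ^+ d) (4 ^+ d) (`|g| ^+ 2) (M ^+ 2) {IFI} I.
move=> a b G q J CF.
have -> : 4 * L1 ^+ 2 * G + 8 * L1 * a * C0 * W + eps * (8 * L1 * a * C0 +
    8 * L1 * a * C0 * (sg + 1) + q * b * C0 * (sg + 1)) =
  2 * (2 * L1 ^+ 2 * G + 2 * L1 * (a * (2 * (C0 * (W + eps)) + 2 * (eps * (C0 * (sg + 1)))))) +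
  q * (b * (eps * (C0 * (sg + 1)))) by ring.
by rewrite lerD2r -ler_pdivrMl// mulrC.
Qed.

End friedrichs_inequality.

(** * Traces and the Robin problem *)

Section traces.
Context {R : realType} {d : nat}.
Variable Omega : set 'rV[R]_d.
Hypotheses (d2 : (2 <= d)%N) (oOmega : open Omega) (bOmega : bounded_set Omega).
Hypothesis sOmega : (hausdorff d.-1 (boundary Omega) < +oo)%E.
Local Notation vol := (volume oOmega).
Local Notation surf := (surface Omega).
Local Notation L2O := (LspaceType2 vol).
Local Notation L2G := (LspaceType2 surf).
Local Notation od := (on_domain oOmega).
Local Notation ob := (on_boundary Omega).
Implicit Types (u w : L2O) (phi psi chi x y : L2G) (v : 'rV[R]_d -> R).

Local Opaque Lspace_class Lspace_repr L2class H1norm dirichlet L2dot on_domain on_boundary.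

Lemma ltr_half_add (a b e : R) : a < e / 2 -> b < e / 2 -> a + b < e.
Proof. by move=> ae be; rewrite [e]splitr ltrD. Qed.

Lemma H1normN u : H1 oOmega u -> H1norm oOmega (- u) = H1norm oOmega u.
Proof. by move=> Hu; rewrite -scaleN1r (H1normZ bOmega _ Hu) normrN1 mul1r. Qed.

Lemma H1norm_distrC u w : H1 oOmega u -> H1 oOmega w ->
  H1norm oOmega (u - w) = H1norm oOmega (w - u).
Proof. by move=> Hu Hw; rewrite -H1normN ?opprB//; exact: H1B. Qed.

Lemma H1norm_triangle u w z : H1 oOmega u -> H1 oOmega w -> H1 oOmega z ->
  H1norm oOmega (u - z) <= H1norm oOmega (u - w) + H1norm oOmega (w - z).
Proof.
move=> Hu Hw Hz; have -> : u - z = (u - w) + (w - z) by rewrite addrA subrK.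
by apply: H1normD => //; exact: H1B.
Qed.

Lemma dirichlet_le u w : H1 oOmega u -> H1 oOmega w ->
  `|dirichlet u w| <= H1norm oOmega u * H1norm oOmega w.
Proof.
move=> Hu Hw; have CS := dirichlet_CauchySchwarz bOmega Hu Hw.
have du := dirichlet_le_H1norm u; have dw := dirichlet_le_H1norm w.
have du0 := dirichlet_ge0 u; have dw0 := dirichlet_ge0 w.
have nu := H1norm_ge0 u; have nw := H1norm_ge0 w.
move: (dirichlet u w) (dirichlet u u) (dirichlet w w) (H1norm oOmega u) (H1norm oOmega w)
  CS du dw du0 dw0 nu nw => a b c p q CS du dw du0 dw0 nu nw.
rewrite -(ler_pXn2r (n := 2))// ?nnegrE ?mulr_ge0// real_normK ?num_real//.
by rewrite (le_trans CS)// exprMn ler_pM.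
Qed.

Lemma is_traceP u phi : is_trace oOmega u phi <-> H1 oOmega u /\
  forall e, 0 < e -> exists v, [/\ H1C oOmega v, H1norm oOmega (od v - u) < e &
    `|ob v - phi| < e].
Proof.
split=> [[Hu [v [Hv vu vphi]]]|[Hu H]].
  split=> // e e0.
  have /cvgrPdist_lt/(_ _ e0) A := vu; have /cvgrPdist_lt/(_ _ e0) B := vphi.
  have [N _ /(_ N (leqnn N)) [NA NB]] := filterI A B.
  exists (v N); split; [exact: Hv| |by rewrite distrC].
  by move: NA; rewrite sub0r normrN ger0_norm// H1norm_ge0.
have /choice[v vP] n : exists v, [/\ H1C oOmega v, H1norm oOmega (od v - u) < n.+1%:R^-1 &
    `|ob v - phi| < n.+1%:R^-1] by apply: H; rewrite invr_gt0.
split=> //; exists v; split.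
- by move=> n; case: (vP n).
- apply/cvgrPdist_lt => e e0; have := near_infty_natSinv_lt (PosNum e0).
  apply: filterS => n /= ne; have [_ vn _] := vP n.
  by rewrite sub0r normrN ger0_norm ?H1norm_ge0// (lt_trans vn).
- apply/cvgrPdist_lt => e e0; have := near_infty_natSinv_lt (PosNum e0).
  by apply: filterS => n /= ne; have [_ _ vn] := vP n; rewrite distrC (lt_trans vn).
Qed.

Lemma is_trace_H1 u phi : is_trace oOmega u phi -> H1 oOmega u.
Proof. by case. Qed.

Lemma H1C_trace v : H1C oOmega v -> is_trace oOmega (od v) (ob v).
Proof.
move=> Hv; apply/is_traceP; split=> [|e e0]; first exact: H1C_H1.
have H1v := H1C_H1 Hv.
exists v; split=> //; last by rewrite subrr normr0.
by rewrite subrr -(scale0r (od v)) (H1normZ bOmega _ H1v) normr0 mul0r.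
Qed.

Lemma is_traceD u w phi chi : is_trace oOmega u phi -> is_trace oOmega w chi ->
  is_trace oOmega (u + w) (phi + chi).
Proof.
move=> /is_traceP[Hu Tu] /is_traceP[Hw Tw]; apply/is_traceP; split=> [|e e0].
  exact: H1D.
have e20 : 0 < e / 2 by rewrite divr_gt0.
have [v [Hv vu vphi]] := Tu _ e20; have [v' [Hv' vw vchi]] := Tw _ e20.
have H1v := H1C_H1 Hv; have H1v' := H1C_H1 Hv'.
exists (v + v'); split; first exact: H1CD.
  rewrite (on_domainD bOmega Hv Hv').
  have -> : od v + od v' - (u + w) = (od v - u) + (od v' - w) by rewrite opprD addrACA.
  have T := H1normD bOmega (H1B bOmega H1v Hu) (H1B bOmega H1v' Hw).
  exact: (le_lt_trans T (ltr_half_add vu vw)).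
rewrite (on_boundaryD bOmega sOmega Hv Hv').
have -> : ob v + ob v' - (phi + chi) = (ob v - phi) + (ob v' - chi).
  by rewrite opprD addrACA.
exact: (le_lt_trans (ler_normD _ _) (ltr_half_add vphi vchi)).
Qed.

Lemma is_traceZ (k : R) u phi : is_trace oOmega u phi -> is_trace oOmega (k *: u) (k *: phi).
Proof.
move=> /is_traceP[Hu Tu]; apply/is_traceP; split=> [|e e0]; first exact: H1Z.
have k0 : 0 < `|k| + 1 by rewrite ltr_wpDl.
have ek0 : 0 < e / (`|k| + 1) by rewrite divr_gt0.
have [v [Hv vu vphi]] := Tu _ ek0; have H1v := H1C_H1 Hv.
have ke (t : R) : 0 <= t -> t < e / (`|k| + 1) -> `|k| * t < e.
  move=> t0; rewrite ltr_pdivlMr// mulrDr mulr1 [t * _]mulrC.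
  by apply: le_lt_trans; rewrite lerDl.
exists (k *: v); split; first exact: H1CZ.
  rewrite (on_domainZ bOmega k Hv) -scalerBr (H1normZ bOmega _ (H1B bOmega H1v Hu)).
  by apply: ke vu; exact: H1norm_ge0.
by rewrite (on_boundaryZ bOmega sOmega k Hv) -scalerBr normrZ; exact: ke vphi.
Qed.

Lemma is_traceB u w phi chi : is_trace oOmega u phi -> is_trace oOmega w chi ->
  is_trace oOmega (u - w) (phi - chi).
Proof.
move=> Tu Tw; rewrite -scaleN1r -(scaleN1r chi).
by apply: is_traceD => //; exact: is_traceZ.
Qed.

Lemma is_trace00 : is_trace oOmega 0 0.
Proof. by have := is_traceZ 0 (H1C_trace (H1C0 oOmega bOmega)); rewrite !scale0r. Qed.

(** An identity tested on [H1C] extends to all pairs (w, chi), because the functional is jointly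
    continuous for the H^1 norm of w and the L_2 norm of chi. *)
Lemma trace_functional_eq0 u y : H1 oOmega u ->
  (forall v, H1C oOmega v -> dirichlet u (od v) + L2dot y (ob v) = 0) ->
  forall w chi, is_trace oOmega w chi -> dirichlet u w + L2dot y chi = 0.
Proof.
move=> Hu H w chi /is_traceP[Hw Tw]; apply/eqP; rewrite -normr_le0.
apply/ler_addgt0Pr => e e0; rewrite add0r.
have c0 : 0 < H1norm oOmega u + `|y| + 1.
  by rewrite ltr_wpDl// addr_ge0// H1norm_ge0.
have [v [Hv vw vchi]] := Tw _ (divr_gt0 e0 c0).
have H1v := H1C_H1 Hv.
have E : dirichlet u w + L2dot y chi =
   - (dirichlet u (od v - w) + L2dot y (ob v - chi)).
  rewrite [dirichlet u (od v - w)]dirichletC (dirichletBl bOmega u H1v Hw) L2dotBr.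
  rewrite [dirichlet _ u]dirichletC [dirichlet w u]dirichletC.
  have := H v Hv; move: (dirichlet u (od v)) (dirichlet u w) (L2dot y chi) (L2dot y (ob v)).
  by move=> a b c a' h; rewrite addrACA h add0r opprD !opprK.
rewrite E normrN (le_trans (ler_normD _ _))//.
have h1 := dirichlet_le Hu (H1B bOmega H1v Hw).
have h2 := L2dot_CauchySchwarz y (ob v - chi).
apply: (le_trans (lerD h1 h2)).
have n1 := H1norm_ge0 u; have n2 := H1norm_ge0 (od v - w).
move: vw vchi; rewrite !ltr_pdivlMr//.
move: (H1norm oOmega u) (H1norm oOmega (od v - w)) (`|y|) (`|ob v - chi|)
  n1 n2 (normr_ge0 y) (normr_ge0 (ob v - chi)).
move=> p q a b p0 q0 a0 b0 c1 c2.
have [qb|/ltW bq] := leP q b.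
  by have h : p * q <= p * b by [rewrite ler_wpM2l]; clear -h c2 b0; lra.
by have h : a * b <= a * q by [rewrite ler_wpM2l]; clear -h c1 q0; lra.
Qed.

Lemma form_norm_sqr v : form_norm oOmega v ^+ 2 = dirichlet (od v) (od v) + `|ob v| ^+ 2.
Proof.
rewrite /form_norm sqr_sqrtr; first by rewrite L2dot_norm.
by rewrite addr_ge0 ?L2dot_ge0// dirichlet_ge0.
Qed.

(** The energy is continuous along the functions that define a trace, so estimates for continuous
    functions pass to pairs (u, phi). *)
Lemma energy_limit (e : R) u phi : is_trace oOmega u phi -> 0 < e ->
  exists v, [/\ H1C oOmega v, H1norm oOmega (od v - u) < e, `|ob v - phi| < e &
    form_norm oOmega v ^+ 2 < dirichlet u u + `|phi| ^+ 2 + e].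
Proof.
move=> /is_traceP[Hu Tu] e0; pose c := H1norm oOmega u + `|phi| + 2.
have c0 : 0 < c by rewrite ltr_wpDl// addr_ge0// H1norm_ge0.
have [e' [e'0 e'1 e'e e'c]] : exists e', [/\ 0 < e', e' <= 1, e' <= e & e' * (4 * c) <= e].
  exists (Num.min 1 (Num.min e (e / (4 * c)))).
  rewrite !lt_min ltr01 e0 divr_gt0 ?mulr_gt0// ge_min lexx !ge_min lexx !orbT.
  by split=> //; rewrite -ler_pdivlMr ?mulr_gt0// !ge_min lexx !orbT.
have [v [Hv vu vphi]] := Tu _ e'0; have H1v := H1C_H1 Hv.
exists v; split=> //; [exact: lt_le_trans vu e'e|exact: lt_le_trans vphi e'e|].
rewrite form_norm_sqr.
pose z := od v - u; have Hz : H1 oOmega z by exact: H1B.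
have vz : od v = u + z by rewrite addrC subrK.
have -> : dirichlet (od v) (od v) = dirichlet u u + 2 * dirichlet u z + dirichlet z z.
  rewrite vz (dirichletDl bOmega _ Hu Hz) ![dirichlet _ (u + z)]dirichletC.
  rewrite !(dirichletDl bOmega _ Hu Hz) (dirichletC z u).
  by move: (dirichlet u u) (dirichlet u z) (dirichlet z z) => a b c'; ring.
have zn : `|dirichlet u z| <= H1norm oOmega u * e'.
  apply: (le_trans (dirichlet_le Hu Hz)); apply: ler_wpM2l; first exact: H1norm_ge0.
  exact: ltW vu.
have zz : dirichlet z z <= e'.
  apply: (le_trans (dirichlet_le_H1norm z)).
  have z1 : H1norm oOmega z <= 1 by exact: le_trans (ltW vu) e'1.
  have z2 := ltW vu; have z0 := H1norm_ge0 z; rewrite -/z in z2.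
  move: (H1norm oOmega z) z0 z1 z2 => t t0 t1 t2.
  by rewrite expr2 (le_trans _ t2)// ler_piMl.
have ov : `|ob v| <= `|phi| + e'.
  rewrite -[ob v](subrK phi) addrC (le_trans (ler_normD _ _))// lerD2l.
  exact: ltW.
have {}ov : `|ob v| ^+ 2 <= `|phi| ^+ 2 + 2 * (`|phi| * e') + e'.
  have o0 := normr_ge0 (ob v); have p0 := normr_ge0 phi.
  move: (`|ob v|) (`|phi|) ov o0 p0 => a b ab a0 b0.
  have h1 : a ^+ 2 <= (b + e') ^+ 2 by rewrite lerXn2r// nnegrE addr_ge0// ltW.
  have h2 : e' ^+ 2 <= e' by rewrite expr2 ler_piMl// ltW.
  by apply: (le_trans h1); rewrite sqrrD -(mulr_natl (b * e')) lerD2l.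
have hn := H1norm_ge0 u; have p0 := normr_ge0 phi.
move: zn; rewrite ler_norml => /andP[_ zn].
rewrite /c in e'c c0.
move: (H1norm oOmega u) (dirichlet u z) (dirichlet z z) (dirichlet u u) (`|phi|) (`|ob v| ^+ 2) zn zz ov hn p0 e'c.
move=> A B C D E G zn zz ov A0 E0 e'c.
have h1 : 0 <= A * e' by rewrite mulr_ge0// ltW.
have h2 : 0 <= E * e' by rewrite mulr_ge0// ltW.
by clear -zn zz ov h1 h2 e'c e'0; lra.
Qed.

Lemma form_norm_ge0 v : 0 <= form_norm oOmega v.
Proof. exact: sqrtr_ge0. Qed.

Lemma trace_friedrichs : exists2 C : R, 0 < C & forall u phi, is_trace oOmega u phi ->
  H1norm oOmega u ^+ 2 <= C * (dirichlet u u + `|phi| ^+ 2).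
Proof.
have [C C0 HC] := friedrichs_inequality d2 oOmega bOmega sOmega.
have key v : H1C oOmega v -> H1norm oOmega (od v) ^+ 2 <= (C + 1) * form_norm oOmega v ^+ 2.
  move=> Hv; rewrite form_norm_sqr H1norm_sqr; have := HC v Hv.
  have := dirichlet_ge0 (od v); have := sqr_ge0 `|ob v|.
  move: (`|od v| ^+ 2) (dirichlet (od v) (od v)) (`|ob v| ^+ 2) => a b c c0 b0 h.
  by rewrite mulrDl mul1r (le_trans (lerD h (lexx b)))// lerD2l lerDl.
(* The 1 accounts for the gradient part of the H^1 norm, the 2 for (b + e)^2 <= 2 b^2 + 2 e^2 when
   the approximation error is added. *)
exists (2 * (C + 1)) => [|u phi T]; first by rewrite mulr_gt0// addr_gt0.
apply/ler_addgt0Pr => e e0.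
have c2 : 0 < 2 * (C + 2) by rewrite mulr_gt0// addr_gt0.
have [e1 [e10 e11 e1e]] : exists e1, [/\ 0 < e1, e1 <= 1 & e1 * (2 * (C + 2)) <= e].
  exists (Num.min 1 (e / (2 * (C + 2)))).
  rewrite lt_min ltr01 divr_gt0// ge_min lexx.
  by split=> //; rewrite -ler_pdivlMr// ge_min lexx orbT.
have [v [Hv vu _ vN]] := energy_limit T e10; have [Hu _] := T.
have {}T : H1norm oOmega u <= H1norm oOmega (od v) + e1.
  have -> : u = od v - (od v - u) by rewrite opprB addrCA subrr addr0.
  have H1z := H1B bOmega (H1C_H1 Hv) Hu.
  apply: (le_trans (H1normD bOmega (H1C_H1 Hv) (H1N bOmega H1z))).
  by rewrite (H1normN H1z) lerD2l ltW.
have h := key v Hv; have n0 := H1norm_ge0 u; have nv0 := H1norm_ge0 (od v).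
move: (H1norm oOmega u) (H1norm oOmega (od v)) (form_norm oOmega v ^+ 2)
  (dirichlet u u + `|phi| ^+ 2) T h n0 nv0 vN => a b f E ab bf a0 b0 fE.
have h1 : a ^+ 2 <= (b + e1) ^+ 2 by rewrite lerXn2r// nnegrE addr_ge0// ltW.
have h2 : e1 ^+ 2 <= e1 by rewrite expr2 ler_piMl// ltW.
have h3 := sqr_ge0 (b - e1).
have h4 : (C + 1) * f <= (C + 1) * (E + e1) by rewrite ler_wpM2l ?(ltW fE)// addr_ge0// ltW.
clear -h1 h2 h3 h4 bf e1e; rewrite sqrrD in h1; rewrite sqrrB in h3; lra.
Qed.

(** Minimizing over [H1C] gives functions that are Cauchy in the form norm. [trace_friedrichs] makes
    them converge in H^1, and their boundary values converge in L_2(Gamma) directly; the two limits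
    form a pair in which phi is a trace of u. *)
Lemma trace_riesz x : exists u phi, is_trace oOmega u phi /\
  forall w chi, is_trace oOmega w chi -> dirichlet u w + L2dot phi chi = L2dot x chi.
Proof.
pose a (v v' : 'rV[R]_d -> R) : R := dirichlet (od v) (od v') + L2dot (ob v) (ob v').
pose l (v : 'rV[R]_d -> R) : R := L2dot x (ob v).
have aD (u v w : 'rV[R]_d -> R) : H1C oOmega u -> H1C oOmega v -> H1C oOmega w ->
    a (u + v) w = a u w + a v w.
  move=> Hu Hv Hw; rewrite /a (on_domainD bOmega Hu Hv) (on_boundaryD bOmega sOmega Hu Hv).
  rewrite (dirichletDl bOmega _ (H1C_H1 Hu) (H1C_H1 Hv)) L2dotDl.
  exact: addrACA.
have aZ (k : R) (u w : 'rV[R]_d -> R) : H1C oOmega u -> H1C oOmega w -> a (k *: u) w = k * a u w.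
  move=> Hu Hw; rewrite /a (on_domainZ bOmega k Hu) (on_boundaryZ bOmega sOmega k Hu).
  by rewrite (dirichletZl bOmega k _ (H1C_H1 Hu)) L2dotZl mulrDr.
have aC (u v : 'rV[R]_d -> R) : H1C oOmega u -> H1C oOmega v -> a u v = a v u.
  by move=> _ _; rewrite /a dirichletC L2dotC.
have aE v : a v v = form_norm oOmega v ^+ 2 by rewrite form_norm_sqr /a L2dot_norm.
have [v [Hv vc vl]] : exists v : nat -> ('rV[R]_d -> R), [/\ forall n, H1C oOmega (v n),
    forall e, 0 < e -> exists N, forall m n, (N <= m)%N -> (N <= n)%N ->
      a (v m - v n) (v m - v n) < e &
    forall w : 'rV[R]_d -> R, H1C oOmega w -> a (v n) w @[n --> \oo] --> l w].
  apply: (@quadratic_minimizing_sequence R ('rV[R]_d -> R) (H1C oOmega) a l (`|x| ^+ 2)) => //.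
  - exact: H1C0.
  - by move=> u v Hu Hv; exact: (H1CD bOmega Hu Hv).
  - by move=> k u Hu; exact: (H1CZ bOmega k Hu).
  - by move=> u _; rewrite aE sqr_ge0.
  - by move=> u v Hu Hv; rewrite /l (on_boundaryD bOmega sOmega Hu Hv) L2dotDr.
  - by move=> k u Hu; rewrite /l (on_boundaryZ bOmega sOmega k Hu) L2dotZr.
  - move=> u Hu; rewrite aE form_norm_sqr /l.
    have := L2dot_CauchySchwarz x (ob u); have := dirichlet_ge0 (od u).
    move: (L2dot x (ob u)) (dirichlet (od u) (od u)) (`|x|) (normr_ge0 x) (`|ob u|) (normr_ge0 (ob u)).
    move=> b c p p0 q q0 c0 bpq; rewrite -[b ^+ 2]real_normK ?num_real//.
    rewrite (le_trans (y := (p * q) ^+ 2))//.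
      by rewrite lerXn2r// nnegrE mulr_ge0.
    by rewrite exprMn ler_wpM2l ?sqr_ge0// lerDr.
have H1v n : H1 oOmega (od (v n)) by exact: H1C_H1.
have [C C0 HC] := trace_friedrichs.
have [u Hu uv] : exists2 u, H1 oOmega u & H1norm oOmega (od (v n) - u) @[n --> \oo] --> (0 : R).
  apply: (H1_complete bOmega H1v) => e e0.
  have e2C : 0 < e ^+ 2 / C by rewrite divr_gt0// exprn_gt0.
  have [N NP] := vc _ e2C; exists N => m n Nm Nn.
  have := HC _ _ (H1C_trace (H1CB bOmega (Hv m) (Hv n))).
  rewrite -form_norm_sqr -aE (on_domainB bOmega (Hv m) (Hv n)).
  have := NP m n Nm Nn; have := H1norm_ge0 (od (v m) - od (v n)).
  move: (a _ _) (H1norm _ _) => A B B0; rewrite ltr_pdivlMr// => h1 h2.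
  rewrite -(@ltr_pXn2r _ 2)// ?nnegrE ?(ltW e0)//.
  by rewrite (le_lt_trans h2)// mulrC.
have [phi vphi] : exists phi : L2G, ob (v n) @[n --> \oo] --> phi.
  apply: (@L2_complete _ _ _ surf) => e e0.
  have [N NP] := vc _ (exprn_gt0 2 e0); exists N => m n Nm Nn.
  have := NP m n Nm Nn; rewrite aE form_norm_sqr (on_boundaryB bOmega sOmega (Hv m) (Hv n)).
  have := dirichlet_ge0 (od (v m - v n)).
  move: (dirichlet _ _) (`|ob (v m) - ob (v n)|) (normr_ge0 (ob (v m) - ob (v n))).
  move=> A B B0 A0 h; rewrite -(@ltr_pXn2r _ 2)// ?nnegrE ?(ltW e0)//.
  by rewrite (le_lt_trans _ h)// lerDr.
exists u, phi; have T : is_trace oOmega u phi by split=> //; exists v.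
split=> // w chi Tw; apply/eqP; rewrite -subr_eq0 -addrA -L2dotBl; apply/eqP.
apply: (trace_functional_eq0 Hu _ Tw) => v' Hv'.
have H1v' := H1C_H1 Hv'.
have A1 : a (v n) v' @[n --> \oo] --> dirichlet u (od v') + L2dot phi (ob v').
  apply: cvgD.
    apply/cvgrPdist_le => e e0.
    have c0 : 0 < H1norm oOmega (od v') + 1 by rewrite ltr_wpDl// H1norm_ge0.
    have /cvgrPdist_lt/(_ _ (divr_gt0 e0 c0)) := uv.
    apply: filterS => n; rewrite sub0r normrN (ger0_norm (H1norm_ge0 _)) => un.
    rewrite -(dirichletBl bOmega _ Hu (H1v n)).
    apply: (le_trans (dirichlet_le (H1B bOmega Hu (H1v n)) H1v')).
    rewrite (H1norm_distrC Hu (H1v n)); move: un; rewrite ltr_pdivlMr//.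
    move: (H1norm _ _) (H1norm _ (od v')) (H1norm_ge0 (od (v n) - u)) (H1norm_ge0 (od v')).
    by move=> p q p0 q0 h; rewrite (le_trans _ (ltW h))// ler_wpM2l// lerDl.
  apply/cvgrPdist_le => e e0.
  have c0 : 0 < `|ob v'| + 1 by rewrite ltr_wpDl.
  have /cvgrPdist_lt/(_ _ (divr_gt0 e0 c0)) := vphi.
  apply: filterS => n un; rewrite -L2dotBl.
  apply: (le_trans (L2dot_CauchySchwarz _ _)).
  by rewrite (le_trans (ler_wpM2l (normr_ge0 _) (_ : _ <= `|ob v'| + 1)))// ?lerDl// -ler_pdivlMr// ltW.
have A2 := vl v' Hv'.
have := cvg_unique _ A1 A2; rewrite /l L2dotBl addrA => ->//.
by rewrite subrr.
Qed.

(** Test functions belong to [H1C] with boundary value 0, so the weak identity applied to them says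
    that u is harmonic. Conversely, harmonicity of u forces the Laplacian f occurring in the normal
    derivative to be 0. *)
Lemma DtNP phi psi : DtN oOmega phi psi <-> exists2 u, is_trace oOmega u phi &
  forall v, H1C oOmega v -> dirichlet u (od v) = L2dot psi (ob v).
Proof.
split=> [[u [Hu u0 Tu [_ [f uf fpsi]]]]|[u Tu uv]].
  exists u => // v Hv; rewrite -(fpsi v Hv).
  have -> : f = 0; last by rewrite L2dot0l add0r.
  apply: (test_dot_eq0 bOmega) => h th.
  rewrite (L2dot_on_domain _ (test_Lfun2 oOmega bOmega th)) -(uf h th) (u0 h th).
  by rewrite -(L2dot_on_domain _ (test_Lfun2 oOmega bOmega th)) L2dot0l.
have Hu := is_trace_H1 Tu.
have u0 : is_laplacian u 0.
  move=> h th; rewrite -(L2dot_on_domain 0 (test_Lfun2 oOmega bOmega th)) L2dot0l.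
  have ti i := test_function_pderiv i th.
  have tii i := test_function_pderiv i (ti i).
  have -> : \int[vol]_x (u x * (\sum_i pderiv i (pderiv i h) x)) =
      \sum_i L2dot u (od (pderiv i (pderiv i h))).
    pose G i : 'rV[R]_d -> R^o := pderiv i (pderiv i h).
    have key (r : seq 'I_d) : test_function Omega (\sum_(i <- r) G i) /\
        od (\sum_(i <- r) G i) = \sum_(i <- r) od (G i).
      elim: r => [|i r [tG oG]].
        by rewrite !big_nil; split; [exact: test_function0|exact: on_domain0].
      rewrite !big_cons; split; first exact: (test_functionD (tii i) tG).
      by rewrite -oG; exact: (test_on_domainD oOmega bOmega (tii i) tG).
    have [tG oG] := key (index_enum _).
    transitivity (L2dot u (od (\sum_i G i))).
      rewrite (L2dot_on_domain _ (test_Lfun2 oOmega bOmega tG)).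
      by apply: eq_Rintegral => x _; rewrite fct_sumE.
    rewrite oG; elim/big_rec2 : _ => [|i y z _ <-]; first exact: L2dot0r.
    exact: L2dotDr.
  have -> : \sum_i L2dot u (od (pderiv i (pderiv i h))) = - dirichlet u (od h).
    rewrite dirichletE -sumrN; apply: eq_bigr => i _.
    rewrite (weak_deriv_test oOmega bOmega i th).
    exact: ((is_weak_derivP bOmega i _ _).1 (weak_derivP bOmega i Hu) _ (ti i)).
  have [Hh h0] := test_H1C oOmega bOmega th.
  by rewrite (uv h Hh) h0 L2dot0r oppr0.
exists u; split=> //; split=> //; exists 0 => // v Hv.
by rewrite L2dot0l add0r; exact: uv.
Qed.

End traces.

(** * The equivalences *)

Section compactness.
Context {R : realType}.

Definition totally_bounded (V : normedModType R) (A : set V) :=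
  forall e : R, 0 < e -> exists s : seq V,
    forall a, A a -> exists2 x, x \in s & `|a - x| < e.

Lemma totally_bounded_subset (V : normedModType R) (A B : set V) :
  A `<=` B -> totally_bounded B -> totally_bounded A.
Proof. by move=> AB tB e /tB[s sB]; exists s => a /AB/sB. Qed.

(** A finite net for the values of [G] becomes one for those of [F]: each net point x that has some
    a in [B] with [G a] within delta / 2 is replaced by the value [F a]. *)
Lemma totally_bounded_unif (I : Type) (V W : normedModType R) (B : set I)
    (F : I -> V) (G : I -> W) : totally_bounded (G @` B) ->
  (forall e, 0 < e -> exists2 delta, 0 < delta &
    forall a b, B a -> B b -> `|G a - G b| < delta -> `|F a - F b| < e) ->
  totally_bounded (F @` B).
Proof.
move=> tG FG e e0; have [delta delta0 Fd] := FG e e0.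
have [s sG] := tG _ (divr_gt0 delta0 (ltr0Sn R 1)).
pose P (x : W) (y : V) := exists a, [/\ B a, y = F a & `|G a - x| < delta / 2].
have [f fP] : {f : W -> V & forall x, (exists y, P x y) -> P x (f x)}.
  apply: (@choice _ _ (fun x y => (exists y, P x y) -> P x y)) => x.
  by have [[y Py]|nP] := pselect (exists y, P x y); [exists y|exists 0].
exists (map f s) => _ [a Ba <-].
have [|x xs xa] := sG (G a); first by exists a.
exists (f x); first exact: map_f.
have [|b' [Bb' -> bx']] := fP x; first by exists (F a), a.
apply: Fd => //; rewrite [delta]splitr.
have -> : G a - G b' = (G a - x) - (G b' - x) by rewrite opprB addrA subrK.
by rewrite (le_lt_trans (ler_normB _ _))// ltrD.
Qed.

Lemma totally_bounded_approx (V : normedModType R) (A : set V) :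
  (forall e, 0 < e -> exists2 B, totally_bounded B &
    forall a, A a -> exists2 b, B b & `|a - b| < e) -> totally_bounded A.
Proof.
move=> AB e e0; have e20 : 0 < e / 2 by rewrite divr_gt0.
have [B tB AtB] := AB _ e20; have [s sB] := tB _ e20.
exists s => a /AtB[b /sB[x xs bx] ab]; exists x => //.
by rewrite -[a](subrK b) -addrA (le_lt_trans (ler_normD _ _))// [e]splitr ltrD.
Qed.

(** Pigeonhole: some point of a finite net is within e / 2 of infinitely many terms, and any two of
    these are within e of each other. *)
Lemma totally_bounded_recurrent (V : normedModType R) (u : nat -> V) (e : R) :
  totally_bounded (range u) -> 0 < e ->
  exists k, forall N, exists2 l, (N <= l)%N & `|u k - u l| < e.
Proof.
move=> tu e0; have [s su] := tu _ (divr_gt0 e0 (ltr0Sn R 1)).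
have [x xs xu] : exists2 x, x \in s & forall N, exists2 l, (N <= l)%N & `|u l - x| < e / 2.
  apply: contrapT => H.
  have {}H x : x \in s -> exists N, forall l, (N <= l)%N -> ~ `|u l - x| < e / 2.
    move=> xs; apply: contrapT => Hx; apply: H; exists x => // N.
    apply: contrapT => HN; apply: Hx; exists N => l Nl ul; apply: HN; by exists l.
  have [N HN] : exists N, forall x, x \in s -> forall l, (N <= l)%N -> ~ `|u l - x| < e / 2.
    elim: s H {su} => [_|y s ih H]; first by exists 0%N.
    have [|N NP] := ih; first by move=> x xs; apply: H; rewrite inE xs orbT.
    have [N' NP'] := H y (mem_head _ _).
    exists (maxn N N') => x; rewrite inE => /predU1P[->|xs] l; rewrite geq_max => /andP[lN lN'].
      exact: NP'.
    exact: NP.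
  by have [|x xs] := su (u N); [exists N|exact: HN].
have [k _ kx] := xu 0%N; exists k => N; have [l Nl lx] := xu N; exists l => //.
have -> : u k - u l = (u k - x) - (u l - x) by rewrite opprB addrA subrK.
by rewrite (le_lt_trans (ler_normB _ _))// [e]splitr ltrD.
Qed.

Lemma totally_bounded_cluster (V : normedModType R) (u : nat -> V) :
  cauchyn_complete V -> totally_bounded (range u) ->
  exists l, forall e, 0 < e -> forall N, exists2 k, (N <= k)%N & `|u k - l| < e.
Proof.
move=> cV /(totally_bounded_precompact cV); rewrite precompactE => cu.
have [|l [_ ul]] := cu (u @ \oo) _.
  have : \forall n \near \oo, closure (range u) (u n).
    by apply: nearW => n; apply: subset_closure; exists n.
  exact.
exists l => e e0 N.
have [] := ul (u @` [set k | (N <= k)%N]) (ball l e).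
- by exists N => // k /= Nk; exists k.
- exact: nbhsx_ballx.
by move=> _ [[k /= Nk <-]]; rewrite normed_ballE distrC => uk; exists k.
Qed.

Lemma L2class_mul_norm dT (T : measurableType dT) (mu : {measure set T -> \bar R})
    (h : T -> R) (M : R) (u : LspaceType2 mu) : measurable_fun [set: T] h ->
  0 <= M -> (forall x, `|h x| <= M) -> `|L2class mu (fun x => h x * u x)| <= M * `|u|.
Proof.
move=> mh M0 hM.
rewrite -[M](ger0_norm M0) -normrZ.
apply: (L2_le_norm (L2class_ae (Lfun2_bdM mh hM (Lspace2_Lfun u))) (Lspace_scaleE M u)).
by move=> x /=; rewrite /GRing.scale/= !normrM ler_wpM2r// (ger0_norm M0).
Qed.

(** The point itself, repeated, is a cover by sets of diameter 0, and 0^n = 0 for n > 0. *)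
Lemma hausdorff_set1 d n (p : 'rV[R]_d) : (0 < n)%N -> hausdorff n [set p] = 0%E.
Proof.
move=> n0; apply/eqP; rewrite eq_le measure_ge0 andbT.
apply: ge_ereal_sup => _ [delta /= delta0 <-].
have ed : ediam [set p] = 0%E.
  rewrite /ediam (_ : [set _ | _ in _] = [set 0%E]) ?ereal_sup1//.
  apply/seteqP; split=> [_ [[x y] [/= -> ->] <-]|_ ->].
    by rewrite /= subrr /enorm big1 ?sqrtr0// => i _; rewrite mxE expr0n.
  exists (p, p) => //=; rewrite subrr /enorm big1 ?sqrtr0// => i _.
  by rewrite mxE expr0n.
apply: ereal_inf_lbound; exists (fun=> [set p]).
  by split=> [x ->|k]; [exists 0%N|rewrite ed lee_fin ltW].
rewrite eseries0// => k _ _; rewrite /hausdorff_gauge.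
case: eqVneq => // _; rewrite ed -EFin_expe expr0n gtn_eqF//.
by rewrite mule0.
Qed.

End compactness.

(** * The Robin problem and compactness of the restriction map *)

Section equivalences.
Context {R : realType} {d : nat}.
Variable Omega : set 'rV[R]_d.
Hypotheses (d2 : (2 <= d)%N) (oOmega : open Omega) (bOmega : bounded_set Omega).
Hypothesis sOmega : (hausdorff d.-1 (boundary Omega) < +oo)%E.
Local Notation vol := (volume oOmega).
Local Notation surf := (surface Omega).
Local Notation L2O := (LspaceType2 vol).
Local Notation L2G := (LspaceType2 surf).
Local Notation od := (on_domain oOmega).
Local Notation ob := (on_boundary Omega).
Implicit Types (u w : L2O) (phi psi chi x y : L2G) (v : 'rV[R]_d -> R).

Local Opaque Lspace_class Lspace_repr L2class H1norm dirichlet L2dot on_domain on_boundary.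

(* The weak form of the Robin problem: u is harmonic and its normal derivative
   plus its trace phi equals x. *)
Definition weak_solution x u phi := is_trace oOmega u phi /\
  forall w chi, is_trace oOmega w chi -> dirichlet u w + L2dot phi chi = L2dot x chi.

Lemma weak_solution_energy x u phi : weak_solution x u phi ->
  dirichlet u u + `|phi| ^+ 2 = L2dot x phi.
Proof. by move=> [T /(_ _ _ T)]; rewrite (L2dot_norm phi). Qed.

Lemma weak_solution_bound x u phi : weak_solution x u phi ->
  `|phi| <= `|x| /\ dirichlet u u + `|phi| ^+ 2 <= `|x| ^+ 2.
Proof.
move=> /weak_solution_energy E; have := le_trans (ler_norm _) (L2dot_CauchySchwarz x phi).
rewrite -E; have D0 := dirichlet_ge0 u; have p0 := normr_ge0 phi; have x0 := normr_ge0 x.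
move: (dirichlet u u) (`|phi|) (`|x|) D0 p0 x0 => a b c a0 b0 c0 h.
have bc : b <= c.
  have [b00|bn0] := eqVneq b 0; first by rewrite b00.
  rewrite -(ler_pM2r (x := b)) ?lt_def ?bn0//.
  by rewrite (le_trans _ h)// expr2 lerDr.
by split=> //; rewrite (le_trans h)// expr2 ler_wpM2l.
Qed.

Lemma weak_solutionD x y u w phi chi : weak_solution x u phi ->
  weak_solution y w chi -> weak_solution (x + y) (u + w) (phi + chi).
Proof.
move=> [Tu Hu] [Tw Hw]; split=> [|z zeta Tz].
  exact: (is_traceD bOmega sOmega Tu Tw).
rewrite (dirichletDl bOmega _ (is_trace_H1 Tu) (is_trace_H1 Tw)) !L2dotDl.
by rewrite -(Hu _ _ Tz) -(Hw _ _ Tz); exact: addrACA.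
Qed.

Lemma weak_solutionZ (k : R) x u phi : weak_solution x u phi ->
  weak_solution (k *: x) (k *: u) (k *: phi).
Proof.
move=> [Tu Hu]; split=> [|z zeta Tz]; first exact: (is_traceZ bOmega sOmega k Tu).
rewrite (dirichletZl bOmega k _ (is_trace_H1 Tu)) !L2dotZl -mulrDr.
by rewrite (Hu _ _ Tz).
Qed.

Lemma weak_solution_unique x u w phi chi : weak_solution x u phi ->
  weak_solution x w chi -> phi = chi.
Proof.
move=> Su Sw; have := weak_solutionD Su (weak_solutionZ (-1) Sw).
rewrite !scaleN1r subrr => /weak_solution_bound[].
by rewrite normr0 normr_le0 subr_eq0 => /eqP.
Qed.

(** Together with [DtN_weak_solution]: the map from x to phi is the inverse of D_0 + 1. *)
Lemma weak_solution_DtN x u phi : weak_solution x u phi -> DtN oOmega phi (x - phi).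
Proof.
move=> [Tu Hu]; apply/(DtNP oOmega bOmega _ _); exists u => // v Hv.
rewrite L2dotBl -(Hu _ _ (H1C_trace bOmega Hv)).
by rewrite addrK.
Qed.

Lemma DtN_weak_solution phi psi : DtN oOmega phi psi ->
  exists u, weak_solution (phi + psi) u phi.
Proof.
move=> /(DtNP oOmega bOmega _ _)[u Tu Hu]; exists u; split=> // w chi Tw.
apply/eqP; rewrite -subr_eq0 L2dotDl opprD addrA addrK -L2dotNl; apply/eqP.
apply: (trace_functional_eq0 bOmega (is_trace_H1 Tu) _ Tw) => v Hv.
by rewrite (Hu v Hv) L2dotNl subrr.
Qed.

(** Cauchy-Schwarz for the sum of two semi-inner products, in squared form: 2 |a b| <= 2 sqrt(p s r
    q) <= p s + r q. *)
Lemma sum_CauchySchwarz (a b p q r s : R) : 0 <= p -> 0 <= q -> 0 <= r -> 0 <= s ->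
  a ^+ 2 <= p * q -> b ^+ 2 <= r * s -> (a + b) ^+ 2 <= (p + r) * (q + s).
Proof.
move=> p0 q0 r0 s0 apq brs.
have ab : a * b * 2 <= p * s + r * q.
  have h0 : 0 <= p * s + r * q by rewrite addr_ge0 ?mulr_ge0.
  rewrite (le_trans (ler_norm _))// -(ler_pXn2r (n := 2))// ?nnegrE//.
  rewrite real_normK ?num_real//.
  have h1 : a ^+ 2 * b ^+ 2 <= p * q * (r * s) by rewrite ler_pM ?sqr_ge0.
  have h2 := sqr_ge0 (p * s - r * q).
  have -> : (a * b * 2) ^+ 2 = 4 * (a ^+ 2 * b ^+ 2) by ring.
  have -> : (p * s + r * q) ^+ 2 = (p * s - r * q) ^+ 2 + 4 * (p * q * (r * s)) by ring.
  by rewrite (le_trans (ler_wpM2l (ler0n _ 4) h1))// lerDr.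
have -> : (a + b) ^+ 2 = a ^+ 2 + b ^+ 2 + a * b * 2 by ring.
have -> : (p + r) * (q + s) = p * q + r * s + (p * s + r * q) by ring.
by rewrite !lerD.
Qed.

(* Testing the equation for [ob v] with [v] itself; this recovers compactness of
   [ob] from compactness of the solution operator. *)
Lemma boundary_norm_cube v u phi : H1C oOmega v -> weak_solution (ob v) u phi ->
  `|ob v| ^+ 3 <= form_norm oOmega v ^+ 2 * `|phi|.
Proof.
move=> Hv Su; have := weak_solution_energy Su.
have := Su.2 _ _ (H1C_trace bOmega Hv); rewrite (L2dot_norm (ob v)) form_norm_sqr.
have H1v := H1C_H1 Hv; have Hu := is_trace_H1 Su.1.
have c1 := dirichlet_CauchySchwarz bOmega Hu H1v.
have c2 := L2dot_CauchySchwarz phi (ob v).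
have c3 := le_trans (ler_norm _) (L2dot_CauchySchwarz (ob v) phi).
have d1 := dirichlet_ge0 u; have d3 := dirichlet_ge0 (od v).
have n0 := normr_ge0 phi; have n1 := normr_ge0 (ob v).
move: (dirichlet u (od v)) (L2dot phi (ob v)) (L2dot (ob v) phi) (dirichlet u u)
  (dirichlet (od v) (od v)) (`|phi|) (`|ob v|) c1 c2 c3 d1 d3 n0 n1.
move=> a b c p q f g c1 c2 c3 d1 d3 n0 n1 E1 E2.
have [->|g0] := eqVneq g 0.
  by rewrite expr0n/= expr0n addr0 mulr_ge0.
have gp : 0 < g by rewrite lt_def g0.
have h : (a + b) ^+ 2 <= (p + f ^+ 2) * (q + g ^+ 2).
  apply: sum_CauchySchwarz => //; rewrite ?sqr_ge0//.
  by rewrite -exprMn -[b ^+ 2]real_normK ?num_real// lerXn2r// nnegrE mulr_ge0.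
(* Write E for the energy form. Then g^4 = E(u, v)^2 <= E(u, u) E(v, v), and E(u, u) <= g f; one
   factor g cancels. *)
rewrite -(ler_pM2l gp) -exprS.
have -> : g ^+ 4 = (a + b) ^+ 2 by rewrite E1 -exprM.
apply: (le_trans h); have -> : g * ((q + g ^+ 2) * f) = (g * f) * (q + g ^+ 2) by ring.
by rewrite ler_wpM2r ?E2// addr_ge0 ?sqr_ge0.
Qed.

Lemma form_norm_sub v v' : H1C oOmega v -> H1C oOmega v' ->
  form_norm oOmega (v - v') ^+ 2 <= 2 * form_norm oOmega v ^+ 2 + 2 * form_norm oOmega v' ^+ 2.
Proof.
move=> Hv Hv'; rewrite !form_norm_sqr (on_domainB bOmega Hv Hv').
rewrite (on_boundaryB bOmega sOmega Hv Hv').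
have H1v := H1C_H1 Hv; have H1v' := H1C_H1 Hv'.
have := dirichlet_ge0 (od v + od v').
rewrite (dirichletDl bOmega _ H1v H1v') (dirichletBl bOmega _ H1v H1v').
rewrite ![dirichlet _ (od v + od v')]dirichletC ![dirichlet _ (od v - od v')]dirichletC.
rewrite !(dirichletDl bOmega _ H1v H1v') !(dirichletBl bOmega _ H1v H1v').
rewrite (dirichletC (od v') (od v)).
have n1 := ler_normB (ob v) (ob v'); have n2 := normr_ge0 (ob v - ob v').
have n3 := normr_ge0 (ob v); have n4 := normr_ge0 (ob v').
move: (dirichlet (od v) (od v)) (dirichlet (od v) (od v')) (dirichlet (od v') (od v'))
  (`|ob v|) (`|ob v'|) (`|ob v - ob v'|) n1 n2 n3 n4 => a b c p q r n1 n2 n3 n4 h.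
have h1 : r ^+ 2 <= (p + q) ^+ 2 by rewrite lerXn2r// nnegrE addr_ge0.
have h2 := sqr_ge0 (p - q).
have -> : 2 * (a + p ^+ 2) + 2 * (c + q ^+ 2) =
  (a - b - (b - c) + (p + q) ^+ 2) + ((a + b + (b + c)) + (p - q) ^+ 2) by ring.
apply: (le_trans (y := a - b - (b - c) + (p + q) ^+ 2)); first by rewrite lerD2l.
by rewrite lerDl addr_ge0.
Qed.

Lemma resolvent_compact_form : compact_resolvent (DtN oOmega) ->
  compact_map (H1C oOmega) (form_norm oOmega) ob.
Proof.
move=> [lam [T [[_ TP] Tc]]] B BH [M BM].
apply: totally_bounded_precompact; first exact: L2_complete.
have /choice[K KP] x : exists phi, exists u, weak_solution x u phi.
  by have [u [phi S]] := trace_riesz d2 oOmega bOmega sOmega x; exists phi, u.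
have KB x y : K (x - y) = K x - K y.
  have [u Su] := KP x; have [w Sw] := KP y; have [z Sz] := KP (x - y).
  have := weak_solutionD Su (weak_solutionZ (-1) Sw); rewrite !scaleN1r.
  exact: weak_solution_unique Sz.
(* Resolvent identity: T = (lam - D_0)^-1 and K = (D_0 + 1)^-1 satisfy K = T ((lam + 1) K - 1). *)
have TK x : T ((lam + 1) *: K x - x) = K x.
  have [u Su] := KP x; apply/TP; exists (x - K x); first exact: weak_solution_DtN Su.
  by rewrite opprB addrA scalerDl scale1r.
have nK x : `|K x| <= `|x|.
  by have [u /weak_solution_bound[]] := KP x.
have BN v : B v -> `|ob v| <= M.
  move=> Bv; apply: (le_trans _ (BM v Bv)).
  rewrite -(@ler_pXn2r _ 2)// ?nnegrE ?form_norm_ge0// form_norm_sqr lerDr.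
  exact: dirichlet_ge0.
have tK : totally_bounded [set K (ob v) | v in B].
  have /precompact_totally_bounded : precompact (T @` [set y | `|y| <= (`|lam + 1| + 1) * M]).
    by apply: Tc => //; exists ((`|lam + 1| + 1) * M).
  apply: totally_bounded_subset => _ [v Bv <-]; exists ((lam + 1) *: K (ob v) - ob v).
    rewrite /= (le_trans (ler_normB _ _))// normrZ mulrDl mul1r.
    by rewrite lerD ?BN// ler_wpM2l// (le_trans (nK _))// BN.
  exact: TK.
apply: totally_bounded_unif tK _ => e e0.
(* The form norm of a difference of elements of [B] has square at most 4 M^2; the [+ 1] keeps the
   divisor positive. *)
have c0 : 0 < 4 * M ^+ 2 + 1 by rewrite ltr_wpDl// mulr_ge0// sqr_ge0.
exists (e ^+ 3 / (4 * M ^+ 2 + 1)); first by rewrite divr_gt0// exprn_gt0.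
move=> a b Ba Bb; rewrite -KB -(on_boundaryB bOmega sOmega (BH a Ba) (BH b Bb)).
have [u Su] := KP (ob (a - b)).
have := boundary_norm_cube (H1CB bOmega (BH a Ba) (BH b Bb)) Su.
have N0 := sqr_ge0 (form_norm oOmega (a - b)).
have := form_norm_sub (BH a Ba) (BH b Bb).
have := BM a Ba; have := BM b Bb.
have := form_norm_ge0 oOmega a; have := form_norm_ge0 oOmega b.
move: (`|K (ob (a - b))|) (normr_ge0 (K (ob (a - b)))) => k k0.
move: (`|ob (a - b)|) (normr_ge0 (ob (a - b))) => n n0.
move: (form_norm oOmega (a - b) ^+ 2) N0 (form_norm oOmega a) (form_norm oOmega b).
move=> N N0 p q q0 p0 qM pM Npq nN; rewrite ltr_pdivlMr// => ke.
rewrite -(@ltr_pXn2r _ 3)// ?nnegrE ?(ltW e0)//.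
have p2 : p ^+ 2 <= M ^+ 2 by rewrite lerXn2r// nnegrE// (le_trans p0).
have q2 : q ^+ 2 <= M ^+ 2 by rewrite lerXn2r// nnegrE// (le_trans q0).
have NM : N <= 4 * M ^+ 2 by lra.
apply: (le_lt_trans nN); apply: le_lt_trans ke; rewrite mulrC ler_wpM2l//.
by rewrite (le_trans NM)// lerDl.
Qed.

End equivalences.

(** * Uniqueness of the trace from compactness *)

Section trace_uniqueness.
Context {R : realType} {d : nat}.
Variable Omega : set 'rV[R]_d.
Hypotheses (d2 : (2 <= d)%N) (oOmega : open Omega) (bOmega : bounded_set Omega).
Hypothesis sOmega : (hausdorff d.-1 (boundary Omega) < +oo)%E.
Local Notation vol := (volume oOmega).
Local Notation surf := (surface Omega).
Local Notation L2O := (LspaceType2 vol).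
Local Notation L2G := (LspaceType2 surf).
Local Notation od := (on_domain oOmega).
Local Notation ob := (on_boundary Omega).
Implicit Types (u w : L2O) (phi psi chi : L2G) (v : 'rV[R]_d -> R).

Local Opaque Lspace_class Lspace_repr L2class H1norm dirichlet L2dot.

(** The pairs of bounded energy, seen from the boundary. Taking u = 0 shows that the set contains
    the traces of 0 of square norm at most M. *)
Definition energy_traces (M : R) : set L2G :=
  [set phi | exists2 u, is_trace oOmega u phi & dirichlet u u + `|phi| ^+ 2 <= M].

Lemma energy_traces_totally_bounded (M : R) :
  compact_map (H1C oOmega) (form_norm oOmega) ob -> totally_bounded (energy_traces M).
Proof.
move=> cj; apply: totally_bounded_approx => e e0.
(* If N is the form norm of the approximating function, then N^2 <= M + 1, and 2 N <= N^2 + 1 gives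
   N <= M + 2. *)
exists [set ob v | v in [set v | H1C oOmega v /\ form_norm oOmega v <= M + 2]].
  apply/precompact_totally_bounded/cj => [v []//|].
  by exists (M + 2) => v [].
move=> phi [u Tu uM].
have e10 : 0 < Num.min e 1 by rewrite lt_min e0 ltr01.
have [v [Hv _ vphi vE]] := energy_limit bOmega Tu e10.
exists (ob v); last by rewrite distrC (lt_le_trans vphi)// ge_min lexx.
exists v => //; split=> //.
have v2 : form_norm oOmega v ^+ 2 <= M + 1.
  by rewrite (le_trans (ltW vE))// lerD// ge_min lexx orbT.
have := sqr_ge0 (form_norm oOmega v - 1); move: (form_norm oOmega v) v2 => a h.
have := form_norm_ge0 oOmega v; nra.
Qed.

Lemma on_domain_mul_norm (h : 'rV[R]_d -> R) (M : R) u :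
  measurable_fun [set: 'rV[R]_d] h -> 0 <= M -> (forall x, `|h x| <= M) ->
  `|od (fun x => h x * u x)| <= M * `|u|.
Proof. by move=> mh M0 hM; exact: L2class_mul_norm. Qed.

Local Opaque on_domain on_boundary.

(** By the product rule, with uniform bounds [M] on h and [m i] on its derivatives. Multiplication
    by h thus preserves convergence to 0 in H^1. *)
Lemma H1norm_mul U h : test_function U h -> exists2 C : R, 0 < C &
  forall v, H1C oOmega v -> H1norm oOmega (od (fun x => h x * v x)) <= C * H1norm oOmega (od v).
Proof.
move=> th; have [M M0 hM] := test_function_bounded th.
have mh := smooth_measurable (test_function_smooth th).
have /choice[m mP] i : exists m, 0 <= m /\ forall x, `|pderiv i h x| <= m.
  by have [m m0 hm] := test_function_bounded (test_function_pderiv i th); exists m.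
pose C0 := M ^+ 2 + \sum_i (M + m i) ^+ 2.
have C00 : 0 <= C0 by rewrite addr_ge0 ?sqr_ge0// sumr_ge0// => i _; rewrite sqr_ge0.
exists (C0 + 1) => [|v Hv]; first by rewrite ltr_wpDl.
have H1v := H1C_H1 Hv; have N0 := H1norm_ge0 (od v).
rewrite (on_domainM bOmega th Hv).
suff : H1norm oOmega (od (fun x => h x * od v x)) ^+ 2 <= C0 * H1norm oOmega (od v) ^+ 2.
  have := H1norm_ge0 (od (fun x => h x * od v x)).
  move: (H1norm oOmega (od (fun x => _))) (H1norm oOmega (od v)) N0 => a b b0 a0 ab.
  rewrite -(@ler_pXn2r _ 2)// ?nnegrE ?(mulr_ge0 (addr_ge0 C00 ler01) b0)//.
  rewrite (le_trans ab)// exprMn ler_wpM2r ?sqr_ge0// expr2.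
  by rewrite (le_trans (y := C0 + 1)) ?lerDl// ler_pMr ?lerDr// ltr_wpDl.
have sq (a b c : R) : 0 <= a -> a <= b * c -> a ^+ 2 <= b ^+ 2 * c ^+ 2.
  by move=> a0 ab; rewrite -exprMn lerXn2r// nnegrE// (le_trans a0).
apply: (@eq_ind_r _ _ (fun t => t <= C0 * H1norm oOmega (od v) ^+ 2) _ _
  (H1norm_sqr (od (fun x => h x * od v x)))).
have e1 : `|od (fun x => h x * od v x)| ^+ 2 <= M ^+ 2 * H1norm oOmega (od v) ^+ 2.
  apply: sq; first exact: normr_ge0.
  apply: (le_trans (on_domain_mul_norm _ mh M0 hM)).
  by rewrite ler_wpM2l// norm_le_H1norm.
suff e2 : dirichlet (od (fun x => h x * od v x)) (od (fun x => h x * od v x)) <=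
    (\sum_i (M + m i) ^+ 2) * H1norm oOmega (od v) ^+ 2.
  have := lerD e1 e2; rewrite -mulrDl; exact.
rewrite dirichletE mulr_suml; apply: ler_sum => i _; rewrite L2dot_norm.
have [m0 hm] := mP i.
have mdh := smooth_measurable (smooth_pderiv i (test_function_smooth th)).
have -> := weak_derivE bOmega (is_weak_deriv_mul bOmega th (weak_derivP bOmega i H1v)).
apply: sq; first exact: normr_ge0.
apply: (le_trans (ler_normD _ _)); rewrite mulrDl; apply: lerD.
  apply: (le_trans (on_domain_mul_norm _ mh M0 hM)).
  by rewrite ler_wpM2l// weak_deriv_le_H1norm.
apply: (le_trans (on_domain_mul_norm _ mdh m0 hm)).
by rewrite ler_wpM2l// norm_le_H1norm.
Qed.

Local Transparent on_domain on_boundary.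

(** If v_n tends to 0 in H^1 with boundary values tending to phi, then h v_n tends to 0 in H^1 with
    boundary values tending to h phi. *)
Lemma zero_trace_mul U h phi : test_function U h -> is_trace oOmega 0 phi ->
  is_trace oOmega 0 (L2class surf (fun x => h x * phi x)).
Proof.
move=> th /is_traceP[H0 T0]; apply/is_traceP; split=> // e e0.
have [M M0 hM] := test_function_bounded th.
have mh := smooth_measurable (test_function_smooth th).
have [C C0 HC] := H1norm_mul th.
have c0 : 0 < C + M + 1 by rewrite ltr_wpDl// addr_ge0// ltW.
have [v [Hv]] := T0 _ (divr_gt0 e0 c0); rewrite subr0 => vu vphi.
have le_e (a b : R) : 0 <= b -> a <= C + M -> b < e / (C + M + 1) -> a * b < e.
  move=> b0 ab; rewrite ltr_pdivlMr// => /(le_lt_trans _); apply.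
  by rewrite mulrC ler_wpM2l// (le_trans ab)// lerDl.
exists (fun x => h x * v x); split; first exact: (H1CM bOmega th Hv).
  rewrite subr0; apply: le_lt_trans (HC v Hv) _.
  by apply: le_e => //; [exact: H1norm_ge0|rewrite lerDl].
rewrite (on_boundaryM bOmega sOmega th Hv).
have -> : ob (fun x => h x * ob v x) - L2class surf (fun x => h x * phi x) =
    L2class surf (fun x => h x * (ob v - phi) x).
  have hL (y : L2G) := Lfun2_bdM mh hM (Lspace2_Lfun y).
  rewrite -[X in _ - X]scale1r -scaleNr -(L2classZ _ (hL phi)) -[ob _]/(L2class _ _).
  rewrite -(L2classD (hL (ob v)) (Lfun2Z _ (hL phi))); apply: L2class_eq.
  have -> : ob v - phi = ob v + (-1) *: phi by rewrite scaleN1r.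
  have E1 := Lspace_addE (ob v) ((-1) *: phi); have E2 := Lspace_scaleE (-1) phi.
  move: E1 E2; apply: filterS2 => x /(_ I) E1 /(_ I) E2 _.
  by rewrite E1 /= E2 /GRing.scale/= mulrDr; congr (_ + _); rewrite mulrCA.
apply: le_lt_trans (L2class_mul_norm _ mh M0 hM) _.
by apply: le_e => //; rewrite lerDr ltW.
Qed.

Lemma L2_zero_ae dT (T : measurableType dT) (mu : {measure set T -> \bar R}) :
  (0 : LspaceType2 mu) = cst 0 %[ae mu].
Proof.
have := Lspace_scaleE 0 (0 : LspaceType2 mu); rewrite scale0r.
by apply: filterS => x /(_ I) -> _; rewrite /= /GRing.scale/= mul0r.
Qed.

(** Finitely many of the balls cover the compact boundary, so only finitely many exceptional null
    sets are united. The contrapositive supplies the point around which a nonzero phi never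
    vanishes. *)
Lemma local_vanishing phi :
  (forall p, boundary Omega p -> exists2 r : R, 0 < r &
    \forall x \ae surf, ball p r x -> phi x = 0) -> phi = 0.
Proof.
move=> H; have /choice[r rP] p : exists r : R, boundary Omega p ->
    0 < r /\ \forall x \ae surf, ball p r x -> phi x = 0.
  have [/H[r r0 rp]|nB] := pselect (boundary Omega p); first by exists r.
  by exists 0.
have := compact_boundary oOmega bOmega; rewrite compact_cover.
move=> /(_ _ (boundary Omega) (fun p => ball p (r p)))[|p Bp|D' D'B BD'].
- by move=> p _; exact: ball_open.
- by exists p => //; apply: ballxx; case: (rP p Bp).
have [s Es] := (finite_seqP _).1 (finite_fset D').
have sB p : p \in s -> boundary Omega p.
  move=> ps; have : [set` s] p by [].
  by rewrite -Es => /D'B/set_mem.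
have : \forall x \ae surf, forall p, p \in s -> ball p (r p) x -> phi x = 0.
  elim: s sB {Es} => [_|q s ih sB]; first exact: nearW.
  have [_] := rP q (sB q (mem_head _ _)).
  have : forall p, p \in s -> boundary Omega p by move=> p ps; apply: sB; rewrite inE ps orbT.
  move=> /ih; apply: filterS2 => x Hs Hq p; rewrite inE => /predU1P[->//|]; exact: Hs.
move=> H'; apply/Lspace_eqP; move: H' (surface_ae_boundary Omega) (L2_zero_ae surf).
apply: filterS3 => x Hx /BD'[p pD px] /(_ I) -> _.
by apply: Hx px; rewrite Es in pD.
Qed.

Lemma trace_unique_compact : (forall M, totally_bounded (energy_traces M)) ->
  trace_unique oOmega.
Proof.
move=> tE phi T0; apply: contrapT => phi0.
pose h p k : 'rV[R]_d -> R^o := bump p k.+1%:R^-1 1.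
have r0 k : 0 < k.+1%:R^-1 :> R by rewrite invr_gt0.
have th p k : test_function setT (h p k) by apply: test_function_bump.
have mh p k := smooth_measurable (test_function_smooth (th p k)).
have hb p k x : `|h p k x| <= 1 by rewrite ger0_norm ?bump_ge0 ?bump_le1.
have hL p k (y : L2G) := Lfun2_bdM (mh p k) (hb p k) (Lspace2_Lfun y).
have [p [Bp hp]] : exists p, boundary Omega p /\
    forall k, L2class surf (fun x => h p k x * phi x) != 0.
  apply: contrapT => H; apply: phi0; apply: local_vanishing => p Bp.
  have [k /eqP hk0] : exists k, L2class surf (fun x => h p k x * phi x) == 0.
    apply: contrapT => Hk; apply: H; exists p; split=> // k.
    by apply/negP => hk; apply: Hk; exists k.
  exists k.+1%:R^-1 => //.
  have := L2class_ae (hL p k phi); rewrite hk0.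
  move: (L2_zero_ae surf); apply: filterS2 => x /(_ I) -> /(_ I)/= /esym/eqP hx px.
  by move: hx; rewrite mulf_eq0 gt_eqF ?bump_gt0//= => /eqP.
pose g k := L2class surf (fun x => h p k x * phi x).
pose psi k := `|g k|^-1 *: g k.
have npsi k : `|psi k| = 1.
  by rewrite normrZ normfV normr_id mulVf// normr_eq0; exact: hp.
have Tpsi k : is_trace oOmega 0 (psi k).
  rewrite -(scaler0 _ (`|g k|^-1)); apply: (is_traceZ bOmega sOmega).
  exact: zero_trace_mul (th p k) T0.
have supp k : \forall x \ae surf, ~ ball p k.+1%:R^-1 x -> psi k x = 0.
  have := Lspace_scaleE (`|g k|^-1) (g k); have := L2class_ae (hL p k phi).
  apply: filterS2 => x /(_ I) E1 /(_ I) E2 npx; rewrite E2 /= E1.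
  by rewrite /h bump_eq0// mul0r scaler0.
have tpsi : totally_bounded (range psi).
  apply: totally_bounded_subset (tE 1) => _ [k _ <-]; exists 0 => //.
  have -> : dirichlet (0 : L2O) 0 = 0.
    by rewrite -{1}(scale0r 0) (dirichletZl bOmega _ _ (H1_0 oOmega bOmega)) mul0r.
  by rewrite add0r npsi expr1n.
clearbody psi.
(* One fixed [k] is close to [psi l] for arbitrarily large [l], while the mass of [psi k] on the
   ball carrying [psi l] tends to 0. *)
have [k Hk] := totally_bounded_recurrent tpsi ltr01.
pose B l := ball p l.+1%:R^-1.
have mB l : measurable (B l) by apply: open_measurable_rV; exact: ball_open.
have mI (S : set 'rV[R]_d) : measurable S -> measurable_fun [set: 'rV[R]_d] (\1_S : _ -> R).
  by move=> mS; exact: measurable_indic.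
have Ib (S : set 'rV[R]_d) x : `|\1_S x : R| <= 1.
  by rewrite indicE; case: (_ \in _); rewrite ?normr1 ?normr0.
have mpsi := Lspace2_measurable (psi k).
have IL (S : set 'rV[R]_d) (mS : measurable S) := Lfun2_bdM (mI S mS) (Ib S) (Lspace2_Lfun (psi k)).
have mp : measurable [set p].
  apply: closed_measurable_rV; apply: (@compact_closed 'rV[R]_d).
    exact: norm_hausdorff.
  exact: compact_set1.
(* Since d >= 2, the Hausdorff measure has positive dimension d - 1 and singletons are null. *)
have np : \forall x \ae surf, x <> p.
  exists [set p]; split=> //; last by move=> x /= /contrapT.
  rewrite /surface/= /mrestr setIidl; last by move=> x ->.
  by apply: hausdorff_set1; rewrite -ltnS prednK// (leq_trans _ d2).
have cv0 : \int[surf]_x (\1_(B l) x * psi k x) ^+ 2 @[l --> \oo] --> (0 : R).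
  have -> : 0 = \int[surf]_x (\1_[set p] x * psi k x) ^+ 2 :> R.
    transitivity (\int[surf]_x (cst 0 x : R)); first by rewrite /Rintegral integral0.
    apply: eq_Rintegral_ae.
    - exact: measurable_cst.
    - by apply: measurable_funX; apply: measurable_funM => //; apply: mI; exact: mp.
    - apply: filterS np => x xp _; rewrite indicE memNset ?mul0r ?expr0n//.
  apply: (@Rdominated_cvg _ _ _ surf _ _ (fun x => psi k x ^+ 2)).
  - by move=> l; apply: measurable_funX; apply: measurable_funM => //; exact: mI.
  - by apply: measurable_funX; apply: measurable_funM => //; apply: mI.
  - by have /Lfun2P[] := Lspace2_Lfun (psi k).
  - move=> l x; rewrite ger0_norm ?sqr_ge0// exprMn ler_piMl ?sqr_ge0//.
  - move=> x; have [->|xp] := eqVneq x p.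
      have -> : (fun l => (\1_(B l) p * psi k p) ^+ 2) = cst ((\1_[set p] p * psi k p) ^+ 2).
        by apply/funext => l; rewrite !indicE !mem_set//; exact: ballxx.
      exact: cvg_cst.
    apply: cvg_near_cst; have px : 0 < `|p - x| by rewrite normr_gt0 subr_eq0 eq_sym.
    have := near_infty_natSinv_lt (PosNum px); apply: filterS => l /= lx.
    have nx : ~ [set p] x by move=> xE; rewrite xE eqxx in xp.
    have nB : ~ B l x by rewrite /B normed_ballE => /(lt_trans lx); rewrite ltxx.
    by rewrite !indicE (memNset nx) (memNset nB).
have [N _ HN] : \forall l \near \oo, \int[surf]_x (\1_(B l) x * psi k x) ^+ 2 < 4^-1.
  have q0 : 0 < 4^-1 :> R by rewrite invr_gt0.
  have /cvgrPdist_lt/(_ _ q0) := cv0; apply: filterS => l.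
  by rewrite sub0r normrN; exact: le_lt_trans (ler_norm _).
have [l Nl kl] := Hk N; have {HN} := HN l Nl => /= small.
have dot : L2dot (psi k) (psi l) = L2dot (L2class surf (fun x => \1_(B l) x * psi k x)) (psi l).
  have mpl := Lspace2_measurable (psi l).
  have ml : measurable_fun [set: 'rV[R]_d] (fun x => \1_(B l) x * psi k x).
    by apply: measurable_funM; [exact: mI|exact: mpsi].
  have refl (y : L2G) : y = (y : _ -> R) %[ae surf] by exact: nearW.
  rewrite (L2dot_ae (refl (psi k)) (refl (psi l)) mpsi mpl).
  rewrite (L2dot_ae (L2class_ae (IL _ (mB l))) (refl (psi l)) ml mpl).
  apply: (eq_Rintegral_ae (measurable_funM mpsi mpl) (measurable_funM ml mpl)).
  apply: filterS (supp l) => x Hx _; rewrite /= indicE.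
  have [Bx|nBx] := pselect (B l x); first by rewrite mem_set// mul1r.
  by rewrite (Hx nBx) !mulr0.
have := L2dot_CauchySchwarz (L2class surf (fun x => \1_(B l) x * psi k x)) (psi l).
rewrite -dot npsi mulr1.
(* A distance below 1 forces the inner product of these unit vectors above 1/2, but it is at most
   the norm of [psi k] restricted to [B l], which is below 1/2. *)
have : `|psi k - psi l| ^+ 2 = 2 - 2 * L2dot (psi k) (psi l).
  rewrite -L2dot_norm L2dotBl !L2dotBr (L2dotC (psi l) (psi k)) !L2dot_norm !npsi.
  by ring.
have : `|psi k - psi l| ^+ 2 < 1 by rewrite expr_lt1.
have : `|L2class surf (fun x => \1_(B l) x * psi k x)| < 2^-1.
  rewrite -(@ltr_pXn2r _ 2)// ?nnegrE// (L2norm_class (IL _ (mB l))).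
  by rewrite (lt_le_trans small)// exprVn -natrX.
move: (`|L2class _ _|) (L2dot _ _) (`|psi k - psi l| ^+ 2) => a b c.
rewrite ler_norml => h1 h2 h3 /andP[_ h4]; clear -h1 h2 h3 h4; lra.
Qed.

End trace_uniqueness.

(** * The trace operator once traces are unique *)

Section trace_operator.
Context {R : realType} {d : nat}.
Variable Omega : set 'rV[R]_d.
Hypotheses (d2 : (2 <= d)%N) (oOmega : open Omega) (bOmega : bounded_set Omega).
Hypothesis sOmega : (hausdorff d.-1 (boundary Omega) < +oo)%E.
Local Notation vol := (volume oOmega).
Local Notation surf := (surface Omega).
Local Notation L2O := (LspaceType2 vol).
Local Notation L2G := (LspaceType2 surf).
Local Notation od := (on_domain oOmega).
Local Notation ob := (on_boundary Omega).
Implicit Types (u w : L2O) (phi psi chi : L2G) (v : 'rV[R]_d -> R).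

Local Opaque Lspace_class Lspace_repr L2class H1norm dirichlet L2dot on_domain on_boundary.

Lemma trace_eq : trace_unique oOmega ->
  forall u phi psi, is_trace oOmega u phi -> is_trace oOmega u psi -> phi = psi.
Proof.
move=> tu u phi psi Tphi Tpsi; apply/eqP; rewrite -subr_eq0; apply/eqP.
by apply: tu; rewrite -(subrr u); exact: (is_traceB bOmega sOmega Tphi Tpsi).
Qed.

(** [Gamma_sigma] is picked by [get], so a candidate has to be exhibited: under uniqueness the whole
    boundary is one. For the set actually picked, the indicator of its complement in the boundary is
    a trace of 0, hence 0 almost everywhere. *)
Lemma Gamma_sigma_null : trace_unique oOmega ->
  measurable (Gamma_sigma oOmega) /\ \forall x \ae surf, Gamma_sigma oOmega x.
Proof.
move=> tu; have mB := measurable_boundary Omega.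
have [] : [/\ measurable (Gamma_sigma oOmega), Gamma_sigma oOmega `<=` boundary Omega &
    [set phi | is_trace oOmega 0 phi] =
    L2Gamma_on (Omega := Omega) (boundary Omega `\` Gamma_sigma oOmega)].
  apply: (@getPex _ [set B | [/\ measurable B, B `<=` boundary Omega &
    [set phi | is_trace oOmega 0 phi] =
    L2Gamma_on (Omega := Omega) (boundary Omega `\` B)]]).
  exists (boundary Omega); split=> //; apply/seteqP; split=> phi /=.
    move=> /tu ->; rewrite /L2Gamma_on/=.
    by apply: filterS (L2_zero_ae surf) => x h _; exact: h.
  rewrite setDv /L2Gamma_on setD0 => phi0.
  suff -> : phi = 0 by exact: is_trace00.
  apply/Lspace_eqP; move: phi0 (surface_ae_boundary Omega) (L2_zero_ae surf).
  by apply: filterS3 => x Hx Bx /(_ I) -> _; exact: Hx.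
set G := Gamma_sigma oOmega => mG GB GE; split; first exact: mG.
have mN : measurable (boundary Omega `\` G) by exact: measurableD.
pose chi := L2class surf (\1_(boundary Omega `\` G) : _ -> R).
have chiL : (\1_(boundary Omega `\` G) : _ -> R) \in Lfun surf 2%:E.
  apply: (surface_bounded_Lfun2 sOmega (M := 1)); first exact: measurable_indic.
  by move=> x; rewrite indicE; case: (_ \in _); rewrite ?normr1 ?normr0.
have chiE := L2class_ae chiL.
have : is_trace oOmega 0 chi.
  rewrite -[is_trace _ _ _]/([set phi | is_trace oOmega 0 phi] chi) GE /L2Gamma_on/=.
  apply: filterS chiE => x + [Bx nx] => /(_ I) ->.
  by rewrite indicE memNset.
move=> /tu chi0; move: chiE; rewrite -/chi chi0 => chiE.
move: chiE (L2_zero_ae surf) (surface_ae_boundary Omega).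
apply: filterS3 => x /(_ I) -> /(_ I) + Bx; rewrite indicE.
have [Gx//|nGx] := pselect (G x); rewrite mem_set//=.
by move=> /eqP; rewrite oner_eq0.
Qed.

(** Since [Gamma_sigma] has full measure, any trace satisfies the support condition in [Tr], and
    uniqueness identifies it with the chosen one. *)
Lemma Tr_trace : trace_unique oOmega ->
  forall u phi, is_trace oOmega u phi -> Tr oOmega u = phi.
Proof.
move=> tu u phi T; have : is_trace oOmega u (Tr oOmega u) /\
    L2Gamma_on (Omega := Omega) (Gamma_sigma oOmega) (Tr oOmega u).
  apply: (@xgetPex _ 0 [set phi | is_trace oOmega u phi /\
     L2Gamma_on (Omega := Omega) (Gamma_sigma oOmega) phi]).
  exists phi; split=> //; rewrite /L2Gamma_on/=.
  by apply: filterS (Gamma_sigma_null tu).2 => x Gx [].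
by move=> [T' _]; exact: trace_eq T' T.
Qed.

Lemma H1sigma_norm_sqr : trace_unique oOmega -> forall u phi, is_trace oOmega u phi ->
  H1sigma_norm oOmega u ^+ 2 = dirichlet u u + `|phi| ^+ 2.
Proof.
move=> tu u phi T; rewrite /H1sigma_norm (Tr_trace tu T).
have -> : \int[surf]_(x in Gamma_sigma oOmega) phi x ^+ 2 = `|phi| ^+ 2.
  have [mG aG] := Gamma_sigma_null tu; have mphi := Lspace2_measurable phi.
  have refl : phi = (phi : _ -> R) %[ae surf] by exact: nearW.
  rewrite -L2dot_norm (L2dot_ae refl refl mphi mphi) Rintegral_mkcond.
  apply: eq_Rintegral_ae.
  - apply/(measurable_restrictT _ _).1; first exact: mG.
    by apply: measurable_funTS; exact: (measurable_funX 2 mphi).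
  - exact: (measurable_funM mphi mphi).
  - by apply: filterS aG => x Gx _; rewrite patchE mem_set//= expr2.
by rewrite sqr_sqrtr// addr_ge0 ?dirichlet_ge0 ?sqr_ge0.
Qed.

Lemma form_compact_trace : compact_map (H1C oOmega) (form_norm oOmega) ob ->
  trace_unique oOmega /\ compact_map (H1sigma oOmega) (H1sigma_norm oOmega) (Tr oOmega).
Proof.
move=> cj; have tE M := energy_traces_totally_bounded bOmega M cj.
have tu := trace_unique_compact d2 bOmega sOmega tE; split=> // B BH [M BM].
apply: totally_bounded_precompact; first exact: L2_complete.
apply: totally_bounded_subset (tE (M ^+ 2)) => _ [u Bu <-].
have [phi T] := BH u Bu; rewrite (Tr_trace tu T); exists u => //.
rewrite -(H1sigma_norm_sqr tu T).
have N0 : 0 <= H1sigma_norm oOmega u by exact: sqrtr_ge0.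
by rewrite lerXn2r// ?nnegrE ?BM// (le_trans N0)// BM.
Qed.

(** Otherwise there are functions with boundary norm 1 and H^1 norm tending to 0. By compactness
    their boundary values cluster at some phi, which is a trace of 0 and so 0, although all of them
    have norm 1. *)
Lemma boundary_bound : trace_unique oOmega ->
  compact_map (H1sigma oOmega) (H1sigma_norm oOmega) (Tr oOmega) ->
  exists2 C : R, 0 <= C & forall v, H1C oOmega v -> `|ob v| <= C * H1norm oOmega (od v).
Proof.
move=> tu cT; apply: contrapT => H.
have /choice[v vP] n : exists v, H1C oOmega v /\ n.+1%:R * H1norm oOmega (od v) < `|ob v|.
  apply: contrapT => Hn; apply: H; exists n.+1%:R => // v Hv.
  by rewrite leNgt; apply/negP => h; apply: Hn; exists v.
have Hv n : H1C oOmega (v n) by case: (vP n).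
have b0 n : 0 < `|ob (v n)|.
  by have [_] := vP n; apply: le_lt_trans; rewrite mulr_ge0// H1norm_ge0.
pose w n := `|ob (v n)|^-1 *: v n.
have Hw n : H1C oOmega (w n) by exact: (H1CZ bOmega _ (Hv n)).
have nb n : `|ob (w n)| = 1.
  by rewrite (on_boundaryZ bOmega sOmega _ (Hv n)) normrZ normfV normr_id mulVf// gt_eqF.
have nd n : H1norm oOmega (od (w n)) < n.+1%:R^-1.
  rewrite (on_domainZ bOmega _ (Hv n)) (H1normZ bOmega _ (H1C_H1 (Hv n))).
  rewrite normfV normr_id mulrC ltr_pdivrMr// mulrC ltr_pdivlMr// mulrC.
  by case: (vP n).
have Tw n := H1C_trace bOmega (Hw n).
have tw : totally_bounded (range (fun n => ob (w n))).
  have /precompact_totally_bounded : precompact (Tr oOmega @` range (fun n => od (w n))).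
    apply: cT => [_ [n _ <-]|]; first by exists (ob (w n)).
    (* The square of this norm is at most 1 + 1: the gradient part is bounded by the H^1 norm, the
       boundary part is 1. *)
    exists 2 => _ [n _ <-]; have N0 : 0 <= H1sigma_norm oOmega (od (w n)) by exact: sqrtr_ge0.
    rewrite -(@ler_pXn2r _ 2)// ?nnegrE// (H1sigma_norm_sqr tu (Tw n)) nb.
    have := dirichlet_le_H1norm (od (w n)); have := H1norm_ge0 (od (w n)).
    have : H1norm oOmega (od (w n)) <= 1.
      by rewrite (le_trans (ltW (nd n)))// invf_le1// ler1n.
    move: (dirichlet _ _) (H1norm _ _) => a b b1 b00 ab.
    have : b ^+ 2 <= 1 by rewrite exprn_ile1.
    by lra.
  by apply: totally_bounded_subset => _ [n _ <-]; exists (od (w n)); [exists n|exact: Tr_trace].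
have [phi Hphi] := totally_bounded_cluster (@L2_complete _ _ _ surf) tw.
have phi0 : phi = 0.
  apply: tu; apply/is_traceP; split=> [|e e0]; first exact: H1_0.
  have [N _ /(_ N (leqnn N)) Ne] := near_infty_natSinv_lt (PosNum e0).
  have [k Nk kphi] := Hphi e e0 N; exists (w k); split; [exact: Hw| |exact: kphi].
  rewrite subr0 (lt_trans (nd k))//; apply: le_lt_trans Ne.
  by rewrite lef_pV2 ?posrE// ler_nat ltnS.
have [k _] := Hphi 1 ltr01 0%N; rewrite phi0 subr0 nb.
by rewrite ltxx.
Qed.

(** By [boundary_bound], H^1 convergence of continuous functions forces convergence of their
    boundary values, which gives every element of [H1tilde] a trace. The same bound makes sets
    bounded in H^1 bounded for [H1sigma_norm]. *)
Lemma trace_compact_H1tilde : trace_unique oOmega ->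
  compact_map (H1sigma oOmega) (H1sigma_norm oOmega) (Tr oOmega) ->
  (forall u, H1tilde oOmega u -> exists! phi, is_trace oOmega u phi) /\
  compact_map (H1tilde oOmega) (H1norm oOmega) (Tr oOmega).
Proof.
move=> tu cT; have [C C0 HC] := boundary_bound tu cT.
have ex u : H1tilde oOmega u -> exists phi, is_trace oOmega u phi.
  move=> [Hu Au].
  have /choice[v vP] n : exists v, H1C oOmega v /\ H1norm oOmega (od v - u) < n.+1%:R^-1.
    by have [|v Hv vu] := Au n.+1%:R^-1; [rewrite invr_gt0|exists v].
  have Hv n : H1C oOmega (v n) by case: (vP n).
  have [phi vphi] : exists phi : L2G, ob (v n) @[n --> \oo] --> phi.
    apply: (@L2_complete _ _ _ surf) => e e0.
    have c0 : 0 < C + 1 by rewrite ltr_wpDl.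
    have e1 : 0 < e / (C + 1) / 2 by rewrite !divr_gt0.
    have [N _ NP] := near_infty_natSinv_lt (PosNum e1).
    exists N => m n Nm Nn; rewrite -(on_boundaryB bOmega sOmega (Hv m) (Hv n)).
    apply: (le_lt_trans (HC _ (H1CB bOmega (Hv m) (Hv n)))).
    rewrite (on_domainB bOmega (Hv m) (Hv n)).
    have h1 := H1norm_triangle bOmega (H1C_H1 (Hv m)) Hu (H1C_H1 (Hv n)).
    rewrite (H1norm_distrC bOmega Hu (H1C_H1 (Hv n))) in h1.
    have h2 := lt_trans (vP m).2 (NP m Nm); have h3 := lt_trans (vP n).2 (NP n Nn).
    have := le_lt_trans h1 (ltr_half_add h2 h3); rewrite ltr_pdivlMr//.
    have := H1norm_ge0 (od (v m) - od (v n)).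
    move: (H1norm _ _) => t t0; apply: le_lt_trans; rewrite mulrC ler_wpM2l//.
    by rewrite lerDl.
  exists phi; split=> //; exists v; split=> //.
  apply/cvgrPdist_lt => e e0; have := near_infty_natSinv_lt (PosNum e0).
  apply: filterS => n /= ne; have [_ vn] := vP n.
  by rewrite sub0r normrN (ger0_norm (H1norm_ge0 _)) (lt_trans vn).
have bd u phi : is_trace oOmega u phi -> `|phi| <= C * H1norm oOmega u.
  move=> /is_traceP[Hu T]; apply/ler_addgt0Pr => e e0.
  have c0 : 0 < C + 1 by rewrite ltr_wpDl.
  have [v [Hv vu vphi]] := T _ (divr_gt0 e0 c0); have H1v := H1C_H1 Hv.
  have h1 : `|phi| <= `|ob v| + `|ob v - phi|.
    by rewrite -{1}[phi](subKr (ob v)) ler_normB.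
  have h2 : H1norm oOmega (od v) <= H1norm oOmega u + H1norm oOmega (od v - u).
    rewrite -{1}[od v](subrK u) addrC.
    exact: (H1normD bOmega Hu (H1B bOmega H1v Hu)).
  have h3 := HC v Hv; move: vu vphi; rewrite !ltr_pdivlMr//.
  move: (`|phi|) (`|ob v|) (`|ob v - phi|) (H1norm oOmega (od v)) (H1norm oOmega u)
    (H1norm oOmega (od v - u)) h1 h2 h3 => a b c p q r h1 h2 h3 h4 h5.
  have h6 : C * p <= C * (q + r) by rewrite ler_wpM2l.
  apply: (le_trans h1); apply: (le_trans (lerD h3 (lexx c))).
  apply: (le_trans (lerD h6 (lexx c))); rewrite mulrDr -addrA lerD2l.
  have [rc|/ltW cr] := leP r c.
    have h7 : C * r <= C * c by rewrite ler_wpM2l.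
    by apply: (le_trans _ (ltW h5)); rewrite mulrDr mulr1 [c * C]mulrC lerD2r.
  by apply: (le_trans _ (ltW h4)); rewrite mulrDr mulr1 [r * C]mulrC lerD2l.
split=> [u Hu|B BH [M BM]].
  by have [phi T] := ex u Hu; exists phi; split; [exact: T|move=> psi T'; exact: (trace_eq tu T T')].
apply: cT => [u /BH/ex[phi T]|]; first by exists phi.
exists (Num.sqrt (M ^+ 2 + (C * M) ^+ 2)) => u Bu.
have [phi T] := ex u (BH u Bu); have N0 : 0 <= H1sigma_norm oOmega u by exact: sqrtr_ge0.
have uM := BM u Bu; have u0 := H1norm_ge0 u.
rewrite -(@ler_pXn2r _ 2)// ?nnegrE ?sqrtr_ge0// (H1sigma_norm_sqr tu T).
rewrite sqr_sqrtr ?addr_ge0 ?sqr_ge0// lerD//.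
  apply: (le_trans (dirichlet_le_H1norm u)).
  by rewrite lerXn2r// nnegrE// (le_trans u0).
rewrite lerXn2r// ?nnegrE//; first by rewrite mulr_ge0// (le_trans u0).
by apply: (le_trans (bd u phi T)); rewrite ler_wpM2l.
Qed.

Lemma H1tilde_compact_resolvent :
  (forall u, H1tilde oOmega u -> exists! phi, is_trace oOmega u phi) ->
  compact_map (H1tilde oOmega) (H1norm oOmega) (Tr oOmega) ->
  compact_resolvent (DtN oOmega).
Proof.
move=> eu cT.
(* The continuous functions that define a trace of u also approximate u in H^1. *)
have Ht u phi : is_trace oOmega u phi -> H1tilde oOmega u.
  move=> /is_traceP[Hu T]; split=> // e e0.
  by have [v [Hv vu _]] := T e e0; exists v.
have tu : trace_unique oOmega.
  move=> phi T; have [psi [_ H]] := eu 0 (Ht _ _ T).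
  by rewrite -(H _ T); apply: H; exact: is_trace00.
(* The datum is -f because - phi - D_0 phi = f reads D_0 phi + phi = -f. *)
have /choice[S SP] f : exists p : L2O * L2G, weak_solution (- f) p.1 p.2.
  by have [u [phi S]] := trace_riesz d2 oOmega bOmega sOmega (- f); exists (u, phi).
pose Tf f := (S f).2.
have Tlin : linear Tf.
  move=> k f g; have := weak_solutionD bOmega sOmega (weak_solutionZ bOmega sOmega k (SP f)) (SP g).
  rewrite scalerN -opprD => W.
  exact: (weak_solution_unique bOmega sOmega (SP (k *: f + g)) W).
pose T : {linear L2G -> L2G} := HB.pack_for {linear L2G -> L2G} Tf
  (GRing.isLinear.Build R L2G L2G *:%R Tf Tlin).
have TE f : T f = Tf f by [].
have nT f : `|T f| <= `|f|.
  by have [] := weak_solution_bound (SP f); rewrite normrN.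
have Tc : continuous T.
  move=> f A /nbhs_ballP[e /= e0 eA]; apply/(@nbhs_ballP R L2G); exists e => // g fg.
  have fg' : `|(f : L2G) - g| < e by rewrite -(@normed_ballE R L2G).
  apply: eA; have := @normed_ballE R L2G (T f) (T g) e => ->.
  by rewrite -linearB; exact: (le_lt_trans (nT (f - g)) fg').
exists (-1), T; split; first split.
- exact: Tc.
- move=> f phi; split=> [Tphi|[psi Dpsi E]].
    exists (- f - phi); last by rewrite scaleN1r opprB opprK addKr.
    by rewrite -Tphi; exact: (weak_solution_DtN bOmega (SP f)).
  have [u W] := DtN_weak_solution bOmega Dpsi.
  have -> : f = - (phi + psi) by rewrite -E scaleN1r opprD.
  rewrite TE; have := SP (- (phi + psi)); rewrite opprK => W'.
  exact: (weak_solution_unique bOmega sOmega W' W).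
- move=> B _ [M BM].
  have [C C0 HC] := trace_friedrichs d2 oOmega bOmega sOmega.
  (* The map factors through the solution u, which [trace_friedrichs] bounds in H^1 by the datum. *)
  have -> : T @` B = Tr oOmega @` [set (S f).1 | f in B].
    rewrite image_comp; apply: eq_imagel => f Bf /=.
    by rewrite (Tr_trace tu (SP f).1).
  apply: cT => [_ [f Bf <-]|]; first exact: Ht (SP f).1.
  exists (Num.sqrt (C * M ^+ 2)) => _ [f Bf <-].
  have [_ E] := weak_solution_bound (SP f); rewrite normrN in E.
  have fM := BM f Bf; have M0 : 0 <= M by apply: le_trans fM.
  rewrite -(@ler_pXn2r _ 2)// ?nnegrE ?sqrtr_ge0 ?H1norm_ge0//.
  rewrite (@sqr_sqrtr _ (C * M ^+ 2)); last by rewrite mulr_ge0 ?sqr_ge0// ltW.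
  apply: (le_trans (HC _ _ (SP f).1)); rewrite ler_wpM2l ?(ltW C0)//.
  by rewrite (le_trans E)// lerXn2r// nnegrE.
Qed.

End trace_operator.

Theorem proposition7p1 (R : realType) (d : nat) (Omega : set 'rV[R]_d)
    (oOmega : open Omega) :
  (2 <= d)%N -> bounded_set Omega -> connected Omega ->
  (hausdorff d.-1 (boundary Omega) < +oo)%E ->
  [<-> compact_resolvent (DtN oOmega);
       compact_map (H1C oOmega) (form_norm oOmega) (on_boundary Omega);
       trace_unique oOmega /\
         compact_map (H1sigma oOmega) (H1sigma_norm oOmega) (Tr oOmega);
       (forall u, H1tilde oOmega u -> exists! phi, is_trace oOmega u phi) /\
         compact_map (H1tilde oOmega) (H1norm oOmega) (Tr oOmega)].
Proof.
move=> d2 bOmega _ sOmega; tfae.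
- exact: resolvent_compact_form.
- exact: form_compact_trace.
- by move=> [tu cT]; exact: trace_compact_H1tilde.
- by move=> [eu cT]; exact: H1tilde_compact_resolvent.
Qed.
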